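(* For any two persistent spaces $\mathbf{X},\mathbf{Y}:(\mathbb{R},\leq)\to\mathbf{Top}$, $$d_{\mathrm{E}}(\mathbf{cup}(\mathbf{X}),\mathbf{cup}(\mathbf{Y}))\leq d_{\mathrm{HI}}(\mathbf{X},\mathbf{Y}).$$ For the Vietoris-Rips filtrations $\mathbf{VR}(X)$ and $\mathbf{VR}(Y)$ of compact metric spaces $X$ and $Y$, $$d_{\mathrm{E}}\left(\mathbf{cup}(\mathbf{VR}(X)),\mathbf{cup}(\mathbf{VR}(Y))\right)\leq 2\cdot d_{\mathrm{GH}}(X,Y),$$ where $d_{\mathrm{GH}}$ is the Gromov-Hausdorff distance.
   Context: $\mathbf{Top}$ is the category of compactly generated weak Hausdorff spaces; a persistent space is a functor $(\mathbb{R},\le)\to\mathbf{Top}$, $t\mapsto\mathbb{X}_t$. Standing assumption: only persistent spaces with a discrete set of critical values are considered, where $t$ is a critical value of $\mathbf{X}$ if there is no neighbourhood of $t$ on which all the maps $\mathbf{H}^*(\mathbb{X}_{s'})\to\mathbf{H}^*(\mathbb{X}_{s})$, $s\le s'$, are isomorphisms. $\mathbf{H}^*$ is the cohomology ring with coefficients in a fixed field $K$. Persistent cup-length function. The length $\mathbf{len}(R)\in\mathbb{N}$ of a graded ring $R=\bigoplus_{p\ge0}R_p$ is the largest non-negative integer $\ell$ such that there are homogeneous $\eta_1,\dots,\eta_\ell$ of positive degree with $\eta_1\cdots\eta_\ell\neq0$ (it is $0$ if there are no non-zero elements of positive degree). $\mathbf{Int}$ is the set of closed intervals $[a,b]$,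 $a\le b$ real. The function $\mathbf{cup}(\mathbf{X}):\mathbf{Int}\to\mathbb{N}$ is $\mathbf{cup}(\mathbf{X})([a,b]):=\mathbf{len}(\mathbf{Im}(\mathbf{H}^*(\mathbb{X}_b)\to\mathbf{H}^*(\mathbb{X}_a)))$. Erosion distance. Two functors $J_1,J_2:(\mathbf{Int},\subseteq)\to(\mathbb{N},\geq)$ (that is, order-reversing functions) are $\varepsilon$-eroded if $J_1([a,b])\ge J_2([a-\varepsilon,b+\varepsilon])$ and $J_2([a,b])\ge J_1([a-\varepsilon,b+\varepsilon])$ for all $[a,b]\in\mathbf{Int}$. $d_{\mathrm{E}}(J_1,J_2)$ is the infimum of the $\varepsilon\ge0$ for which they are $\varepsilon$-eroded ($\infty$ if none). Interleaving distance. Functors $\mathbf{F},\mathbf{G}:(\mathbb{R},\le)\to\mathcal{C}$ with transition morphisms $f_a^b,g_a^b$ are $\varepsilon$-interleaved if there are morphisms $\varphi_t:\mathbf{F}_t\to\mathbf{G}_{t+\varepsilon}$, $\psi_t:\mathbf{G}_t\to\mathbf{F}_{t+\varepsilon}$, natural in $t\in\mathbb{R}$, with $\psi_{t+\varepsilon}\circ\varphi_t=f_t^{t+2\varepsilon}$ and $\varphi_{t+\varepsilon}\circ\psi_t=g_t^{t+2\varepsilon}$; $d_{\mathrm{I}}^{\mathcal{C}}(\mathbf{F},\mathbf{G})$ is the infimum of such $\varepsilon\ge0$. Homotopy interleaving distance. Persistent spaces $\mathbf{X},\mathbf{X}'$ are weakly equivalent, $\mathbf{X}\simeq\mathbf{X}'$,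 if there are a persistent space $\mathbf{Z}$ and natural transformations $\mathbf{Z}\Rightarrow\mathbf{X}$, $\mathbf{Z}\Rightarrow\mathbf{X}'$ that are weak homotopy equivalences at each $t$. $d_{\mathrm{HI}}(\mathbf{X},\mathbf{Y}):=\inf\{d_{\mathrm{I}}^{\mathbf{Top}}(\mathbf{X}',\mathbf{Y}') : \mathbf{X}'\simeq\mathbf{X},\ \mathbf{Y}'\simeq\mathbf{Y}\}$. Vietoris-Rips filtration. $\mathbf{VR}_t(X)$ is the simplicial complex of finite non-empty subsets of $X$ of diameter $\le t$; $\mathbf{VR}(X)$ is the persistent space $t\mapsto|\mathbf{VR}_t(X)|$ for $t\ge0$, and $t\mapsto|\mathbf{VR}_0(X)|$ for $t<0$, with inclusions as transition maps. *)

(* Defs.v *)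
From HB Require Import structures.
From mathcomp Require Import all_boot all_order all_algebra.
From mathcomp Require Import generic_quotient ring_quotient.
From mathcomp Require Import all_classical all_reals.
From mathcomp Require Import zify.
From mathcomp Require Import topology ereal normedtype.

Set Implicit Arguments.
Unset Strict Implicit.
Unset Printing Implicit Defensive.

Import Order.TTheory GRing.Theory Num.Theory.
Import numFieldNormedType.Exports.

Local Open Scope classical_set_scope.
Local Open Scope ring_scope.
Local Open Scope quotient_scope.

(* Two homogeneous elements of possibly different-looking degrees (p + (q + r)
   and p + q + r, say) are compared in the total space {p & R_p}. *)
Record gradedRing := GradedRing {
  gcomp :> nat -> zmodType;
  gone : gcomp 0;
  gmul : forall p q, gcomp p -> gcomp q -> gcomp (p + q)%N;
  gmulDl : forall p q (x x' : gcomp p) (y : gcomp q),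
    gmul (x + x') y = gmul x y + gmul x' y;
  gmulDr : forall p q (x : gcomp p) (y y' : gcomp q),
    gmul x (y + y') = gmul x y + gmul x y';
  gmulA : forall p q r (x : gcomp p) (y : gcomp q) (z : gcomp r),
    Tagged gcomp (gmul x (gmul y z)) = Tagged gcomp (gmul (gmul x y) z);
  gmul1l : forall p (x : gcomp p), Tagged gcomp (gmul gone x) = Tagged gcomp x;
  gmul1r : forall p (x : gcomp p), Tagged gcomp (gmul x gone) = Tagged gcomp x }.

Definition homogeneous (A : gradedRing) := {p : nat & A p}.

Definition hmul (A : gradedRing) (x y : homogeneous A) : homogeneous A :=
  Tagged (gcomp A) (gmul (tagged x) (tagged y)).

Definition hprod (A : gradedRing) (s : seq (homogeneous A)) : homogeneous A :=
  foldr (@hmul A) (Tagged (gcomp A) (gone A)) s.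

(* The length takes values in the extended numbers: it is the largest admissible
   l when there is one and +oo when the admissible l are unbounded. *)
Definition cup_lengths (A : gradedRing) : set nat :=
  [set l | l = 0%N \/ exists s : seq (homogeneous A),
    [/\ size s = l, all (fun x => 0 < tag x)%N s & tagged (hprod s) != 0]].

Definition len (R : realType) (A : gradedRing) : \bar R :=
  ereal_sup [set (l%:R)%:E | l in cup_lengths A].

Record gradedHom (A B : gradedRing) := GradedHom {
  ghom :> forall p, A p -> B p;
  ghomD : forall p (x y : A p), ghom (x + y) = ghom x + ghom y;
  ghom1 : ghom (gone A) = gone B;
  ghomM : forall p q (x : A p) (y : A q),
    ghom (gmul x y) = gmul (ghom x) (ghom y) }.

Section Image.
Variables (A B : gradedRing) (f : gradedHom A B).

Lemma ghom0 p : f p 0 = 0.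
Proof. by apply: (addrI (f p 0)); rewrite -ghomD !addr0. Qed.

Lemma ghomN p (x : A p) : f p (- x) = - f p x.
Proof. by apply: (addrI (f p x)); rewrite -ghomD !subrr ghom0. Qed.

Definition gim_pred p : {pred B p} := fun y => `[< exists x, f p x = y >].

Lemma gim_zmod_closed p : zmod_closed (@gim_pred p).
Proof.
split=> [|y y' /asboolP[x xy] /asboolP[x' xy']]; apply/asboolP.
  by exists 0; exact: ghom0.
by exists (x - x'); rewrite ghomD ghomN xy xy'.
Qed.

HB.instance Definition _ p :=
  GRing.isZmodClosed.Build (B p) (@gim_pred p) (gim_zmod_closed p).

Definition gim_comp p := {y : B p | y \in @gim_pred p}.
HB.instance Definition _ p := SubType.on (gim_comp p).
HB.instance Definition _ p := Choice.on (gim_comp p).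
HB.instance Definition _ p :=
  [SubChoice_isSubZmodule of gim_comp p by <:].

Lemma gim_one_subproof : gone B \in @gim_pred 0.
Proof. by apply/asboolP; exists (gone A); exact: ghom1. Qed.

Lemma gim_mul_subproof p q (x : gim_comp p) (y : gim_comp q) :
  gmul (val x) (val y) \in @gim_pred (p + q).
Proof.
case: x y => x /= /asboolP[a <-] [y /= /asboolP[b <-]].
by apply/asboolP; exists (gmul a b); exact: ghomM.
Qed.

Definition gim_one : gim_comp 0 := exist _ (gone B) gim_one_subproof.
Definition gim_mul p q (x : gim_comp p) (y : gim_comp q) : gim_comp (p + q) :=
  exist _ (gmul (val x) (val y)) (gim_mul_subproof x y).

Lemma gim_tagged_inj p q (x : gim_comp p) (y : gim_comp q) :
  Tagged (gcomp B) (val x) = Tagged (gcomp B) (val y) ->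
  Tagged gim_comp x = Tagged gim_comp y.
Proof.
move=> exy; have epq : p = q := congr1 tag exy.
case: _ / epq y exy => y exy; congr (Tagged _ _); apply: val_inj.
exact: eq_from_Tagged exy.
Qed.

Program Definition image_gradedRing : gradedRing :=
  @GradedRing (fun p => gim_comp p : zmodType) gim_one gim_mul _ _ _ _ _.
Next Obligation. by move=> *; apply: val_inj; exact: gmulDl. Qed.
Next Obligation. by move=> *; apply: val_inj; exact: gmulDr. Qed.
Next Obligation. by move=> *; apply: gim_tagged_inj; exact: gmulA. Qed.
Next Obligation. by move=> *; apply: gim_tagged_inj; exact: gmul1l. Qed.
Next Obligation. by move=> *; apply: gim_tagged_inj; exact: gmul1r. Qed.

End Image.

Section Simplex.
Variable R : realType.

Definition simplex n : set 'rV[R]_n.+1 :=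
  [set x | (forall i, 0 <= x ord0 i) /\ \sum_i x ord0 i = 1].
Arguments simplex n _ : clear implicits.

Definition Delta n : topologicalType := set_type (simplex n).

Definition simplex_coord m n (th : 'I_m.+1 -> 'I_n.+1) (x : 'rV[R]_m.+1) :
    'rV[R]_n.+1 :=
  \row_j \sum_(i | th i == j) x ord0 i.

Lemma simplex_coord_in m n (th : 'I_m.+1 -> 'I_n.+1) (x : Delta m) :
  simplex_coord th (val x) \in simplex n.
Proof.
case: x => x /= /set_mem[x0 x1]; apply/mem_set; split => [j|].
  by rewrite mxE sumr_ge0.
under eq_bigr do rewrite mxE.
by rewrite (exchange_big_dep predT) //= -x1; apply: eq_bigr => i _;
  rewrite (big_pred1 (th i)) // => j /=; rewrite eq_sym.
Qed.

Lemma simplex_coordP n (i : 'I_n.+1) :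
  continuous (fun x : Delta n => val x ord0 i).
Proof.
move=> x.
have cc : continuous (fun y : 'rV[R]_n.+1 => y ord0 i) := @coord_continuous _ _ _ _ _.
have cv : continuous (set_val : set_type (simplex n) -> 'rV[R]_n.+1) :=
  @initial_continuous _ _ _.
exact: (continuous_comp (cv x) (cc _)).
Qed.

Lemma simplex_sum_continuous n (P : pred 'I_n.+1) :
  continuous (fun x : Delta n => \sum_(i | P i) val x ord0 i).
Proof.
apply: (@continuous_big R _ +%R 0 P _ (Delta n) _
  (fun i (x : Delta n) => val x ord0 i)) => [|i _].
- exact: add_continuous.
- exact: simplex_coordP.
Qed.

Lemma continuous_to_simplex (T : topologicalType) n (f : T -> Delta n) :
  (forall j, continuous (fun x => val (f x) ord0 j)) -> continuous f.
Proof.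
move=> cf; apply: (@continuous_comp_initial _ T _ set_val f) => x U [P xP PU].
have : \forall y \near x, forall i j, P i j (val (f y) i j).
  apply: filter_forall => i; apply: filter_forall => j.
  by have := xP i j; rewrite (ord1 i) => /(cf j x).
by apply: filterS => y yP; exact: PU.
Qed.

Definition simplex_fun m n (th : 'I_m.+1 -> 'I_n.+1) (x : Delta m) : Delta n :=
  exist (fun y => y \in simplex n) _ (simplex_coord_in th x).

Lemma simplex_fun_continuous m n (th : 'I_m.+1 -> 'I_n.+1) :
  continuous (simplex_fun th).
Proof.
apply: continuous_to_simplex => j.
under eq_fun do rewrite /= mxE.
exact: simplex_sum_continuous.
Qed.

HB.instance Definition _ m n th :=
  @isContinuous.Build _ _ _ (@simplex_fun_continuous m n th).

Definition simplex_map m n th : continuousType (Delta m) (Delta n) :=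
  @simplex_fun m n th.

Lemma simplex_map_comp l m n (th : 'I_m.+1 -> 'I_n.+1) (ph : 'I_l.+1 -> 'I_m.+1) x :
  simplex_map th (simplex_map ph x) = simplex_map (th \o ph) x.
Proof.
apply: val_inj; apply/rowP => j /=; rewrite !mxE.
under eq_bigr do rewrite mxE.
rewrite (exchange_big_dep (fun i => th (ph i) == j)) /=; last first.
  by move=> i k /eqP <- /eqP <-.
apply: eq_bigr => i /eqP ij; rewrite (big_pred1 (ph i)) // => k /=.
by rewrite [k == _]eq_sym andb_idl // => /eqP <-; apply/eqP.
Qed.

Lemma simplex_map_id n x : simplex_map (@id 'I_n.+1) x = x.
Proof. 
apply: val_inj; apply/rowP => j; rewrite !mxE (big_pred1 j) //.
 Qed.

End Simplex.
Arguments simplex R n _ : clear implicits.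

Section SingularCohomology.
Variables (R : realType) (K : fieldType).

Section Cochains.
Variable X : topologicalType.

Definition sing n := continuousType (Delta R n) X.

(* [sing_op m f s] is the singular m-simplex obtained by restricting s along the
   affine map of standard simplices given on vertices by k |-> f k. *)
Definition sing_op n m (f : nat -> nat) (s : sing n) : sing m :=
  s \o simplex_map R (fun k : 'I_m.+1 => inord (f k) : 'I_n.+1).

Definition cochain n := sing n -> K.

(* bump i skips the vertex i: this is the i-th face. *)
Definition coboundary n (c : cochain n) : cochain n.+1 := fun s =>
  \sum_(i < n.+2) (-1) ^+ i * c (sing_op n (bump i) s).

(* Alexander-Whitney formula: front p-face times back q-face. *)
Definition cup_cochain p q (a : cochain p) (b : cochain q) :
    cochain (p + q) := fun s =>
  a (sing_op p id s) * b (sing_op q (addn p) s).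

Lemma sing_op_comp n m l (f g : nat -> nat) (s : sing n) :
  (forall k, (k <= l)%N -> (g k <= m)%N) ->
  sing_op l g (sing_op m f s) = sing_op l (f \o g) s.
Proof.
move=> gm; apply/continuousEP => x /=; rewrite -[LHS]/(s _) -[RHS]/(s _).
congr (s _); rewrite [LHS]simplex_map_comp; congr (simplex_map R _ x).
apply/funext => k /=; congr inord; congr f.
by rewrite inordK // ltnS gm // -ltnS.
Qed.

Lemma eq_sing_op n m (f g : nat -> nat) (s : sing n) :
  (forall k, (k <= m)%N -> f k = g k) -> sing_op m f s = sing_op m g s.
Proof.
move=> fg; rewrite /sing_op; congr (_ \o simplex_map R _ : continuousType _ _).
by apply/funext => k; rewrite fg // -ltnS.
Qed.

Lemma sing_op_id n (f : nat -> nat) (s : sing n) :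
  (forall k, (k <= n)%N -> f k = k) -> sing_op n f s = s.
Proof.
move=> fid; rewrite (eq_sing_op (g := id) s fid).
apply/continuousEP => x; rewrite -[LHS]/(s _); congr (s _).
rewrite -[RHS]simplex_map_id; congr (simplex_map R _ x).
by apply/funext => k; rewrite inord_val.
Qed.

Lemma cochain_eq_tagged p q (a : cochain p) (b : cochain q) : p = q ->
  (forall s : sing p, a s = b (sing_op q id s)) ->
  Tagged cochain a = Tagged cochain b.
Proof.
move=> epq; case: q / epq b => b ab; congr (Tagged _ _).
by apply/funext => s; rewrite ab sing_op_id.
Qed.

Lemma coboundaryB n (a b : cochain n) :
  coboundary (a - b) = coboundary a - coboundary b.
Proof.
apply/funext => s; rewrite -[RHS]/(coboundary a s - coboundary b s) -sumrB.
by apply: eq_bigr => i _; rewrite mulrBr.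
Qed.

Lemma coboundary0 n : coboundary (0 : cochain n) = 0.
Proof. by rewrite -[0 in LHS](subrr 0) coboundaryB subrr. Qed.

Lemma bump_le i k : (i <= k -> bump i k = k.+1)%N.
Proof. by rewrite /bump => ->. Qed.

Lemma bump_gt i k : (k < i -> bump i k = k)%N.
Proof. by rewrite /bump => ki; rewrite leqNgt ki. Qed.

Lemma leq_bump_succ i k m : (k <= m -> bump i k <= m.+1)%N.
Proof. by move=> km; rewrite /bump -add1n leq_add // leq_b1. Qed.

Lemma coboundary_cup p q (a : cochain p) (b : cochain q)
    (s : sing (p + q).+1) :
  coboundary (cup_cochain a b) s =
    coboundary a (sing_op p.+1 id s) * b (sing_op q (addn p.+1) s)
    + (-1) ^+ p * (a (sing_op p id s) * coboundary b (sing_op q.+1 (addn p) s)).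
Proof.
pose F i : K := (-1) ^+ i * (a (sing_op p (bump i) s) * b (sing_op q (bump i \o addn p) s)).
have -> : coboundary (cup_cochain a b) s = \sum_(0 <= i < (p + q).+2) F i.
  rewrite big_mkord; apply: eq_bigr => i _; rewrite /cup_cochain !sing_op_comp //.
    by move=> k kq; rewrite leq_add2l.
  by move=> k kp; rewrite (leq_trans kp) // leq_addr.
rewrite (@big_cat_nat _ _ _ p.+1) //=; last by rewrite ltnS -addnS leq_addr.
have -> : coboundary a (sing_op p.+1 id s) * b (sing_op q (addn p.+1) s) =
    \sum_(0 <= i < p.+1) F i
    + (-1) ^+ p.+1 * (a (sing_op p id s) * b (sing_op q (addn p.+1) s)).
  rewrite /coboundary big_ord_recr /= mulrDl mulrA; congr (_ + _).
    rewrite big_mkord mulr_suml; apply: eq_bigr => i _.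
    rewrite /F mulrA sing_op_comp => [|k]; last exact: leq_bump_succ.
    congr (_ * b _); apply: eq_sing_op => k _ /=.
    by rewrite bump_le //; apply: leq_trans (leq_addr _ _); rewrite -ltnS.
  rewrite sing_op_comp => [|k]; last exact: leq_bump_succ.
  congr (_ * a _ * _); apply: eq_sing_op => k kp /=.
  by rewrite bump_gt.
have -> : (-1) ^+ p * (a (sing_op p id s) * coboundary b (sing_op q.+1 (addn p) s))
    = (-1) ^+ p * (a (sing_op p id s) * b (sing_op q (addn p.+1) s))
      + \sum_(p.+1 <= i < (p + q).+2) F i.
  rewrite /coboundary big_ord_recl mulrDr mulrDr expr0 mul1r; congr (_ + _).
    rewrite sing_op_comp => [|k]; last exact: leq_bump_succ.
    by congr (_ * (_ * b _)); apply: eq_sing_op => k kp /=; rewrite bump_le // addSnnS.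
  have -> : (p + q).+2 = (q.+1 + p.+1)%N by rewrite addnS addSn addnC.
  rewrite -[X in \sum_(X <= _ < _) _]add0n big_addn addnK big_mkord.
  rewrite !mulr_sumr; apply: eq_bigr => i _.
  have -> : (i + p.+1 = p + i.+1)%N by rewrite addnC addSnnS.
  rewrite sing_op_comp => [|k]; last exact: leq_bump_succ.
  rewrite [a _ * (_ * _)]mulrCA [LHS]mulrA -exprD /F.
  congr (_ * (a _ * b _)); apply: eq_sing_op => k kp /=.
    by rewrite bump_gt // (leq_ltn_trans kp) // -addSnnS leq_addr.
  by rewrite /bump leq_add2l addnCA.
rewrite exprS mulN1r mulNr -addrA; congr (_ + _).
by rewrite addrA addNr add0r.
Qed.

End Cochains.
End SingularCohomology.

Section CohomologyRing.
Variables (R : realType) (K : fieldType) (X : topologicalType).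
Local Notation cochain := (cochain R K X).

Definition is_cocycle n : {pred cochain n} := fun c => coboundary c == 0.

Lemma cocycle_zmod_closed n : zmod_closed (@is_cocycle n).
Proof.
split=> [|a b /eqP a0 /eqP b0]; apply/eqP; first exact: coboundary0.
by rewrite coboundaryB a0 b0 subrr.
Qed.

HB.instance Definition _ n :=
  GRing.isZmodClosed.Build (cochain n) (@is_cocycle n) (@cocycle_zmod_closed n).

Definition cocycle n := {c : cochain n | c \in @is_cocycle n}.
HB.instance Definition _ n := SubType.on (cocycle n).
HB.instance Definition _ n := Choice.on (cocycle n).
HB.instance Definition _ n := [SubChoice_isSubZmodule of cocycle n by <:].

Lemma cocycleP n (z : cocycle n) : coboundary (val z) = 0.
Proof. exact/eqP/(valP z). Qed.

Definition is_coboundary n : {pred cocycle n} :=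
  match n with
  | 0 => fun z => val z == 0
  | m.+1 => fun z => `[< exists c : cochain m, coboundary c = val z >]
  end.

Lemma coboundary_zmod_closed n : zmod_closed (@is_coboundary n).
Proof.
case: n => [|n]; split=> //.
- exact: eqxx.
- by move=> a b /eqP a0 /eqP b0; apply/eqP; rewrite raddfB /= a0 b0 subrr.
- by apply/asboolP; exists 0; exact: coboundary0.
- move=> a b /asboolP[c ca] /asboolP[d db]; apply/asboolP; exists (c - d).
  by rewrite coboundaryB raddfB /= ca db.
Qed.

HB.instance Definition _ n :=
  GRing.isZmodClosed.Build (cocycle n) (@is_coboundary n)
    (@coboundary_zmod_closed n).

Definition cohomology_group n : zmodType := Quotient.quot (@is_coboundary n).

Definition cohomology_class n (z : cocycle n) : cohomology_group n :=
  \pi_(Quotient.quot (@is_coboundary n)) z.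

Lemma cohomology_classK n (x : cohomology_group n) :
  cohomology_class (repr x) = x.
Proof. exact: reprK. Qed.

Lemma cohomology_groupP n (z z' : cocycle n) :
  cohomology_class z = cohomology_class z' <->
  is_coboundary (z - z').
Proof.
split=> [/eqP|zz']; first by rewrite -Quotient.idealrBE.
by apply/eqP; rewrite -Quotient.idealrBE.
Qed.

Lemma cup_is_cocycle p q (a : cocycle p) (b : cocycle q) :
  cup_cochain (val a) (val b) \in @is_cocycle (p + q).
Proof.
apply/eqP/funext => s; rewrite coboundary_cup !cocycleP.
by rewrite mul0r mulr0 mulr0 addr0.
Qed.

Definition cup_cocycle p q (a : cocycle p) (b : cocycle q) : cocycle (p + q) :=
  exist (fun c => c \in @is_cocycle (p + q)) _ (cup_is_cocycle a b).

Lemma one_is_cocycle : ((fun=> 1) : cochain 0) \in @is_cocycle 0.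
Proof.
apply/eqP/funext => s; rewrite /coboundary !big_ord_recl big_ord0 /=.
by rewrite expr0 expr1 !mulr1 addr0 subrr.
Qed.

Definition one_cocycle : cocycle 0 :=
  exist (fun c => c \in @is_cocycle 0) _ one_is_cocycle.

Definition cohomology_one : cohomology_group 0 := cohomology_class one_cocycle.

Definition cup_product p q (x : cohomology_group p) (y : cohomology_group q) :
    cohomology_group (p + q) := cohomology_class (cup_cocycle (repr x) (repr y)).

Lemma is_coboundaryI n m (z : cocycle n) (c : cochain m) : m.+1 = n ->
  (forall s, val z s = coboundary c (sing_op m.+1 id s)) -> is_coboundary z.
Proof.
move=> emn; case: n / emn z => z zc; apply/asboolP; exists c.
by apply/funext => s; rewrite zc sing_op_id.
Qed.

Lemma is_coboundary_eq0 n (z : cocycle n) :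
  (forall s, val z s = 0) -> is_coboundary z.
Proof.
move=> z0; have -> : z = 0 by apply: val_inj; apply/funext => s; exact: z0.
exact: (rpred0 (@is_coboundary n)).
Qed.

Lemma cup_coboundaryl p q (a : cocycle p) (b : cocycle q) :
  is_coboundary a -> is_coboundary (cup_cocycle a b).
Proof.
case: p a => [|p] a.
  move=> /eqP a0; apply: is_coboundary_eq0 => s /=.
  by rewrite /cup_cochain a0 mul0r.
move=> H; have {H}/asboolP[c ca] : `[< exists c, coboundary c = val a >] := H.
apply: (is_coboundaryI (c := cup_cochain c (val b))) => // s.
rewrite coboundary_cup cocycleP mulr0 mulr0 addr0 ca /= /cup_cochain.
by rewrite !sing_op_comp // => k; lia.
Qed.

Lemma cup_coboundaryr p q (a : cocycle p) (b : cocycle q) :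
  is_coboundary b -> is_coboundary (cup_cocycle a b).
Proof.
case: q b => [|q] b.
  move=> /eqP b0; apply: is_coboundary_eq0 => s /=.
  by rewrite /cup_cochain b0 mulr0.
move=> H; have {H}/asboolP[c cb] : `[< exists c, coboundary c = val b >] := H.
pose a' : cochain p := fun s => (-1) ^+ p * val a s.
have a'0 : coboundary a' = 0.
  apply/funext => s; rewrite -[RHS](mulr0 ((-1) ^+ p)).
  rewrite -[X in _ * X]/((0 : cochain p.+1) s) -(cocycleP a) mulr_sumr.
  by apply: eq_bigr => i _; rewrite mulrCA.
apply: (is_coboundaryI (c := cup_cochain a' c)); first by rewrite addnS.
move=> s; rewrite coboundary_cup a'0 mul0r add0r cb /a' !mulrA -exprD.
rewrite -signr_odd oddD addbb mul1r /= /cup_cochain.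
by rewrite !sing_op_comp // => k; lia.
Qed.

Lemma cup_cocycleDl p q (a a' : cocycle p) (b : cocycle q) :
  cup_cocycle (a + a') b = cup_cocycle a b + cup_cocycle a' b.
Proof. by apply: val_inj; apply/funext => s; exact: mulrDl. Qed.

Lemma cup_cocycleDr p q (a : cocycle p) (b b' : cocycle q) :
  cup_cocycle a (b + b') = cup_cocycle a b + cup_cocycle a b'.
Proof. by apply: val_inj; apply/funext => s; exact: mulrDr. Qed.

Lemma pi_cohomologyD n (a b : cocycle n) :
  cohomology_class (a + b) =
  cohomology_class a + cohomology_class b.
Proof. exact: raddfD. Qed.

Lemma cup_productE p q (a : cocycle p) (b : cocycle q) :
  cup_product (cohomology_class a) (cohomology_class b) = cohomology_class (cup_cocycle a b).
Proof.
apply/cohomology_groupP.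
set a' := repr _; set b' := repr _.
have aa' : is_coboundary (a' - a).
  by apply/cohomology_groupP; rewrite /a' cohomology_classK.
have bb' : is_coboundary (b' - b).
  by apply/cohomology_groupP; rewrite /b' cohomology_classK.
have -> : cup_cocycle a' b' - cup_cocycle a b =
    cup_cocycle (a' - a) b' + cup_cocycle a (b' - b).
  apply/eqP; rewrite subr_eq -addrA -cup_cocycleDr subrK -cup_cocycleDl.
  by rewrite subrK.
apply: (rpredD (S := @is_coboundary (p + q))).
  exact: cup_coboundaryl.
exact: cup_coboundaryr.
Qed.

Lemma cohomology_surj n (x : cohomology_group n) :
  exists z, x = cohomology_class z.
Proof. by exists (repr x); rewrite cohomology_classK. Qed.

Lemma cohomology_eq_tagged p q (a : cocycle p) (b : cocycle q) : p = q ->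
  (forall s, val a s = val b (sing_op q id s)) ->
  Tagged cohomology_group (cohomology_class a) = Tagged cohomology_group (cohomology_class b).
Proof.
move=> epq; case: q / epq b => b ab.
suff -> : a = b by [].
by apply: val_inj; apply/funext => s; rewrite ab sing_op_id.
Qed.

Program Definition cohomology : gradedRing :=
  @GradedRing cohomology_group cohomology_one cup_product _ _ _ _ _.
Next Obligation.
move=> p q x x' y; have [a ->] := cohomology_surj x.
have [a' ->] := cohomology_surj x'; have [b ->] := cohomology_surj y.
by rewrite -pi_cohomologyD !cup_productE cup_cocycleDl pi_cohomologyD.
Qed.
Next Obligation.
move=> p q x y y'; have [a ->] := cohomology_surj x.
have [b ->] := cohomology_surj y; have [b' ->] := cohomology_surj y'.
by rewrite -pi_cohomologyD !cup_productE cup_cocycleDr pi_cohomologyD.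
Qed.
Next Obligation.
move=> p q r x y z; have [a ->] := cohomology_surj x.
have [b ->] := cohomology_surj y; have [c ->] := cohomology_surj z.
rewrite !cup_productE; apply: cohomology_eq_tagged; first exact: addnA.
move=> s; rewrite /= /cup_cochain mulrA !sing_op_comp //.
by congr (_ * _ * val c _); apply: eq_sing_op => k _ /=; rewrite addnA.
all: by move=> k /=; lia.
Qed.
Next Obligation.
move=> p x; have [a ->] := cohomology_surj x.
rewrite cup_productE; apply: cohomology_eq_tagged => // s.
by rewrite /= /cup_cochain mul1r.
Qed.
Next Obligation.
move=> p x; have [a ->] := cohomology_surj x.
rewrite cup_productE; apply: cohomology_eq_tagged; first exact: addn0.
by move=> s; rewrite /= /cup_cochain mulr1.
Qed.

End CohomologyRing.

Section CohomologyMap.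
Variables (R : realType) (K : fieldType) (X Y : topologicalType).
Variable f : continuousType X Y.

Definition pull_cochain n (c : cochain R K Y n) : cochain R K X n :=
  fun s => c (f \o s).

Lemma pull_coboundary n (c : cochain R K Y n) :
  coboundary (pull_cochain c) = pull_cochain (coboundary c).
Proof.
apply/funext => s; apply: eq_bigr => i _; congr (_ * c _).
exact/continuousEP.
Qed.

Lemma pull_is_cocycle n (z : cocycle R K Y n) :
  pull_cochain (val z) \in @is_cocycle R K X n.
Proof. by apply/eqP; rewrite pull_coboundary cocycleP. Qed.

Definition pull_cocycle n (z : cocycle R K Y n) : cocycle R K X n :=
  exist (fun c => c \in @is_cocycle R K X n) _ (pull_is_cocycle z).

Definition cohomology_fun n (x : cohomology_group R K Y n) :
    cohomology_group R K X n := cohomology_class (pull_cocycle (repr x)).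

Lemma cohomology_funE n (z : cocycle R K Y n) :
  cohomology_fun (cohomology_class z) = cohomology_class (pull_cocycle z).
Proof.
apply/cohomology_groupP; set z' := repr _.
have zz' : is_coboundary (z' - z).
  by apply/cohomology_groupP; rewrite /z' cohomology_classK.
have -> : pull_cocycle z' - pull_cocycle z = pull_cocycle (z' - z).
  exact: val_inj.
move: (z' - z) zz' => {z' z}; case: n => [|n] z /=.
  by move=> /eqP z0; apply/eqP/funext => s; rewrite /= /pull_cochain z0.
move=> /asboolP[c cz]; apply/asboolP; exists (pull_cochain c).
by rewrite pull_coboundary cz.
Qed.

Program Definition cohomology_map :
    gradedHom (cohomology R K Y) (cohomology R K X) :=
  @GradedHom (cohomology R K Y) (cohomology R K X) cohomology_fun _ _ _.
Next Obligation.
move=> p x y; have [a ->] := cohomology_surj x; have [b ->] := cohomology_surj y.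
rewrite -pi_cohomologyD !cohomology_funE -pi_cohomologyD; congr (cohomology_class _).
exact: val_inj.
Qed.
Next Obligation.
by rewrite /= /cohomology_one cohomology_funE; congr (cohomology_class _); exact: val_inj.
Qed.
Next Obligation.
move=> p q x y; have [a ->] := cohomology_surj x; have [b ->] := cohomology_surj y.
rewrite /= cup_productE !cohomology_funE cup_productE; congr (cohomology_class _).
apply: val_inj; apply/funext => s; congr (val a _ * val b _); exact/continuousEP.
Qed.

End CohomologyMap.

Section ImageMorphisms.
Variables (A B : gradedRing) (f : gradedHom A B).

Definition hmap (x : homogeneous A) : homogeneous B :=
  Tagged (gcomp B) (f _ (tagged x)).

Lemma hmap_hprod (s : seq (homogeneous A)) :
  hprod (map hmap s) = hmap (hprod s).
Proof.
elim: s => [|x s /= ->]; first by rewrite /hmap /= ghom1.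
by rewrite /hmap /hmul /= ghomM.
Qed.

Lemma gim_corestr_subproof p (x : A p) : f p x \in @gim_pred A B f p.
Proof. by apply/asboolP; exists x. Qed.

Program Definition gim_corestr : gradedHom A (image_gradedRing f) :=
  @GradedHom A (image_gradedRing f)
    (fun p x => exist (fun y => y \in @gim_pred A B f p) _
                  (gim_corestr_subproof x)) _ _ _.
Next Obligation. by move=> *; apply: val_inj; exact: ghomD. Qed.
Next Obligation. by apply: val_inj; exact: ghom1. Qed.
Next Obligation. by move=> *; apply: val_inj; exact: ghomM. Qed.

End ImageMorphisms.

Lemma gim_corestr_surj (A B : gradedRing) (f : gradedHom A B)
    (s : seq (homogeneous (image_gradedRing f))) :
  exists s' : seq (homogeneous A), s = map (hmap (gim_corestr f)) s'.
Proof.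
elim: s => [|[p [y py]] s [s' ->]]; first by exists [::].
have /asboolP[x xy] := py; exists (Tagged (gcomp A) x :: s') => /=.
congr (_ :: _); rewrite /hmap /=; congr (Tagged _ _).
exact/esym/val_inj.
Qed.

Lemma cup_lengths_image (A B A' B' : gradedRing) (f : gradedHom A B)
    (f' : gradedHom A' B') (u : gradedHom A' A) (v : gradedHom B B') :
  (forall p (x : A' p), f' p x = v p (f p (u p x))) ->
  cup_lengths (image_gradedRing f') `<=` cup_lengths (image_gradedRing f).
Proof.
move=> f'E l [->|[s [sl s0 sN0]]]; first by left.
right; have [r sr] := gim_corestr_surj s; subst s.
exists (map (hmap (gim_corestr f)) (map (hmap u) r)).
split; first by rewrite !size_map in sl *.
- by move: s0; rewrite !all_map.
- move: sN0; rewrite !hmap_hprod; apply: contra => /eqP /(congr1 val) /= fu0.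
  apply/eqP; apply: val_inj; rewrite /= f'E fu0 ghom0 //.
Qed.

Lemma cohomology_map_comp (R : realType) (K : fieldType) (X Y Z : topologicalType)
    (f : continuousType X Y) (g : continuousType Y Z)
    (h : continuousType X Z) : (forall x, h x = g (f x)) ->
  forall p (x : cohomology R K Z p),
    cohomology_map R K h p x =
    cohomology_map R K f p (cohomology_map R K g p x).
Proof.
move=> hE p x; have [a ->] := cohomology_surj x.
rewrite /= !cohomology_funE; congr (cohomology_class _).
apply: val_inj; apply/funext => s; congr (val a _).
by apply/continuousEP => y /=; rewrite hE.
Qed.

Definition graded_iso (A B : gradedRing) (f : gradedHom A B) :=
  forall p, bijective (f p).

Definition compactly_generated (X : topologicalType) :=
  forall A : set X,
    (forall (C : topologicalType) (u : continuousType C X),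
      compact [set: C] -> hausdorff_space C -> closed (u @^-1` A)) ->
    closed A.

Definition weak_hausdorff (X : topologicalType) :=
  forall (C : topologicalType) (u : continuousType C X),
    compact [set: C] -> hausdorff_space C -> closed (range u).

Section WeakEquivalence.
Variable R : realType.

Definition unit_interval : topologicalType := set_type (`[0, 1] : set R).

Definition cube n : topologicalType :=
  set_type [set x : 'rV[R]_n | forall i, 0 <= x ord0 i <= 1].

Definition cube_boundary n (s : cube n) :=
  exists i, val s ord0 i = 0 \/ val s ord0 i = 1.

Section Spheroids.
Variables (X : topologicalType) (x : X) (n : nat).

Definition spheroid (a : continuousType (cube n) X) :=
  forall s, cube_boundary s -> a s = x.

Definition spheroid_homotopic (a b : continuousType (cube n) X) :=
  exists H : continuousType (cube n * unit_interval)%type X,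
    [/\ forall s t, val t = 0 -> H (s, t) = a s,
        forall s t, val t = 1 -> H (s, t) = b s
      & forall s t, cube_boundary s -> H (s, t) = x].

End Spheroids.

Definition path_connected_to (X : topologicalType) (x y : X) :=
  exists g : continuousType unit_interval X,
    (forall t, val t = 0 -> g t = x) /\ (forall t, val t = 1 -> g t = y).

(* pi_n (X, x) is the set of spheroids modulo homotopy relative to the boundary;
   the two conjuncts are injectivity and surjectivity of the map induced by f
   between these quotients. *)
Definition pi_bijective n (X Y : topologicalType) (f : continuousType X Y)
    (x : X) :=
  (forall a b : continuousType (cube n) X, spheroid x a -> spheroid x b ->
     spheroid_homotopic (f x) (f \o a) (f \o b) -> spheroid_homotopic x a b) /\
  (forall c : continuousType (cube n) Y, spheroid (f x) c ->
     exists2 a : continuousType (cube n) X, spheroid x a &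
       spheroid_homotopic (f x) (f \o a) c).

Definition pi0_bijective (X Y : topologicalType) (f : continuousType X Y) :=
  (forall x x', path_connected_to (f x) (f x') -> path_connected_to x x') /\
  (forall y, exists x, path_connected_to (f x) y).

Definition weak_homotopy_equivalence (X Y : topologicalType)
    (f : continuousType X Y) :=
  pi0_bijective f /\ forall n x, pi_bijective n.+1 f x.

End WeakEquivalence.

Section Persistence.
Variables (R : realType) (K : fieldType).

Record persistentSpace := PersistentSpace {
  pspace :> R -> topologicalType;
  pspace_compactly_generated : forall t, compactly_generated (pspace t);
  pspace_weak_hausdorff : forall t, weak_hausdorff (pspace t);
  pmap : forall s t, s <= t -> continuousType (pspace s) (pspace t);
  pmap_id : forall t (tt : t <= t) x, pmap tt x = x;
  pmap_comp : forall r s t (rs : r <= s) (st : s <= t) (rt : r <= t) x,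
    pmap st (pmap rs x) = pmap rt x }.

Definition critical_value (X : persistentSpace) : set R :=
  [set t | ~ exists2 U, nbhs t U & forall s s' (ss' : s <= s'), U s -> U s' ->
    graded_iso (cohomology_map R K (pmap X ss'))].

Definition discrete_critical_values (X : persistentSpace) :=
  critical_value X `<=` isolated (critical_value X).

Record Int := MkInt { lo : R; hi : R; lo_le_hi : lo <= hi }.

Definition Int_sub (I J : Int) := lo J <= lo I /\ hi I <= hi J.

Lemma thicken_subproof (e : {nonneg R}) (I : Int) :
  lo I - e%:num <= hi I + e%:num.
Proof.
rewrite lerBlDr -addrA; apply: (le_trans (lo_le_hi I)).
by rewrite lerDl; apply: addr_ge0.
Qed.

Definition thicken (e : {nonneg R}) (I : Int) : Int :=
  MkInt (thicken_subproof e I).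

(* Functors from (Int, inclusion) to the extended numbers ordered by >=. *)
Record intFunctor := IntFunctor {
  int_fun :> Int -> \bar R;
  int_fun_mono : forall I J, Int_sub I J -> (int_fun J <= int_fun I)%E }.

Definition eroded (e : {nonneg R}) (J1 J2 : intFunctor) :=
  forall I, (J2 (thicken e I) <= J1 I)%E /\ (J1 (thicken e I) <= J2 I)%E.

Definition erosion_distance (J1 J2 : intFunctor) : \bar R :=
  ereal_inf [set (e%:num)%:E | e in [set e : {nonneg R} | eroded e J1 J2]].

Definition cup_fun (X : persistentSpace) (I : Int) : \bar R :=
  len R (image_gradedRing (cohomology_map R K (pmap X (lo_le_hi I)))).

Lemma cup_mono X I J : Int_sub I J -> (cup_fun X J <= cup_fun X I)%E.
Proof.
move=> [loJI hiIJ]; apply: ereal_sup_le => _ [l ll <-]; exists l => //.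
apply: (cup_lengths_image (u := cohomology_map R K (pmap X hiIJ))
  (v := cohomology_map R K (pmap X loJI))) ll => p x.
have loJhiI := le_trans loJI (lo_le_hi I).
transitivity (cohomology_map R K (pmap X loJhiI) p
    (cohomology_map R K (pmap X hiIJ) p x)).
  by apply: cohomology_map_comp => y; exact/esym/pmap_comp.
by apply: cohomology_map_comp => y; exact/esym/pmap_comp.
Qed.

Definition cup (X : persistentSpace) : intFunctor := IntFunctor (@cup_mono X).

(* t + e + e is used for t + 2 e, so that the composites typecheck. *)
Definition interleaved (e : {nonneg R}) (X Y : persistentSpace) :=
  exists (phi : forall t, continuousType (X t) (Y (t + e%:num)))
         (psi : forall t, continuousType (Y t) (X (t + e%:num))),
  [/\ forall s t (st : s <= t) (ste : s + e%:num <= t + e%:num) x,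
        phi t (pmap X st x) = pmap Y ste (phi s x),
      forall s t (st : s <= t) (ste : s + e%:num <= t + e%:num) y,
        psi t (pmap Y st y) = pmap X ste (psi s y),
      forall t (t2e : t <= t + e%:num + e%:num) x,
        psi (t + e%:num) (phi t x) = pmap X t2e x
    & forall t (t2e : t <= t + e%:num + e%:num) y,
        phi (t + e%:num) (psi t y) = pmap Y t2e y].

Definition interleaving_distance (X Y : persistentSpace) : \bar R :=
  ereal_inf [set (e%:num)%:E | e in [set e : {nonneg R} | interleaved e X Y]].

Definition natural (Z X : persistentSpace)
    (f : forall t, continuousType (Z t) (X t)) :=
  forall s t (st : s <= t) z, f t (pmap Z st z) = pmap X st (f s z).

Definition weakly_equivalent (X X' : persistentSpace) :=
  exists (Z : persistentSpace) (f : forall t, continuousType (Z t) (X t))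
         (g : forall t, continuousType (Z t) (X' t)),
  [/\ natural f, natural g,
      forall t, weak_homotopy_equivalence R (f t)
    & forall t, weak_homotopy_equivalence R (g t)].

Definition homotopy_interleaving_distance (X Y : persistentSpace) : \bar R :=
  ereal_inf [set d | exists X' Y', [/\ weakly_equivalent X' X,
    weakly_equivalent Y' Y & d = interleaving_distance X' Y']].

End Persistence.

Section GromovHausdorff.
Variable R : realType.

Definition hausdorff_distance (Z : metricType R) (A B : set Z) : \bar R :=
  ereal_inf [set r%:E | r in [set r : R | [/\ 0 < r,
    A `<=` \bigcup_(b in B) ball b r & B `<=` \bigcup_(a in A) ball a r]]].

Definition isometric_embedding (X Z : metricType R) (f : X -> Z) :=
  forall x x', mdist (f x) (f x') = mdist x x'.

Definition gromov_hausdorff_distance (X Y : metricType R) : \bar R :=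
  ereal_inf [set d | exists (Z : metricType R) (f : X -> Z) (g : Y -> Z),
    [/\ isometric_embedding f, isometric_embedding g
      & d = hausdorff_distance (range f) (range g)]].

End GromovHausdorff.

Section SimplicialComplex.
Variable V : choiceType.

Record simplicialComplex := SimplicialComplex {
  simplices : set (set V);
  simplex_finite : forall s, simplices s -> finite_set s;
  simplex_nonempty : forall s, simplices s -> s !=set0;
  simplex_face : forall s s', simplices s -> s' `<=` s -> s' !=set0 ->
    simplices s' }.

End SimplicialComplex.

Section Realization.
Variables (R : realType) (V : choiceType) (C : simplicialComplex V).

(* Points of the realization, given by their barycentric coordinates; the
   support being a simplex, the coordinates are finitely supported. *)
Record realization := Realization {
  bary :> V -> R;
  bary_ge0 : forall v, 0 <= bary v;
  bary_support : simplices C [set v | bary v != 0];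
  bary_sum : \sum_(v \in [set: V]) bary v = 1 }.

HB.instance Definition _ := gen_eqMixin realization.
HB.instance Definition _ := gen_choiceMixin realization.

Lemma bary_inj (a b : realization) : (forall v, a v = b v) -> a = b.
Proof.
move=> /funext; case: a b => [a a0 aC a1] [b b0 bC b1] /= ab.
by case: b / ab b0 bC b1 => *; congr Realization; exact: Prop_irrelevance.
Qed.

Section Face.
Variables (n : nat) (vs : 'I_n.+1 -> V).
Hypotheses (vs_inj : injective vs) (vs_C : simplices C (range vs)).

Definition face_coord (x : Delta R n) (v : V) : R :=
  \sum_(i | vs i == v) val x ord0 i.

Lemma face_coord_ge0 x v : 0 <= face_coord x v.
Proof. by apply: sumr_ge0 => i _; have [] := set_mem (valP x). Qed.

Lemma face_coord_sum x : \sum_(v \in [set: V]) face_coord x v = 1.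
Proof.
have [_ <-] := set_mem (valP x).
rewrite (fsbigE [seq vs i | i <- enum 'I_n.+1]) //=.
- rewrite big_map big_enum_cond /=; apply: eq_big => [i|i _]; first by rewrite in_setT.
  by rewrite /face_coord (big_pred1 i) // => j /=; rewrite inj_eq.
- by rewrite map_inj_uniq // enum_uniq.
move=> v _ /negP vN; apply: big1 => i /eqP iv; case: vN.
by rewrite -iv map_f // mem_enum.
Qed.

Lemma face_coord_support x : simplices C [set v | face_coord x v != 0].
Proof.
apply: (simplex_face vs_C) => [v /= xv|].
  apply: contrapT => vN; move/eqP: xv; apply; apply: big1 => i /eqP iv.
  by case: vN; exists i.
apply: contrapT => /set0P/negP; rewrite negbK => /eqP x0.
have := face_coord_sum x; rewrite fsbig1 => [/esym/eqP|v _].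
  by rewrite oner_eq0.
apply: contrapT => /eqP xv.
by have : [set v | face_coord x v != 0] v by []; rewrite x0.
Qed.

Definition face_map (x : Delta R n) : realization :=
  Realization (face_coord_ge0 x) (face_coord_support x) (face_coord_sum x).

End Face.

(* Coherent topology: U is open iff its trace on each closed simplex is open. *)
Definition realization_open : set_system realization :=
  [set U | forall n (vs : 'I_n.+1 -> V) (vs_inj : injective vs)
     (vs_C : simplices C (range vs)), open (face_map vs_inj vs_C @^-1` U)].

Lemma realization_openT : realization_open setT.
Proof. by move=> n vs vs_inj vs_C; exact: openT. Qed.

Lemma realization_openI : setI_closed realization_open.
Proof. by move=> A B oA oB n vs ? ?; apply: openI; [exact: oA|exact: oB]. Qed.

Lemma realization_open_bigU (I : Type) (f : I -> set realization) :
  (forall i, realization_open (f i)) -> realization_open (\bigcup_i f i).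
Proof.
by move=> of_ n vs ? ?; rewrite preimage_bigcup; apply: bigcup_open => i _;
  exact: of_.
Qed.

HB.instance Definition _ := isOpenTopological.Build realization
  realization_openT realization_openI realization_open_bigU.

Lemma realization_openE : @open realization = realization_open.
Proof. by []. Qed.

End Realization.

Section RealizationTop.
Variable R : realType.

Lemma hausdorff_separated (X : topologicalType) :
  (forall x y : X, (forall f : X -> R, continuous f -> f x = f y) -> x = y) ->
  hausdorff_space X.
Proof.
move=> sepX x y xy; apply: sepX => f cf; apply: (@Rhausdorff R) => A B fxA fyB.
have [z [Az Bz]] := xy _ _ (cf _ _ fxA) (cf _ _ fyB).
by exists (f z).
Qed.

Lemma Delta_hausdorff n : hausdorff_space (Delta R n).
Proof.
apply: hausdorff_separated => x y xy; apply: val_inj; apply/rowP => i.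
exact: (xy _ (@simplex_coordP R n i)).
Qed.

Lemma simplex_compact n : compact (simplex R n).
Proof.
have cc (i : 'I_n.+1) : continuous (fun y : 'rV[R]_n.+1 => y ord0 i) :=
  @coord_continuous _ _ _ _ _.
have cs : continuous (fun y : 'rV[R]_n.+1 => \sum_i y ord0 i).
  apply: (@continuous_big R _ +%R 0 xpredT _ _ _ (fun i (y : 'rV[R]_n.+1) => y ord0 i)) => [|i _].
  - exact: add_continuous.
  - exact: cc.
apply: (@subclosed_compact _ _
  [set y : 'rV[R]_n.+1 | forall i, `[0, 1]%classic (y ord0 i)]).
- have -> : simplex R n = (\bigcap_(i in [set: 'I_n.+1])
      ((fun y : 'rV[R]_n.+1 => y ord0 i) @^-1` [set z | 0 <= z])) `&`
      ((fun y : 'rV[R]_n.+1 => \sum_i y ord0 i) @^-1` [set z | z = 1]).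
    by apply/seteqP; split=> y [y0 y1]; split=> // i; [move=> _|]; exact: y0.
  apply: closedI; last by move/continuous_closedP: cs; apply; exact: closed_eq.
  apply: closed_bigI => i _.
  by move/continuous_closedP: (cc i); apply; exact: closed_ge.
- by apply: (@rV_compact R n.+1 (fun=> `[0, 1]%classic)) => _; exact: segment_compact.
- move=> y [y0 y1] i /=; rewrite in_itv /= y0 -y1 (bigD1 i) //= lerDl.
  by apply: sumr_ge0.
Qed.

Lemma Delta_compact n : compact [set: Delta R n].
Proof.
have x0 : Delta R n.
  exists (\row_j (j == ord0)%:R); apply/mem_set; split=> [i|].
    by rewrite mxE ler0n.
  rewrite (bigD1 ord0) //= mxE eqxx big1 ?addr0 // => i /negPf i0.
  by rewrite mxE i0.
have cg : {within simplex R n, continuous (valL_ x0 (@id (Delta R n)))}.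
  by apply/subspace_valL_continuousP' => x.
have := continuous_compact cg (@simplex_compact n).
congr (compact _); apply/seteqP; split=> // x _.
exists (val x); first exact/set_mem/(valP x).
exact: (congr1 (@^~ x) (valLK x0 (@id (Delta R n)))).
Qed.

Section OneComplex.
Variables (V : choiceType) (C : simplicialComplex V).

Lemma face_map_continuous n (vs : 'I_n.+1 -> V) (vs_inj : injective vs)
  (vs_C : simplices C (range vs)) : continuous (face_map (R := R) vs_inj vs_C).
Proof. by apply/continuousP => A; rewrite realization_openE; apply. Qed.

Lemma bary_continuous v : continuous (fun a : realization R C => a v).
Proof.
apply/continuousP => A oA; rewrite realization_openE => n vs vs_inj vs_C.
have := @simplex_sum_continuous R n (fun i => vs i == v).
by move/continuousP => /(_ A oA).
Qed.

Lemma realization_hausdorff : hausdorff_space (realization R C).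
Proof.
apply: hausdorff_separated => a b ab; apply: bary_inj => v.
exact: (ab _ (@bary_continuous v)).
Qed.

Lemma realization_weak_hausdorff : weak_hausdorff (realization R C).
Proof.
move=> D u cD hD; apply: compact_closed; first exact: realization_hausdorff.
apply: continuous_compact => //; apply: continuous_subspaceT.
exact: cts_fun.
Qed.

Lemma realization_compactly_generated : compactly_generated (realization R C).
Proof.
move=> A cA; rewrite -openC realization_openE => n vs vs_inj vs_C; rewrite preimage_setC openC.
exact: (cA (Delta R n) (mkcts (@face_map_continuous n vs vs_inj vs_C))
  (@Delta_compact n) (@Delta_hausdorff n)).
Qed.

End OneComplex.

Section Inclusion.
Variables (V : choiceType) (C D : simplicialComplex V).
Hypothesis CD : simplices C `<=` simplices D.

Definition realization_incl (a : realization R C) : realization R D :=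
  Realization (bary_ge0 a) (CD (bary_support a)) (bary_sum a).

Lemma realization_incl_continuous : continuous realization_incl.
Proof.
apply/continuousP => A; rewrite !realization_openE => oA n vs vs_inj vs_C.
rewrite -comp_preimage.
have -> : realization_incl \o face_map vs_inj vs_C =
    face_map vs_inj (CD vs_C) by apply/funext => x; exact: bary_inj.
exact: oA.
Qed.

End Inclusion.
End RealizationTop.

Section VietorisRips.
Variables (R : realType) (X : metricType R).

Definition diameter (s : set X) : \bar R :=
  ereal_sup [set (mdist xy.1 xy.2)%:E | xy in s `*` s].

Program Definition vr_complex (t : R) : simplicialComplex X :=
  @SimplicialComplex X
    [set s | [/\ finite_set s, s !=set0 & (diameter s <= t%:E)%E]] _ _ _.
Next Obligation. by move=> t s []. Qed.
Next Obligation. by move=> t s []. Qed.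
Next Obligation.
move=> t s s' [fs _ st] s's s'0; split=> //; first exact: sub_finite_set fs.
apply: le_trans st; apply: ereal_sup_le => _ [[x y] [sx sy] <-].
by exists (x, y) => //; split; exact: s's.
Qed.

Lemma vr_complex_le s t : s <= t ->
  simplices (vr_complex s) `<=` simplices (vr_complex t).
Proof. by move=> st A [fA A0 As]; split=> //; rewrite (le_trans As) ?lee_fin. Qed.

Lemma vr_level_le (s t : R) : s <= t -> Num.max 0 s <= Num.max 0 t.
Proof. by move=> st; rewrite ge_max !le_max lexx st orbT. Qed.

(* Level t is VR_t for 0 <= t and VR_0 for t < 0. *)
Program Definition vietoris_rips : persistentSpace R :=
  @PersistentSpace R (fun t => realization R (vr_complex (Num.max 0 t)))
    (fun t => @realization_compactly_generated R X _)
    (fun t => @realization_weak_hausdorff R X _)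
    (fun s t st => mkcts (@realization_incl_continuous R X _ _
                      (vr_complex_le (vr_level_le st)))) _ _.
Next Obligation. by move=> *; exact: bary_inj. Qed.
Next Obligation. by move=> *; exact: bary_inj. Qed.

End VietorisRips.

(* Main.v *)
Require Import Defs.
From mathcomp Require Import all_boot all_order all_algebra.
From mathcomp Require Import all_classical all_reals.
From mathcomp Require Import topology ereal normedtype.
From mathcomp Require Import zify ring lra.

Set Implicit Arguments.
Unset Strict Implicit.
Unset Printing Implicit Defensive.

Import Order.TTheory GRing.Theory Num.Theory.
Import numFieldNormedType.Exports.

Local Open Scope classical_set_scope.
Local Open Scope ring_scope.

(** The persistent cup-length only sees the maps that a persistent space
    induces in cohomology, so the theorem rests on two facts about singular
    cohomology: a weak homotopy equivalence induces an isomorphism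
    ([weak_equivalence_cohomology_inj], [weak_equivalence_cohomology_surj]),
    and homotopic maps induce the same map ([homotopic_cohomology_map]).
    Given the first fact, the cup-length is the same for weakly equivalent
    persistent spaces ([weakly_equivalent_cup]).  An interleaving factors the
    map of one space over a thickened interval through the map of the other
    over the interval itself, and the image of a composite has at most the
    length of the image of each factor ([interleaved_cup_le]).  This is the
    inequality for the homotopy interleaving distance.

    Both facts come from one construction.  A path cell of [f : X -> Y] is a
    singular simplex [a] of [X] with a homotopy in [Y] that starts at [f a];
    path cells are the singular simplices of the mapping path space of [f],
    handled without a topology on a space of paths.  They project to the
    simplices of [X] (the start) and of [Y] (the end).  A combinatorial
    argument shows that a projection along which boundaries of simplices lift
    is bijective in cohomology: a section compatible with faces gives
    injectivity ([lifting_exact]), and acyclic carriers give surjectivity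
    ([lifting_descend]), since the cells lying over one simplex can be coned
    off to a vertex.  The start always lifts boundaries, by the homotopy
    extension property ([start_lifts]); the end does so when [f] is a weak
    equivalence ([end_lifts]).  Constant paths form a section of the start
    whose end is [f], so [f] is bijective in cohomology in that case.  For the
    identity of [Y], start and end agree on constant paths, hence agree in
    cohomology, and a homotopy is a family of path cells of the identity: this
    is homotopy invariance.

    That the end lifts boundaries is the homotopy extension and lifting
    property of a weak equivalence.  It is proved on prisms, close to the cubes
    on which homotopy groups are defined, and moved to simplices by a map that
    is a homeomorphism off the boundary ([collapse]).  The proof uses no group
    structure: a lifting problem stays solvable when it is deformed
    ([solvable_transport]), and it is deformed until the map on the boundary is
    constant.  Injectivity on homotopy groups allows the last deformation, and
    surjectivity solves the problem that is left ([HELP_prism]).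

    For Vietoris-Rips filtrations, points less than [r] apart in a common
    metric space give maps on vertices in both directions that raise distances
    by at most [2 * r].  They induce simplicial maps, and their composite is
    contiguous to the inclusion, hence equal to it in cohomology.  Below scale
    zero, where the filtration is constant, these maps do not interleave; but
    there the complex is a discrete set of points, whose cohomology vanishes in
    positive degrees, so the cup-length is zero ([vr_cup_le]). *)

(** * Semi-simplicial sets and their cochains *)

(** Faces are indexed by natural numbers to keep the simplicial identity free
    of casts. The indices that matter in degree [n.+1] are those up to [n.+1];
    for singular simplices a larger index repeats the last face. *)
Record semiSimplicial := SemiSimplicial {
  cell :> nat -> Type;
  face : forall n, nat -> cell n.+1 -> cell n;
  face_face : forall n i j (e : cell n.+2), (i <= j)%N ->
    face i (face j.+1 e) = face j (face i e) }.
Arguments face {s n} i e.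

Record ssMap (T S : semiSimplicial) := SSMap {
  ssfun :> forall n, T n -> S n;
  ssfun_face : forall n i (e : T n.+1), ssfun (face i e) = face i (ssfun e) }.

(** The square of a boundary operator vanishes: terms cancel in pairs under
    the simplicial identity. The summand need not be a function of a cell,
    which the chain homotopy below requires. *)
Lemma alternating_double_sum (K : fieldType) n (a : nat -> nat -> K) :
  (forall i j, (i <= j <= n)%N -> a j.+1 i = a i j) ->
  \sum_(j < n.+2) \sum_(i < n.+1) (-1) ^+ (j + i) * a j i = 0.
Proof.
move=> aE.
under eq_bigr => j _ do rewrite (bigID (fun i : 'I_n.+1 => (i < j)%N)) /=.
rewrite big_split /= big_ord_recl big_pred0 // add0r.
rewrite [X in _ + X]big_ord_recr /= [X in _ + (_ + X)]big1 => [|i]; last first.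
  by rewrite ltn_ord.
rewrite addr0 [X in _ + X](exchange_big_dep xpredT) //= -big_split big1 //= => j _.
apply/eqP; rewrite addr_eq0 -sumrN; apply/eqP; apply: eq_big => i.
  by rewrite -leqNgt.
move=> ij; have {}ij : (i <= j)%N by [].
rewrite [a _ _](aE i j) ?ij ?(ltn_ord j) //; last by rewrite -ltnS ltn_ord.
by rewrite -?[bump 0 j]/(j.+1) addSn exprS mulN1r mulNr [(j + i)%N]addnC.
Qed.

Section Cochains.
Variable K : fieldType.

Definition sdelta (T : semiSimplicial) n (c : T n -> K) (e : T n.+1) : K :=
  \sum_(i < n.+2) (-1) ^+ i * c (face i e).

(** In degree 0 there are no cochains one degree lower, so exact means zero. *)
Definition exact_cochain (T : semiSimplicial) n : (T n -> K) -> Prop :=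
  match n with
  | 0 => fun c => forall e, c e = 0
  | m.+1 => fun c => exists b : T m -> K, forall e, c e = sdelta b e
  end.

Lemma exact_cochainB (T : semiSimplicial) n (c c' : T n -> K) :
  exact_cochain c -> exact_cochain c' -> exact_cochain (fun e => c e - c' e).
Proof.
case: n c c' => [|n] c c' /= => [c0 c'0 e|[b bE] [b' b'E]].
  by rewrite c0 c'0 subrr.
exists (fun e => b e - b' e) => e; rewrite bE b'E -sumrB.
by apply: eq_bigr => i _; rewrite mulrBr.
Qed.

Lemma eq_exact_cochain (T : semiSimplicial) n (c c' : T n -> K) :
  c =1 c' -> exact_cochain c -> exact_cochain c'.
Proof. by move=> /funext ->. Qed.

Lemma exact_cochain_pull (T S : semiSimplicial) (f : ssMap T S) n (c : S n -> K) :
  exact_cochain c -> exact_cochain (fun e => c (f n e)).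
Proof.
case: n c => [|n] c /= => [c0 e|[b bE]]; first exact: c0.
exists (fun e => b (f n e)) => e; rewrite bE.
by apply: eq_bigr => i _; rewrite ssfun_face.
Qed.

Lemma sdelta_pull (T S : semiSimplicial) (f : ssMap T S) n (c : S n -> K) e :
  sdelta (fun x => c (f n x)) e = sdelta c (f n.+1 e).
Proof. by apply: eq_bigr => i _; rewrite ssfun_face. Qed.

End Cochains.

Lemma dependent_choice_nat (A : nat -> Type) (G : forall n, A n -> Prop)
    (L : forall n, A n -> A n.+1 -> Prop) (a0 : A 0%N) :
  G 0%N a0 ->
  (forall n a, G n a -> exists a', G n.+1 a' /\ L n a a') ->
  exists s : forall n, A n,
    [/\ s 0%N = a0, forall n, G n (s n) & forall n, L n (s n) (s n.+1)].
Proof.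
move=> G0 step.
pose next n (a : {a | G n a}) : {a | G n.+1 a} :=
  let w := cid (step n (sval a) (svalP a)) in exist (G n.+1) (sval w) (svalP w).1.
pose s := nat_rect (fun n => {a | G n a}) (exist (G 0%N) a0 G0) next.
exists (fun n => sval (s n)); split=> [//|n|n]; first exact: svalP.
exact: (svalP (cid (step n (sval (s n)) (svalP (s n))))).2.
Qed.

(** * Lifting boundaries *)

(** The condition for the [u i] to be the faces of a hollow simplex. *)
Definition compatible (T : semiSimplicial) n : (nat -> T n) -> Prop :=
  match n with
  | 0 => fun _ => True
  | m.+1 => fun u => forall i j, (i <= j <= m.+1)%N ->
                       face i (u j.+1) = face j (u i)
  end.

(** The right lifting property with respect to the inclusions of boundaries
    into simplices, degree 0 being the lifting of single vertices. *)
Definition lifts_boundaries (T S : semiSimplicial) (p : ssMap T S) :=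
  (forall y : S 0%N, exists e, p 0%N e = y) /\
  forall n (y : S n.+1) (u : nat -> T n),
    (forall i, (i <= n.+1)%N -> p n (u i) = face i y) -> compatible u ->
    exists2 e, p n.+1 e = y & forall i, (i <= n.+1)%N -> face i e = u i.

(** By induction on the degree: the lifts already chosen for the faces of [y]
    form a hollow simplex over the boundary of [y], which the lifting property
    fills. *)
Lemma section_exists (T S : semiSimplicial) (p : ssMap T S) :
  lifts_boundaries p ->
  exists t : forall n, S n -> T n,
    (forall n y, p n (t n y) = y) /\
    forall n (y : S n.+1) i, (i <= n.+1)%N -> face i (t n.+1 y) = t n (face i y).
Proof.
move=> [p0 pS].
have [t0 t0E] := choice p0.
pose G n (t : S n -> T n) := (forall y, p n (t y) = y) /\
  forall y : S n.+1, compatible (fun i => t (face i y)).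
pose L n (t : S n -> T n) (t' : S n.+1 -> T n.+1) :=
  forall y i, (i <= n.+1)%N -> face i (t' y) = t (face i y).
have [|n t [pt ct]|t [_ tG tL]] := @dependent_choice_nat _ G L t0.
- by split.
- have [y|t' t'P] := choice (P := fun y e => p n.+1 e = y /\
      forall i, (i <= n.+1)%N -> face i e = t (face i y)).
    have [|//|e] := pS n y (fun i => t (face i y)); last by exists e.
    by move=> i _; exact: pt.
  exists t'; split; last by move=> y; exact: (t'P y).2.
  split=> [y|y i j /andP[ij jn]]; first exact: (t'P y).1.
  rewrite !(t'P _).2 ?face_face //; exact: leq_trans jn.
- by exists t; split=> [n y|n y i]; [exact: (tG n).1|exact: tL].
Qed.

(** * Cells over a singular simplex *)

Section Over.
Variables (R : realType) (K : fieldType) (Y : topologicalType).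

Lemma bump_bump i j : (i <= j)%N -> bump j.+1 \o bump i =1 bump i \o bump j.
Proof. by move=> ij k; rewrite /= /bump; lia. Qed.

Lemma sing_face_face n i j (s : sing R Y n.+2) : (i <= j)%N ->
  sing_op n (bump i) (sing_op n.+1 (bump j.+1) s) =
  sing_op n (bump j) (sing_op n.+1 (bump i) s).
Proof.
move=> ij; rewrite !sing_op_comp; try by move=> k; exact: leq_bump_succ.
by apply: eq_sing_op => k _; exact: bump_bump.
Qed.

Definition singular : semiSimplicial :=
  @SemiSimplicial (sing R Y) (fun n i => sing_op n (bump i)) sing_face_face.

Variables (T : semiSimplicial) (p : ssMap T singular).

(** The carrier of [y]: cells lying over the restriction of [y] along a map on
    vertices. For monotone [vert] these are the cells of the pullback of [p]
    along [y], seen as a map from a standard simplex; monotonicity is not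
    imposed because singular simplices can be restricted along any map on
    vertices. *)
Record over N (y : sing R Y N) m := Over {
  vert : nat -> nat;
  top : T m;
  vert_le : forall k, (k <= m)%N -> (vert k <= N)%N;
  topE : p m top = sing_op m vert y }.

Lemma over_inj N (y : sing R Y N) m (x x' : over y m) :
  vert x =1 vert x' -> top x = top x' -> x = x'.
Proof.
case: x x' => [a e ale pe] [a' e' ale' pe'] /= /funext aa' ee'.
by subst a' e'; congr Over; exact: Prop_irrelevance.
Qed.

Lemma over_face_vert_le N (y : sing R Y N) m i (x : over y m.+1) k :
  (k <= m)%N -> ((vert x \o bump i) k <= N)%N.
Proof. by move=> km; apply: vert_le; exact: leq_bump_succ. Qed.

Lemma over_faceE N (y : sing R Y N) m i (x : over y m.+1) :
  p m (face i (top x)) = sing_op m (vert x \o bump i) y.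
Proof.
rewrite ssfun_face /= topE sing_op_comp // => k; exact: leq_bump_succ.
Qed.

Definition over_face N (y : sing R Y N) m i (x : over y m.+1) : over y m :=
  Over (over_face_vert_le i x) (over_faceE i x).

Lemma over_face_face N (y : sing R Y N) m i j (x : over y m.+2) : (i <= j)%N ->
  over_face i (over_face j.+1 x) = over_face j (over_face i x).
Proof.
move=> ij; apply: over_inj => /= [k|]; last exact: face_face.
exact: congr1 (bump_bump ij k).
Qed.

Definition overSS N (y : sing R Y N) : semiSimplicial :=
  @SemiSimplicial (over y) (@over_face N y) (@over_face_face N y).

Lemma over_comp_subproof N (y : sing R Y N) n (x : over y n) m
    (z : over (p n (top x)) m) :
  p m (top z) = sing_op m (vert x \o vert z) y.
Proof.
apply: etrans (topE z) (etrans (congr1 (sing_op m (vert z)) (topE x)) _).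
by rewrite sing_op_comp //; exact: vert_le.
Qed.

Definition over_comp N (y : sing R Y N) n (x : over y n) m
    (z : over (p n (top x)) m) : over y m :=
  @Over N y m (vert x \o vert z) (top z)
    (fun k km => vert_le x (vert_le z km)) (over_comp_subproof z).
Arguments over_comp {N y n} x {m} z.

Definition over_id n (y : sing R Y n) (e : T n) (pe : p n e = y) : over y n :=
  @Over n y n id e (fun k kn => kn)
    (etrans pe (esym (sing_op_id y (fun k _ => erefl k)))).

Definition vcons (v : nat -> nat) k := if k is k'.+1 then v k' else 0%N.

Lemma vcons_bump0 v : vcons v \o bump 0 =1 v.
Proof. by move=> k; rewrite /= /bump. Qed.

Lemma vcons_bumpS v i : vcons v \o bump i.+1 =1 vcons (v \o bump i).
Proof.
case=> [|k]; first by rewrite /= /bump.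
by rewrite /= bumpS.
Qed.

Hypothesis pP : lifts_boundaries p.

Lemma cone_filler N (y : sing R Y N) m (x : over y m) (u : nat -> T m) :
  u 0%N = top x ->
  (forall i, (i <= m)%N -> p m (u i.+1) = sing_op m (vcons (vert x \o bump i)) y) ->
  compatible u ->
  exists z : over y m.+1, vert z = vcons (vert x) /\
    forall i, (i <= m.+1)%N -> face i (top z) = u i.
Proof.
move=> u0 uS cu.
have vle k : (k <= m.+1)%N -> (vcons (vert x) k <= N)%N.
  by case: k => // k; exact: (vert_le x).
have [|//|e pe eu] := pP.2 m (sing_op m.+1 (vcons (vert x)) y) u; last first.
  by exists (Over vle pe).
move=> [_|i im] /=; rewrite sing_op_comp ?u0 ?uS ?topE //.
all: try by move=> k; exact: leq_bump_succ.
by apply: eq_sing_op => k _; exact/esym/vcons_bumpS.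
Qed.

(** Every carrier is contractible. A chosen cell over the vertex 0 of [y] is
    joined to every other cell, degree by degree: the faces of the cone of [x]
    are [x] and the cones of its faces, already constructed, so the lifting
    property provides the cone. The last clause says that the base of the
    cones of vertices does not depend on the vertex. *)
Lemma cone_exists N (y : sing R Y N) :
  exists g : forall m, overSS y m -> overSS y m.+1,
    [/\ forall m x, face 0 (g m x) = x,
        forall m (x : overSS y m.+1) i, (i <= m.+1)%N ->
          face i.+1 (g m.+1 x) = g m (face i x)
      & forall x x' : over y 0, vert x = vert x' ->
          face 1 (g 0%N x) = face 1 (g 0%N x')].
Proof.
have [v pv] := pP.1 (sing_op 0 (fun=> 0%N) y).
have [x|g0 g0P] := choice (P := fun (x : overSS y 0) (z : overSS y 1) =>
    [/\ vert z = vcons (vert x), face 0 z = x & face 1 (top z) = v]).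
  have [//|i im|//|z [zx zu]] := @cone_filler N y 0 x (fun i => if i is 0 then top x else v).
    rewrite pv; apply: eq_sing_op => k; rewrite leqn0 => /eqP -> //.
  exists z; split=> //; last by rewrite zu.
  apply: over_inj; last by rewrite /= zu.
  by move=> k; rewrite /= zx; exact: vcons_bump0.
have vface m (x : overSS y m) (z : overSS y m.+1) i : vert z = vcons (vert x) ->
    vert (face i.+1 z) =1 vcons (vert x \o bump i).
  by move=> zx k; rewrite /= zx; exact: vcons_bumpS.
pose G m (g : overSS y m -> overSS y m.+1) :=
  [/\ forall x, vert (g x) = vcons (vert x), forall x, face 0 (g x) = x &
  forall (x : overSS y m.+1) i j, (i <= j <= m)%N ->
    face i.+1 (g (face j.+1 x)) = face j.+1 (g (face i x))].
pose L m (g : overSS y m -> overSS y m.+1) (g' : overSS y m.+1 -> overSS y m.+2) :=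
  forall x i, (i <= m.+1)%N -> face i.+1 (g' x) = g (face i x).
have [|m g [gv gf gc]|g [g0E gG gL]] := @dependent_choice_nat _ G L g0.
- split=> [x|x|x i j /andP[ij]]; try by have [] := g0P x.
  rewrite leqn0 => /eqP j0; move: ij; rewrite j0 leqn0 => /eqP ->.
  have [v1 _ t1] := g0P (face 1 x); have [v0 _ t0] := g0P (face 0 x).
  apply: over_inj; last by rewrite /= t1 t0.
  by move=> k; rewrite !(vface _ _ _ _ v1) !(vface _ _ _ _ v0); case: k.
- have [x|g' g'P] := choice (P := fun (x : overSS y m.+1) (z : overSS y m.+2) =>
    [/\ vert z = vcons (vert x), face 0 z = x &
        forall i, (i <= m.+1)%N -> face i.+1 z = g (face i x)]).
    have [//|i im||z [zx zu]] := @cone_filler N y m.+1 x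
        (fun i => if i is i'.+1 then top (g (face i' x)) else top x).
    + by rewrite topE gv.
    + move=> [|i] j /andP[ij jm].
        exact: (congr1 (fun z : over y m => top z) (gf (face j x))).
      case: j ij jm => // j; rewrite !ltnS => ij jm.
      apply: (congr1 (fun z : over y m => top z) (gc x i j _)).
      by rewrite ij.
    exists z; split=> // [|i im]; apply: over_inj; rewrite /= ?zu //.
      by move=> k; rewrite /= zx; exact: vcons_bump0.
    by move=> k; rewrite gv; exact: vface.
  exists g'; split=> [|x i im]; last by have [_ _ ->] := g'P x.
  split=> [x|x|x i j /andP[ij jm]]; try by have [] := g'P x.
  have [_ _ h1] := g'P (face j.+1 x); have [_ _ h0] := g'P (face i x).
  by rewrite h1 ?(leq_trans ij) // h0 // face_face.
- exists g; split=> [m x|m x i im|x x' xx']; first by have [_ ->] := gG m.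
    exact: gL.
  rewrite g0E; have [v1 _ t1] := g0P x; have [v0 _ t0] := g0P x'.
  apply: over_inj; last by rewrite /= t1 t0.
  by move=> k; rewrite !(vface _ _ _ _ v1) !(vface _ _ _ _ v0) xx'.
Qed.


Lemma over_comp_face N (y : sing R Y N) n (x : over y n) m i
    (z : over (p n (top x)) m.+1) :
  over_face i (over_comp x z) = over_comp x (over_face i z).
Proof. exact: over_inj. Qed.

Lemma over_comp_comp N (y : sing R Y N) n (x : over y n) m
    (z : over (p n (top x)) m) l (t : over (p m (top z)) l) :
  over_comp x (over_comp z t) = over_comp (over_comp x z) t.
Proof. exact: over_inj. Qed.

Let cone N (y : sing R Y N) := sval (cid (cone_exists y)).
Arguments cone {N} y m.
Let coneP N (y : sing R Y N) := svalP (cid (cone_exists y)).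
Let lift := sval (cid (section_exists pP)).
Let liftK : forall n y, p n (lift y) = y := (svalP (cid (section_exists pP))).1.
Let lift_face : forall n (y : singular n.+1) i, (i <= n.+1)%N ->
  face i (lift y) = lift (face i y) := (svalP (cid (section_exists pP))).2.

Definition over_top N (y : sing R Y N) n (x : over y n) : over (p n (top x)) n :=
  over_id (erefl (p n (top x))).
Definition over_lift N (y : sing R Y N) n (x : over y n) : over (p n (top x)) n :=
  over_id (liftK (p n (top x))).

Definition cone_cochain N (y : sing R Y N) n (x : over y n) m
    (c : over y m.+1 -> K) : over (p n (top x)) m -> K :=
  fun z => c (over_comp x (cone (p n (top x)) m z)).
Arguments cone_cochain {N y n} x {m} c.

(** The method of acyclic carriers, dualized. Write [k] for the chain homotopy
    from the identity to the composite of [p] with a section, [e] for a cell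
    over [y] and [s] for the section. Then [k e] is the cone, in the carrier
    of [y], of [e - s y - k (boundary of e)]. Here [homotopy_bd x c] is the
    value of the cochain [c] on [k (boundary of x)] and [homotopy_op x c] its
    value on [k x]. The cochain lives on a carrier and not on all of [T],
    because a cone depends on the simplex over which it is formed. *)
Fixpoint homotopy_bd n : forall N (y : sing R Y N), over y n -> (over y n -> K) -> K :=
  match n with
  | 0 => fun _ _ _ _ => 0
  | m.+1 => fun N y x c => \sum_(i < m.+2) (-1) ^+ i *
      let x' := over_face i x in let c' := cone_cochain x' c in
      (c' (over_top x') - c' (over_lift x') - homotopy_bd (over_top x') c')
  end.

Definition homotopy_op n N (y : sing R Y N) (x : over y n) (c : over y n.+1 -> K) : K :=
  let c' := cone_cochain x c in
  c' (over_top x) - c' (over_lift x) - homotopy_bd (over_top x) c'.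

Lemma homotopy_bdS n N (y : sing R Y N) (x : over y n.+1) c :
  homotopy_bd x c = \sum_(i < n.+2) (-1) ^+ i * homotopy_op (over_face i x) c.
Proof. by []. Qed.

Lemma homotopy_bdB n N (y : sing R Y N) (x : over y n) c d :
  homotopy_bd x (fun z => c z - d z) = homotopy_bd x c - homotopy_bd x d.
Proof.
elim: n N y x c d => [|n IHn] N y x c d; first by rewrite subrr.
rewrite !homotopy_bdS -sumrB; apply: eq_bigr => i _.
rewrite -mulrBr /homotopy_op; congr (_ * _).
rewrite [homotopy_bd _ _](IHn _ _ _ (cone_cochain _ c) (cone_cochain _ d)).
rewrite /cone_cochain; ring.
Qed.

(** Restriction to a smaller carrier commutes with the operator, which uses
    only the simplex right under the cell. *)
Lemma homotopy_op_comp n N (y : sing R Y N) m (x : over y m)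
    (z : over (p m (top x)) n) (c : over y n.+1 -> K) :
  homotopy_op z (fun t => c (over_comp x t)) = homotopy_op (over_comp x z) c.
Proof.
rewrite /homotopy_op.
by have -> : cone_cochain z (fun t => c (over_comp x t)) =
     cone_cochain (over_comp x z) c
  by apply/funext => t; rewrite /cone_cochain over_comp_comp.
Qed.

(** The cone is a contraction in positive degrees. *)
Lemma cone_cochain_sdelta N (y : sing R Y N) n (x : over y n) m
    (c : overSS y m.+1 -> K) (z : overSS (p n (top x)) m.+1) :
  cone_cochain x (sdelta c) z =
  c (over_comp x z) - sdelta (T := overSS _) (cone_cochain x c) z.
Proof.
have [c0 cS _] := coneP (p n (top x)).
rewrite /cone_cochain /sdelta big_ord_recl expr0 mul1r /= over_comp_face.
congr (c (over_comp x _) + _); first exact: c0.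
rewrite -sumrN; apply: eq_bigr => i _.
rewrite -?[bump 0 i]/(i.+1) exprS mulN1r mulNr over_comp_face; congr (- (_ * c (over_comp x _))).
by apply: cS; rewrite -ltnS.
Qed.

(** The homotopy formula. Taking cones turns [e - s y - k (boundary of e)]
    back into itself up to the cone of its boundary; by induction that
    boundary is [k (boundary of the boundary of e)], which vanishes. *)
Lemma homotopy_op_sdelta n N (y : sing R Y N) (x : overSS y n) (c : overSS y n -> K) :
  homotopy_op x (sdelta c) =
  c x - c (over_comp x (over_lift x)) - homotopy_bd x c.
Proof.
elim: n N y x c => [|n IHn] N y x c.
  have [c0 _ c1] := coneP (p 0%N (top x)).
  have cE z : cone_cochain x (sdelta c) z =
      c (over_comp x z) - c (over_comp x (over_face 1 (cone (p 0%N (top x)) 0%N z))).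
    rewrite /cone_cochain /sdelta !big_ord_recl big_ord0 expr0 mul1r /= expr1 mulN1r addr0.
    rewrite !over_comp_face; congr (c (over_comp x _) - _); exact: c0.
  rewrite /homotopy_op /= !cE [over_face 1 _](c1 _ (over_lift x)) // !subr0.
  have -> : over_comp x (over_top x) = x by exact: over_inj.
  by rewrite opprB addrA subrK.
rewrite /homotopy_op; set c' := cone_cochain x c.
have dE : cone_cochain x (sdelta c) = fun z => c (over_comp x z) - sdelta (T := overSS _) c' z.
  by apply/funext => z; exact: cone_cochain_sdelta.
rewrite dE (homotopy_bdB _ (fun z => c (over_comp x z))).
have -> : over_comp x (over_top x) = x by exact: over_inj.
have -> : homotopy_bd (over_top x) (fun z => c (over_comp x z)) = homotopy_bd x c.
  rewrite !homotopy_bdS; apply: eq_bigr => i _; rewrite homotopy_op_comp.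
  by congr (_ * homotopy_op _ c); exact: over_inj.
suff -> : homotopy_bd (over_top x) (sdelta (T := overSS _) c') =
    sdelta (T := overSS _) c' (over_top x) - sdelta (T := overSS _) c' (over_lift x).
  set u := sdelta _ _; set v := sdelta _ _.
  ring.
rewrite homotopy_bdS.
under eq_bigr => i _.
  rewrite (IHn _ _ (over_face i (over_top x)) c').
  have -> : over_comp (over_face i (over_top x)) (over_lift (over_face i (over_top x))) =
      over_face i (over_lift x).
    apply: over_inj => //=; rewrite lift_face; last by rewrite -ltnS.
    by congr lift; exact: ssfun_face.
  rewrite !mulrBr; over.
rewrite !sumrB -[RHS]subr0; congr (_ - _ - _).
clear dE IHn; case: n x c c' => [|n] x c c'; first by apply: big1 => i _; rewrite mulr0.
under eq_bigr => i _ do rewrite homotopy_bdS mulr_sumr.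
under eq_bigr => i _ do under eq_bigr => j _ do rewrite mulrA -exprD.
apply: (@alternating_double_sum K n.+1 (fun j i =>
  homotopy_op (over_face i (over_face j (over_top x))) c')) => i j /andP[ij _].
by rewrite over_face_face.
Qed.

(** A cobounding cochain on [T] restricts along a section. *)
Lemma lifting_exact n (z : singular n -> K) :
  exact_cochain (fun e => z (p n e)) -> exact_cochain z.
Proof.
case: n z => [|n] z /= => [z0 y|[b bE]].
  by have [e <-] := pP.1 y.
exists (fun y => b (lift y)) => y; rewrite -[y in LHS]liftK bE.
by apply: eq_bigr => i _; rewrite lift_face // -ltnS.
Qed.

(** Restrict the cocycle to a section: the homotopy formula bounds the
    difference. *)
Lemma lifting_descend n (c : T n -> K) : (forall e, sdelta c e = 0) ->
  exists2 a : singular n -> K, (forall y, sdelta a y = 0) &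
    exact_cochain (fun e => c e - a (p n e)).
Proof.
move=> c0; exists (fun y => c (lift y)) => [y|].
  rewrite -[RHS](c0 (lift y)); apply: eq_bigr => i _.
  by rewrite lift_face // -ltnS.
have cE e : c e - c (lift (p n e)) =
    homotopy_bd (over_id (erefl (p n e))) (fun x => c (top x)).
  apply/eqP; rewrite -subr_eq0; apply/eqP.
  have := homotopy_op_sdelta (over_id (erefl (p n e)) : overSS _ _) (fun x => c (top x)).
  move=> <-; rewrite /homotopy_op.
  suff -> : cone_cochain (over_id (erefl (p n e)))
      (sdelta (T := overSS _) (fun x => c (top x))) = fun z => 0 - 0.
    by rewrite homotopy_bdB !subrr.
  by apply/funext => z; rewrite subrr; exact: (c0 (top _)).
case: n c c0 cE => [|n] c c0 cE /=; first by move=> e; rewrite cE.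
exists (fun e => homotopy_op (over_id (erefl (p n e))) (fun x => c (top x))) => e.
rewrite cE homotopy_bdS; apply: eq_bigr => i _; congr (_ * _).
Qed.

End Over.

(** * Continuity *)

Section ContinuityCombinators.
Variables P Q Z : topologicalType.

Lemma cont_comp (f : P -> Q) (g : Q -> Z) :
  continuous f -> continuous g -> continuous (fun x => g (f x)).
Proof. by move=> cf cg x; apply: continuous_comp; [exact: cf|exact: cg]. Qed.

Lemma cont_id : continuous (fun x : P => x).
Proof. by move=> x. Qed.

Lemma cont_const (z : Z) : continuous (fun _ : P => z).
Proof. by move=> x; exact: cvg_cst. Qed.

Lemma cont_pair (f : P -> Q) (g : P -> Z) :
  continuous f -> continuous g -> continuous (fun x => (f x, g x)).
Proof. by move=> cf cg x; apply: cvg_pair; [exact: cf|exact: cg]. Qed.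

Lemma cont_fst : continuous (fun q : P * Q => q.1).
Proof. by move=> x; exact: cvg_fst. Qed.

Lemma cont_snd : continuous (fun q : P * Q => q.2).
Proof. by move=> x; exact: cvg_snd. Qed.

Lemma within_comp (A : set P) (B : set Q) (f : P -> Q) (g : Q -> Z) :
  {within A, continuous f} -> (forall x, A x -> B (f x)) ->
  {within B, continuous g} -> {within A, continuous (fun x => g (f x))}.
Proof.
move=> /subspace_continuousP cf AB /subspace_continuousP cg.
apply/subspace_continuousP => x Ax U /(cg _ (AB _ Ax)) gU.
have := cf _ Ax _ gU; rewrite /= !nbhs_simpl /within /= => fU.
by apply: filterS fU => y + Ay; apply => //; exact: AB.
Qed.

Lemma cont_within (A : set P) (f : P -> Q) :
  continuous f -> {within A, continuous f}.
Proof. exact: continuous_subspaceT. Qed.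

Lemma within_setT (f : P -> Q) : {within setT, continuous f} -> continuous f.
Proof. 
move=> /subspace_continuousP cf x U /(cf _ I).
by rewrite /= !nbhs_simpl /within /=; apply: filterS => y; apply.
Qed.

Lemma within_eq (A : set P) (f g : P -> Q) : (forall x, A x -> f x = g x) ->
  {within A, continuous f} -> {within A, continuous g}.
Proof. by move=> fg; apply: subspace_eq_continuous => x /set_mem; exact: fg. Qed.

End ContinuityCombinators.

Lemma within_comp_cont (P Q Z : topologicalType) (B : set Q) (f : P -> Q) (g : Q -> Z) :
  continuous f -> (forall x, B (f x)) ->
  {within B, continuous g} -> continuous (fun x => g (f x)).
Proof.
move=> cf fB cg; apply: within_setT; apply: within_comp cg => //.
exact: cont_within.
Qed.

(** The gluing lemma for a finite closed cover. Near a point, the closed sets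
    that do not contain it can be ignored. *)
Lemma within_glue (J : finType) (P Q : topologicalType) (A : set P)
    (B : J -> set P) (f : P -> Q) :
  (forall x, A x -> exists j, B j x) -> (forall j, closed (B j)) ->
  (forall j, {within B j, continuous f}) -> {within A, continuous f}.
Proof.
move=> AB cB fB; apply/subspace_continuousP => x Ax U fU.
have : \forall y \near x, forall j, B j y -> U (f y).
  apply: filter_forall => j; have [Bx|Bx] := pselect (B j x).
    by have /subspace_continuousP/(_ x Bx U fU) := fB j.
  have : nbhs x (~` B j) by apply: open_nbhs_nbhs; split=> //; rewrite openC.
  by apply: filterS => y nB /nB.
rewrite /= !nbhs_simpl /within /=; apply: filterS => y yU Ay.
by have [j /yU] := AB y Ay.
Qed.

Section RealCombinators.
Variables (R : realType) (P : topologicalType).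
Implicit Types f g : P -> R.

Lemma contD f g : continuous f -> continuous g -> continuous (fun x => f x + g x).
Proof. by move=> cf cg x; apply: cvgD; [exact: cf|exact: cg]. Qed.

Lemma contN f : continuous f -> continuous (fun x => - f x).
Proof. by move=> cf x; apply: cvgN; exact: cf. Qed.

Lemma contB f g : continuous f -> continuous g -> continuous (fun x => f x - g x).
Proof. by move=> cf cg; apply: contD => //; exact: contN. Qed.

Lemma contM f g : continuous f -> continuous g -> continuous (fun x => f x * g x).
Proof. by move=> cf cg x; apply: cvgM; [exact: cf|exact: cg]. Qed.

Lemma contV f : (forall x, f x != 0) -> continuous f -> continuous (fun x => (f x)^-1).
Proof. by move=> f0 cf x; apply: cvgV => //; exact: cf. Qed.

Lemma cont_norm f : continuous f -> continuous (fun x => `|f x|).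
Proof. by move=> cf x; apply: cvg_norm; exact: cf. Qed.

Lemma cont_max f g : continuous f -> continuous g -> continuous (fun x => Num.max (f x) (g x)).
Proof. by move=> cf cg x; apply: (@continuous_max R P); [exact: cf|exact: cg]. Qed.

Lemma cont_min f g : continuous f -> continuous g -> continuous (fun x => Num.min (f x) (g x)).
Proof. by move=> cf cg x; apply: (@continuous_min R P); [exact: cf|exact: cg]. Qed.

Lemma cont_prod n (F : 'I_n -> P -> R) (Q : pred 'I_n) : (forall i, continuous (F i)) ->
  continuous (fun x => \prod_(i | Q i) F i x).
Proof.
move=> cF; apply: (@continuous_big R _ *%R 1 Q _ P _ F) => [|i _]; last exact: cF.
exact: mul_continuous.
Qed.

Lemma cont_bigmax n (F : 'I_n -> P -> R) : (forall i, continuous (F i)) ->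
  continuous (fun x => \big[Num.max/0]_i F i x).
Proof.
move=> cF; apply: (@continuous_big R _ Num.max 0 xpredT _ P _ F) => [|i _]; last exact: cF.
exact: max_continuous.
Qed.

End RealCombinators.

(** * Cubes *)

Section Cubes.
Variable R : realType.
Local Notation I := (unit_interval R).

Definition clamp (x : R) : R := Num.max 0 (Num.min 1 x).

Lemma clamp_in x : 0 <= clamp x <= 1.
Proof. by rewrite /clamp le_max lexx /= ge_max ler01 ge_min lexx. Qed.

Lemma clamp_id x : 0 <= x <= 1 -> clamp x = x.
Proof. by move=> /andP[x0 x1]; rewrite /clamp min_r // max_r. Qed.

Lemma cont_clamp (P : topologicalType) (f : P -> R) :
  continuous f -> continuous (fun x => clamp (f x)).
Proof.
move=> cf; apply: cont_max; first exact: cont_const.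
by apply: cont_min => //; exact: cont_const.
Qed.

Lemma set_type_continuous (T : topologicalType) (A : set T) :
  continuous (set_val : set_type A -> T).
Proof. exact: initial_continuous. Qed.

Lemma to_set_type_continuous (P T : topologicalType) (A : set T) (f : P -> set_type A) :
  continuous (fun x => set_val (f x)) -> continuous f.
Proof. exact: (@continuous_comp_initial _ P T set_val f). Qed.

Lemma clamp_mem x : clamp x \in (`[0, 1]%classic : set R).
Proof. by apply/mem_set; rewrite /= in_itv /= clamp_in. Qed.

(** Clamping makes this total, so that continuity and bounds can be checked
    separately. *)
Definition to_unit (x : R) : I := exist (fun y => y \in (`[0, 1]%classic : set R)) _ (clamp_mem x).

Lemma unit_bounds (t : I) : 0 <= val t <= 1.
Proof. by case: t => t /= /set_mem; rewrite /= in_itv. Qed.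

Lemma val_to_unit x : 0 <= x <= 1 -> val (to_unit x) = x.
Proof. exact: clamp_id. Qed.

Lemma to_unitK (t : I) : to_unit (val t) = t.
Proof. by apply: val_inj; rewrite val_to_unit // unit_bounds. Qed.

Lemma cont_to_unit (P : topologicalType) (f : P -> R) :
  continuous f -> continuous (fun x => to_unit (f x)).
Proof. by move=> cf; apply: to_set_type_continuous; exact: cont_clamp. Qed.

Lemma cont_unit_val : continuous (fun t : I => val t : R).
Proof. exact: set_type_continuous. Qed.

Definition i0 : I := to_unit 0.
Definition i1 : I := to_unit 1.

Lemma val_i0 : val i0 = 0. Proof. by rewrite val_to_unit // lexx ler01. Qed.
Lemma val_i1 : val i1 = 1. Proof. by rewrite val_to_unit // lexx ler01. Qed.

Lemma eq_i0 (t : I) : (val t = 0) <-> (t = i0).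
Proof. by split=> [t0|->]; [apply: val_inj; rewrite val_i0|exact: val_i0]. Qed.

Lemma eq_i1 (t : I) : (val t = 1) <-> (t = i1).
Proof. by split=> [t0|->]; [apply: val_inj; rewrite val_i1|exact: val_i1]. Qed.

Lemma i1_neq_i0 : i1 <> i0.
Proof. by move=> /(congr1 val); rewrite val_i0 val_i1 => /eqP; rewrite oner_eq0. Qed.

Section Cube.
Variable n : nat.
Local Notation D := (cube R n).

Lemma to_cube_mem (x : 'I_n -> R) :
  (\row_j clamp (x j)) \in [set x : 'rV[R]_n | forall i, 0 <= x ord0 i <= 1].
Proof. by apply/mem_set => i; rewrite mxE clamp_in. Qed.

Definition to_cube (x : 'I_n -> R) : D :=
  exist (fun y => y \in [set x : 'rV[R]_n | forall i, 0 <= x ord0 i <= 1])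
   _ (to_cube_mem x).

Lemma cube_bounds (s : D) i : 0 <= val s ord0 i <= 1.
Proof. by case: s => s /= /set_mem. Qed.

Lemma val_to_cube x i : 0 <= x i <= 1 -> val (to_cube x) ord0 i = x i.
Proof. by move=> xi; rewrite /= mxE clamp_id. Qed.

Lemma cube_eq (s s' : D) : (forall i, val s ord0 i = val s' ord0 i) -> s = s'.
Proof. by move=> ss'; apply: val_inj; apply/rowP. Qed.

Lemma cont_cube_coord i : continuous (fun s : D => val s ord0 i : R).
Proof.
have cc : continuous (fun y : 'rV[R]_n => y ord0 i) := @coord_continuous _ _ _ _ _.
exact: (cont_comp (@set_type_continuous _ _) cc).
Qed.

Lemma cont_cube (P : topologicalType) (f : P -> D) :
  (forall i, continuous (fun x => val (f x) ord0 i : R)) -> continuous f.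
Proof.
move=> cf; apply: to_set_type_continuous => x U [V xV VU].
have : \forall y \near x, forall i j, V i j (val (f y) i j).
  apply: filter_forall => i; apply: filter_forall => j.
  by have := xV i j; rewrite (ord1 i) => /(cf j x).
by apply: filterS => y yV; exact: VU.
Qed.

Lemma cont_to_cube (P : topologicalType) (f : 'I_n -> P -> R) :
  (forall i, continuous (f i)) -> continuous (fun x => to_cube (fun i => f i x)).
Proof.
move=> cf; apply: cont_cube => i; under eq_fun do rewrite /= mxE.
exact: cont_clamp.
Qed.

(** The norm whose unit ball is the cube, centred at its barycentre. *)
Definition cube_gauge (s : D) : R := \big[Num.max/0]_i `|2 * val s ord0 i - 1|.

Lemma cont_cube_gauge : continuous cube_gauge.
Proof.
apply: cont_bigmax => i; apply: cont_norm; apply: contB; last exact: cont_const.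
by apply: contM; [exact: cont_const|exact: cont_cube_coord].
Qed.

Lemma cube_gauge_ge (s : D) i : `|2 * val s ord0 i - 1| <= cube_gauge s.
Proof. exact: le_bigmax. Qed.

Lemma cube_gauge_le1 (s : D) : cube_gauge s <= 1.
Proof.
apply: bigmax_le => // i _; rewrite ler_norml; have := cube_bounds s i.
by move=> /andP[]; lra.
Qed.

Lemma cube_gauge_boundary (s : D) : cube_boundary s -> cube_gauge s = 1.
Proof.
move=> [i si]; apply/eqP; rewrite eq_le cube_gauge_le1 /=.
apply: le_trans (cube_gauge_ge s i).
by case: si => ->; rewrite ?mulr0 ?sub0r ?normrN1 // mulr1 ger0_norm; lra.
Qed.

Lemma cube_gauge_attained (s : D) : 0 < cube_gauge s ->
  exists i, cube_gauge s = `|2 * val s ord0 i - 1|.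
Proof.
move=> s0; apply: contrapT => /forallNP ns.
suff : cube_gauge s < cube_gauge s by rewrite ltxx.
rewrite {1}/cube_gauge; apply: bigmax_lt => // i _.
by rewrite lt_neqAle cube_gauge_ge andbT; apply/eqP => /esym/ns.
Qed.

Lemma closed_cube_boundary : closed (@cube_boundary R n).
Proof.
have -> : @cube_boundary R n = \bigcup_(i in [set: 'I_n])
    ((fun s : D => val s ord0 i : R) @^-1` [set 0] `|`
     (fun s : D => val s ord0 i : R) @^-1` [set 1]).
  by apply/seteqP; split=> [s [i si]|s [i _ si]]; exists i.
apply: closed_bigcup; first exact: finite_finset.
by move=> i _; apply: closedU; have /continuous_closedP := @cont_cube_coord i;
  apply; exact: closed_eq.
Qed.

(* Writing [y] for the position relative to the centre, scaled to the
   gauge, the centre of projection is [(0, 2)]. The line through [(y, t)]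
   meets the bottom at [y / (1 - t / 2)] and the sides at a gauge of 1;
   the nearer point is obtained by dividing by the larger of the two
   factors. *)
Let radius (q : D * I) : R := Num.max (cube_gauge q.1) (1 - val q.2 / 2).

Lemma radius_ge q : 1 / 2 <= radius q.
Proof. by rewrite le_max; apply/orP; right; have /andP[] := unit_bounds q.2; lra. Qed.

Lemma radius_gt0 q : 0 < radius q.
Proof. by apply: lt_le_trans (radius_ge q); lra. Qed.

Lemma radius_le1 q : radius q <= 1.
Proof.
by rewrite ge_max cube_gauge_le1 andTb; have /andP[] := unit_bounds q.2; lra.
Qed.

Lemma cont_radius : continuous radius.
Proof.
apply: cont_max.
  exact: (cont_comp (@cont_fst _ _) cont_cube_gauge).
apply: contB; first exact: cont_const.
apply: contM; last exact: cont_const.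
exact: (cont_comp (@cont_snd _ _) cont_unit_val).
Qed.

(** The radial projection of the cylinder over the cube, from a point above
    the centre of its top face, onto the bottom and the sides. *)
Definition cube_retract (q : D * I) : D * I :=
  (to_cube (fun i => 1 / 2 + (val q.1 ord0 i - 1 / 2) / radius q),
   to_unit (2 - (2 - val q.2) / radius q)).

Lemma cont_cube_retract : continuous cube_retract.
Proof.
have cV : continuous (fun q => (radius q)^-1).
  apply: contV; last exact: cont_radius.
  by move=> q; rewrite gt_eqF // radius_gt0.
apply: cont_pair.
  apply: cont_to_cube => i; apply: contD; first exact: cont_const.
  apply: contM => //; apply: contB; last exact: cont_const.
  exact: (cont_comp (@cont_fst _ _) (@cont_cube_coord i)).
apply: cont_to_unit; apply: contB; first exact: cont_const.
apply: contM => //; apply: contB; first exact: cont_const.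
exact: (cont_comp (@cont_snd _ _) cont_unit_val).
Qed.

Lemma cube_retract_coord q i :
  val (cube_retract q).1 ord0 i = 1 / 2 + (val q.1 ord0 i - 1 / 2) / radius q.
Proof.
rewrite val_to_cube //.
have : `|(val q.1 ord0 i - 1 / 2) / radius q| <= 1 / 2.
  rewrite normrM normfV (gtr0_norm (radius_gt0 q)) ler_pdivrMr ?radius_gt0 //.
  have : cube_gauge q.1 <= radius q by rewrite le_max lexx.
  have := cube_gauge_ge q.1 i; move: (val q.1 ord0 i) => z.
  by rewrite !ler_norml => /andP[? ?] ?; apply/andP; split; lra.
by rewrite ler_norml => /andP[]; lra.
Qed.

Lemma cube_retract_height q : val (cube_retract q).2 = 2 - (2 - val q.2) / radius q.
Proof.
rewrite val_to_unit //; have /andP[t0 t1] := unit_bounds q.2.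
have r0 := radius_gt0 q; have r1 := radius_le1 q.
have : 1 - val q.2 / 2 <= radius q by rewrite le_max lexx orbT.
move=> r2; apply/andP; split.
  by rewrite subr_ge0 ler_pdivrMr //; lra.
rewrite lerBlDr -lerBlDl ler_pdivlMr //; nra.
Qed.

Lemma cube_retract_fix q : q.2 = i0 \/ cube_boundary q.1 -> cube_retract q = q.
Proof.
move=> q0; have r1 : radius q = 1.
  apply/eqP; rewrite eq_le radius_le1 /= le_max.
  case: q0 => [->|/cube_gauge_boundary ->]; last by rewrite lexx.
  by rewrite val_i0 mul0r subr0 lexx orbT.
case: q r1 {q0} => s t r1; congr (_, _).
  apply: cube_eq => i; rewrite [LHS](cube_retract_coord (s, t)) r1 /=; lra.
by apply: val_inj; rewrite [LHS](cube_retract_height (s, t)) r1 /=; lra.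
Qed.

(** The projection reaches the sides first exactly when the gauge exceeds [1 -
    t / 2], where [t] is the height. *)
Lemma cube_retract_in q : (cube_retract q).2 = i0 \/ cube_boundary (cube_retract q).1.
Proof.
have r0 := radius_gt0 q.
have [mt|tm] := leP (cube_gauge q.1) (1 - val q.2 / 2).
  left; apply/eq_i0; rewrite cube_retract_height.
  have -> : radius q = (2 - val q.2) / 2 by rewrite /radius max_r //; lra.
  have : 2 - val q.2 != 0 by have /andP[] := unit_bounds q.2; lra.
  by move=> ?; field.
right; have rE : radius q = cube_gauge q.1 by rewrite /radius max_l // ltW.
have [|i iE] := @cube_gauge_attained q.1; first by rewrite -rE.
exists i; rewrite cube_retract_coord rE iE.
have : 2 * val q.1 ord0 i - 1 != 0 by rewrite -normr_gt0 -iE -rE.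
move: (val q.1 ord0 i) => z z0; have [zp|zn] := ger0P (2 * z - 1); [right|left]; field; lra.
Qed.

End Cube.

(** * Homotopy extension *)

(** The homotopy extension property of the pair [(D, A)]. Functions on [A] are
    total functions that are continuous within [A]. *)
Definition HEP (D : topologicalType) (A : set D) :=
  forall (Z : topologicalType) (F : D -> Z) (G : D * I -> Z),
    continuous F -> {within [set q | A q.1], continuous G} ->
    (forall x, A x -> G (x, i0) = F x) ->
    exists E : D * I -> Z, [/\ continuous E, forall x, E (x, i0) = F x
      & forall x t, A x -> E (x, t) = G (x, t)].

Lemma closed_i0 : closed [set i0].
Proof.
have -> : [set i0] = (fun t : I => val t : R) @^-1` [set 0].
  by apply/seteqP; split=> t /= /eq_i0.
have /continuous_closedP := cont_unit_val; apply; exact: closed_eq.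
Qed.

Lemma closed_i1 : closed [set i1].
Proof.
have -> : [set i1] = (fun t : I => val t : R) @^-1` [set 1].
  by apply/seteqP; split=> t /= /eq_i1.
have /continuous_closedP := cont_unit_val; apply; exact: closed_eq.
Qed.

Lemma closed_preimage (P Q : topologicalType) (f : P -> Q) (B : set Q) :
  continuous f -> closed B -> closed [set x | B (f x)].
Proof. by move=> /continuous_closedP cf; exact: cf. Qed.

(** Extend along the retraction of the cylinder. *)
Lemma HEP_cube n : HEP (@cube_boundary R n).
Proof.
move=> Z F G cF cG FG.
pose k (q : cube R n * I) := if pselect (q.2 = i0) then F q.1 else G q.
have kG x t : cube_boundary x -> k (x, t) = G (x, t).
  by move=> bx; rewrite /k /=; case: pselect => //= t0; rewrite t0 FG.
exists (fun q => k (cube_retract q)); split.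
- pose B (b : bool) : set (cube R n * I) :=
    if b then [set q | q.2 = i0] else [set q | cube_boundary q.1].
  apply: (within_comp_cont (B := [set q | q.2 = i0 \/ cube_boundary q.1])).
  + exact: cont_cube_retract.
  + exact: cube_retract_in.
  apply: (@within_glue bool _ _ _ B) => [q [q0|q0]|[]|[]]; first by exists true.
  + by exists false.
  + exact: (closed_preimage (@cont_snd _ _) closed_i0).
  + rewrite -[B false]/[set q : cube R n * I | cube_boundary q.1].
    exact: (closed_preimage (@cont_fst _ _) (@closed_cube_boundary n)).
  + apply: (within_eq (f := fun q => F q.1)).
      by move=> q q0; rewrite /k; case: pselect.
    by apply: cont_within; exact: (cont_comp (@cont_fst _ _) cF).
  + by apply: within_eq cG => -[x t] bx; rewrite kG.
- move=> x; rewrite cube_retract_fix; last by left.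
  by rewrite /k /=; case: pselect.
- by move=> x t bx; rewrite cube_retract_fix ?kG //; right.
Qed.

Lemma HEP_homeo (D' D : topologicalType) (A' : set D') (A : set D)
    (c : D' -> D) (g : D -> D') :
  continuous c -> continuous g -> cancel c g -> cancel g c ->
  (forall x, A' x <-> A (c x)) -> HEP A' -> HEP A.
Proof.
move=> cc cg cK gK AA hep Z F G cF cG FG.
have [|||E [cE E0 EA]] := hep Z (fun x => F (c x)) (fun q => G (c q.1, q.2)).
- exact: cont_comp cF.
- apply: within_comp cG; last by move=> q /AA.
  apply: cont_within; apply: cont_pair; last exact: cont_snd.
  exact: (cont_comp (@cont_fst _ _)).
- by move=> x /AA; exact: FG.
exists (fun q => E (g q.1, q.2)); split.
- apply: cont_comp cE; apply: cont_pair; last exact: cont_snd.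
  exact: (cont_comp (@cont_fst _ _)).
- by move=> x; rewrite /= E0 gK.
- by move=> x t Ax; rewrite /= EA /= ?gK //; apply/AA; rewrite gK.
Qed.

Section Prism.
Variable m : nat.

Definition prism_boundary : set (cube R m * I) :=
  [set p | [\/ p.2 = i0, p.2 = i1 | cube_boundary p.1]].

(** The extra coordinate comes first; the identification of a prism with a
    cube is what relates null-homotopies of spheroids to spheroids one
    dimension up. *)
Definition pack (p : cube R m * I) : cube R m.+1 :=
  to_cube (fun j => if unlift ord0 j is Some k then val p.1 ord0 k else val p.2).

Definition unpack (z : cube R m.+1) : cube R m * I :=
  (to_cube (fun k => val z ord0 (lift ord0 k)), to_unit (val z ord0 ord0)).

Lemma pack0 p : val (pack p) ord0 ord0 = val p.2.
Proof. by rewrite val_to_cube unlift_none // unit_bounds. Qed.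

Lemma packS p k : val (pack p) ord0 (lift ord0 k) = val p.1 ord0 k.
Proof. by rewrite val_to_cube liftK // cube_bounds. Qed.

Lemma packK : cancel pack unpack.
Proof.
move=> [s t]; congr (_, _); last first.
  by apply: val_inj; rewrite val_to_unit pack0 // unit_bounds.
by apply: cube_eq => k; rewrite val_to_cube packS // cube_bounds.
Qed.

Lemma unpackK : cancel unpack pack.
Proof.
move=> z; apply: cube_eq => j; case: (unliftP ord0 j) => [k|] ->.
  by rewrite packS val_to_cube // cube_bounds.
by rewrite pack0 val_to_unit // cube_bounds.
Qed.

Lemma cont_pack : continuous pack.
Proof.
apply: cont_to_cube => j; case: unlift => [k|].
  exact: (cont_comp (@cont_fst _ _) (@cont_cube_coord m k)).
exact: (cont_comp (@cont_snd _ _) cont_unit_val).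
Qed.

Lemma cont_unpack : continuous unpack.
Proof.
apply: cont_pair; last by apply: cont_to_unit; exact: cont_cube_coord.
by apply: cont_to_cube => k; exact: cont_cube_coord.
Qed.

Lemma pack_boundary p : cube_boundary (pack p) <-> prism_boundary p.
Proof.
split=> [[j]|].
  case: (unliftP ord0 j) => [k|] -> ; rewrite ?packS ?pack0 => bj.
    by apply: Or33; exists k.
  by case: bj => [/eq_i0|/eq_i1]; [exact: Or31|exact: Or32].
case=> [/eq_i0 p0|/eq_i1 p1|[k bk]].
- by exists ord0; rewrite pack0; left.
- by exists ord0; rewrite pack0; right.
- by exists (lift ord0 k); rewrite packS.
Qed.

Lemma closed_prism_boundary : closed prism_boundary.
Proof.
have -> : prism_boundary = [set p | cube_boundary (pack p)].
  by apply/seteqP; split=> p /pack_boundary.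
exact: (closed_preimage cont_pack (@closed_cube_boundary m.+1)).
Qed.

Lemma HEP_prism : HEP prism_boundary.
Proof.
apply: (HEP_homeo cont_unpack cont_pack unpackK packK _ (@HEP_cube m.+1)).
by move=> z; rewrite -pack_boundary unpackK.
Qed.

End Prism.

Definition cylinder_boundary (D : topologicalType) (A : set D) : set (D * I) :=
  [set q | [\/ q.2 = i0, q.2 = i1 | A q.1]].

Lemma HEP_prism_cylinder m : HEP (cylinder_boundary (@prism_boundary m)).
Proof.
apply: (@HEP_homeo _ _ _ _ (fun q : cube R m.+1 * I => (unpack q.1, q.2))
   (fun q => (pack q.1, q.2)) _ _ _ _ _ (@HEP_prism m.+1)).
- apply: cont_pair; last exact: cont_snd.
  exact: (cont_comp (@cont_fst _ _) (@cont_unpack m)).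
- apply: cont_pair; last exact: cont_snd.
  exact: (cont_comp (@cont_fst _ _) (@cont_pack m)).
- by move=> [z t] /=; rewrite unpackK.
- by move=> [z t] /=; rewrite packK.
- move=> [z t]; have bz : cube_boundary z <-> prism_boundary (unpack z).
    by rewrite -pack_boundary unpackK.
  by split; case=> [t0|t1|/bz b]; [exact: Or31|exact: Or32|exact: Or33|
    exact: Or31|exact: Or32|exact: Or33].
Qed.

End Cubes.

(** * Homotopy extension and lifting *)

Section HomotopyLifting.
Variables (R : realType) (X Y : topologicalType) (f : continuousType X Y).
Local Notation I := (unit_interval R).
Local Notation i0 := (i0 R).
Local Notation i1 := (i1 R).

Lemma underlying_continuous : continuous f. Proof. exact: cts_fun. Qed.

Section Problem.
Variables (D : topologicalType) (A : set D).

(** A lifting problem consists of a map [u] into [X] and a homotopy [h] in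
    [Y], both on [A], and of a map [sg] into [Y] on [D]. In terms of path
    cells: [(u, h)] lives on the boundary, [sg] is the end of the cell to be
    found. *)
Definition solvable (u : D -> X) (h : D * I -> Y) (sg : D -> Y) :=
  exists (U : D -> X) (H : D * I -> Y),
    [/\ continuous U /\ continuous H, forall x, A x -> U x = u x,
        forall x t, A x -> H (x, t) = h (x, t),
        forall x, H (x, i0) = f (U x) & forall x, H (x, i1) = sg x].

(** The homotopy extension and lifting property of [f] with respect to the
    pair [(D, A)]. *)
Definition HELP := forall (u : D -> X) (h : D * I -> Y) (sg : D -> Y),
  {within A, continuous u} -> {within [set q | A q.1], continuous h} ->
  continuous sg -> (forall x, A x -> h (x, i0) = f (u x)) ->
  (forall x, A x -> h (x, i1) = sg x) -> solvable u h sg.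

Lemma eq_solvable u u' h h' sg :
  (forall x, A x -> u x = u' x) -> (forall x t, A x -> h (x, t) = h' (x, t)) ->
  solvable u h sg -> solvable u' h' sg.
Proof.
move=> uu hh [U [H [c UA HA H0 H1]]]; exists U, H; split=> // [x Ax|x t Ax].
  by rewrite UA ?uu.
by rewrite HA ?hh.
Qed.

Lemma cont_at_fst (P Q S : topologicalType) (B : set P) (g : P * Q -> S) q :
  {within [set p | B p.1], continuous g} -> {within B, continuous (fun x => g (x, q))}.
Proof.
move=> cg; apply: within_comp cg => //; apply: cont_within.
by apply: cont_pair; [exact: cont_id|exact: cont_const].
Qed.

Lemma cont_at_fstT (P Q S : topologicalType) (g : P * Q -> S) q :
  continuous g -> continuous (fun x => g (x, q)).
Proof.
move=> cg; apply: cont_comp cg.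
by apply: cont_pair; [exact: cont_id|exact: cont_const].
Qed.

Definition flip (t : I) : I := to_unit (1 - val t).

Lemma val_flip t : val (flip t) = 1 - val t.
Proof. by rewrite val_to_unit //; have /andP[? ?] := unit_bounds t; lra. Qed.

Lemma flip0 : flip i0 = i1.
Proof. by apply/eq_i1; rewrite val_flip val_i0 subr0. Qed.

Lemma flip1 : flip i1 = i0.
Proof. by apply/eq_i0; rewrite val_flip val_i1 subrr. Qed.

Lemma flipK : involutive flip.
Proof. by move=> t; apply: val_inj; rewrite !val_flip; lra. Qed.

Lemma cont_flip : continuous flip.
Proof.
apply: cont_to_unit; apply: contB; first exact: cont_const.
exact: cont_unit_val.
Qed.

Hypotheses (cA : closed A) (hepA : HEP R A) (hepC : @HEP R (D * I)%type (cylinder_boundary A)).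

(** Solvability is invariant under deformation of the problem. Homotopy
    extension in [X] carries the lift [U] along, and homotopy extension for
    the cylinder over [D] carries the homotopy along, its values being
    prescribed at both ends and over [A]. *)
Lemma solvable_transport (u : D * I -> X) (h : (D * I) * I -> Y) (sg : D * I -> Y) :
  {within [set q | A q.1], continuous u} ->
  {within [set q | A q.1.1], continuous h} -> continuous sg ->
  (forall x t, A x -> h ((x, i0), t) = f (u (x, t))) ->
  (forall x t, A x -> h ((x, i1), t) = sg (x, t)) ->
  solvable (fun x => u (x, i0)) (fun q => h (q, i0)) (fun x => sg (x, i0)) ->
  solvable (fun x => u (x, i1)) (fun q => h (q, i1)) (fun x => sg (x, i1)).
Proof.
move=> cu ch csg h0 h1 [U [H [[cU cH] UA HA H0 H1]]].
have [|E [cE E0 EA]] := hepA cU cu; first by move=> x Ax; rewrite UA.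
pose G (q : (D * I) * I) : Y :=
  if pselect (q.1.2 = i0) then f (E (q.1.1, q.2))
  else if pselect (q.1.2 = i1) then sg (q.1.1, q.2) else h q.
have G0 x t : G ((x, i0), t) = f (E (x, t)) by rewrite /G /=; case: pselect.
have G1 x t : G ((x, i1), t) = sg (x, t).
  rewrite /G /=; case: pselect => [e|ne] /=; first by case: (i1_neq_i0 e).
  by case: pselect.
have GA x s t : A x -> G ((x, s), t) = h ((x, s), t).
  move=> Ax; have [s0|s0] := pselect (s = i0); first by rewrite s0 G0 h0 ?EA.
  have [s1|s1] := pselect (s = i1); first by rewrite s1 G1 h1.
  by rewrite /G /=; case: pselect => //; case: pselect.
have cG : {within [set q | cylinder_boundary A q.1], continuous G}.
  pose B (j : 'I_3) : set ((D * I) * I) :=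
    nth setT [:: [set q | q.1.2 = i0]; [set q | q.1.2 = i1]; [set q | A q.1.1]] j.
  have c12 : continuous (fun q : (D * I) * I => q.1.2).
    exact: (cont_comp (@cont_fst _ _) (@cont_snd _ _)).
  have c11 : continuous (fun q : (D * I) * I => q.1.1).
    exact: (cont_comp (@cont_fst _ _) (@cont_fst _ _)).
  have c2 : continuous (fun q : (D * I) * I => (q.1.1, q.2)).
    by apply: cont_pair => //; exact: cont_snd.
  apply: (@within_glue 'I_3 _ _ _ B).
  - move=> q [q0|q1|qA].
    + by exists (@Ordinal 3 0 isT).
    + by exists (@Ordinal 3 1 isT).
    + by exists (@Ordinal 3 2 isT).
  - case=> [[|[|[|k]]] jk] //.
    + exact: (closed_preimage c12 (@closed_i0 R)).
    + exact: (closed_preimage c12 (@closed_i1 R)).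
    + exact: (closed_preimage c11 cA).
  - case=> [[|[|[|k]]] jk] //.
    + apply: (within_eq (f := fun q => f (E (q.1.1, q.2)))).
        by move=> [[x s] t] s0; have -> : s = i0 := s0; rewrite G0.
      apply: cont_within; exact: (cont_comp (cont_comp c2 cE) underlying_continuous).
    + apply: (within_eq (f := fun q => sg (q.1.1, q.2))).
        by move=> [[x s] t] s1; have -> : s = i1 := s1; rewrite G1.
      apply: cont_within; exact: (cont_comp c2 csg).
    + by apply: within_eq ch => -[[x s] t] Ax; rewrite GA.
have [|E' [cE' E'0 E'A]] := hepC cH cG.
  move=> [x s] [/= ->|/= ->|/= Ax].
  - by rewrite G0 E0 H0.
  - by rewrite G1 H1.
  - by rewrite GA // HA.
exists (fun x => E (x, i1)), (fun q => E' (q, i1)); split.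
- by split; exact: cont_at_fstT.
- by move=> x Ax; rewrite EA.
- by move=> x t Ax; rewrite E'A ?GA //; exact: Or33.
- by move=> x; rewrite E'A ?G0 //; exact: Or31.
- by move=> x; rewrite E'A ?G1 //; exact: Or32.
Qed.

(** Only the data on [A] have to be deformed: homotopy extension makes [sg]
    follow. Transport is used backwards, from the deformed problem to the
    given one. *)
Lemma solvable_deform (u : D * I -> X) (h : (D * I) * I -> Y) (sg : D -> Y) :
  {within [set q | A q.1], continuous u} ->
  {within [set q | A q.1.1], continuous h} -> continuous sg ->
  (forall x t, A x -> h ((x, i0), t) = f (u (x, t))) ->
  (forall x, A x -> h ((x, i1), i0) = sg x) ->
  (forall sg' : D -> Y, continuous sg' ->
     (forall x, A x -> h ((x, i1), i1) = sg' x) ->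
     solvable (fun x => u (x, i1)) (fun q => h (q, i1)) sg') ->
  solvable (fun x => u (x, i0)) (fun q => h (q, i0)) sg.
Proof.
move=> cu ch csg h0 h1 solve1.
have c2 : continuous (fun q : D * I => ((q.1, i1), q.2)).
  apply: cont_pair; last exact: cont_snd.
  by apply: cont_pair; [exact: cont_fst|exact: cont_const].
have [|||E [cE E0 EA]] := hepA (F := sg) (G := fun q => h ((q.1, i1), q.2)) => //.
  by apply: within_comp ch => //; exact: cont_within.
have cfl (P : topologicalType) : continuous (fun q : P * I => (q.1, flip q.2)).
  apply: cont_pair; first exact: cont_fst.
  exact: (cont_comp (@cont_snd _ _) cont_flip).
have := @solvable_transport (fun q => u (q.1, flip q.2))
  (fun q => h (q.1, flip q.2)) (fun q => E (q.1, flip q.2)).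
rewrite /= flip0 flip1; under [fun x => E (x, i0)]eq_fun do rewrite E0.
apply=> //.
- by apply: within_comp cu => //; apply: cont_within; exact: cfl.
- by apply: within_comp ch => //; apply: cont_within; exact: cfl.
- exact: (cont_comp (cfl D) cE).
- by move=> x t Ax; rewrite h0.
- by move=> x t Ax; rewrite EA.
- apply: solve1; first exact: cont_at_fstT.
  by move=> x Ax; rewrite EA.
Qed.

(** The homotopy on the boundary can be run back to its start, [sg] following
    along. *)
Lemma HELP_stationary :
  (forall (u : D -> X) (sg : D -> Y), {within A, continuous u} -> continuous sg ->
     (forall x, A x -> f (u x) = sg x) -> solvable u (fun q => f (u q.1)) sg) ->
  HELP.
Proof.
move=> stat u h sg cu ch csg h0 h1.
pose k (q : (D * I) * I) : D * I := (q.1.1, to_unit (val q.1.2 * (1 - val q.2))).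
have ck : continuous k.
  apply: cont_pair; first exact: (cont_comp (@cont_fst _ _) (@cont_fst _ _)).
  apply: cont_to_unit; apply: contM.
    exact: (cont_comp (cont_comp (@cont_fst _ _) (@cont_snd _ _)) (@cont_unit_val R)).
  apply: contB; first exact: cont_const.
  exact: (cont_comp (@cont_snd _ _) (@cont_unit_val R)).
have k0 x t : k ((x, i0), t) = (x, i0).
  by rewrite -[LHS]/(x, to_unit (val i0 * (1 - val t))) val_i0 mul0r.
have k1 q : k (q, i1) = (q.1, i0).
  by rewrite -[LHS]/(q.1, to_unit (val q.2 * (1 - val i1))) val_i1 subrr mulr0.
have k00 q : k (q, i0) = q.
  case: q => x t; rewrite -[LHS]/(x, to_unit (val t * (1 - val i0))).
  by rewrite val_i0 subr0 mulr1 to_unitK.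
have [|||x t Ax|x Ax|sg' csg' sg'E|U [H [c UA HA H0 H1]]] :=
  @solvable_deform (fun q => u q.1) (fun q => h (k q)) sg.
- by apply: within_comp cu => //; apply: cont_within; exact: cont_fst.
- by apply: within_comp ch => //; exact: cont_within.
- by [].
- by rewrite k0 h0.
- by rewrite k00 h1.
- have := stat u sg' cu csg'.
  case=> [x Ax|U [H [c UA HA H0 H1]]]; first by rewrite -sg'E // k1 h0.
  exists U, H; split=> // x t Ax; rewrite HA //= k1 h0 //.
- by exists U, H; split=> // x t Ax; rewrite HA //= k00.
Qed.

End Problem.

(** * Lifting along weak equivalences *)

Hypothesis wf : weak_homotopy_equivalence R f.

Lemma cube0_eq (s s' : cube R 0) : s = s'.
Proof. by apply: cube_eq => -[]. Qed.

(** Injectivity on homotopy groups, uniformly in the dimension: on the cube of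
    dimension 0 a null-homotopy is a path, and the statement is about path
    components. *)
Lemma null_homotopy_lift m (x0 : X) (a : cube R m -> X) (G : cube R m * I -> Y) :
  continuous a -> (forall s, cube_boundary s -> a s = x0) -> continuous G ->
  (forall s, G (s, i0) = f (a s)) -> (forall s, G (s, i1) = f x0) ->
  (forall s t, cube_boundary s -> G (s, t) = f x0) ->
  exists H : cube R m * I -> X,
    [/\ continuous H, forall s, H (s, i0) = a s, forall s, H (s, i1) = x0
      & forall s t, cube_boundary s -> H (s, t) = x0].
Proof.
case: m a G => [|m] a G ca a0 cG G0 G1 Gb.
  pose s0 : cube R 0 := to_cube (fun=> 0).
  have cp : continuous (fun t => G (s0, t)).
    by apply: cont_comp cG; apply: cont_pair; [exact: cont_const|exact: cont_id].
  have [|g [g0 g1]] := wf.1.1 (a s0) x0.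
    exists (mkcts cp); split=> t; [move/eq_i0|move/eq_i1] => ->; rewrite /mkcts.
      exact: G0.
    exact: G1.
  exists (fun q => g q.2); split.
  - by apply: (cont_comp (@cont_snd _ _)); exact: cts_fun.
  - by move=> s; rewrite g0 ?val_i0 //; congr a; exact: cube0_eq.
  - by move=> s; rewrite g1 ?val_i1.
  - by move=> s t [[]].
have [] := wf.2 m x0 => + _ => /(_ (mkcts ca) (mkcts (@cont_const _ _ x0))).
case=> //.
  exists (mkcts cG); split=> [s t /eq_i0 ->|s t /eq_i1 ->|s t]; rewrite /mkcts.
  - exact: G0.
  - exact: G1.
  - exact: Gb.
move=> H [H0 H1 Hb]; exists H; split.
- exact: cts_fun.
- by move=> s; rewrite H0 ?val_i0.
- by move=> s; rewrite H1 ?val_i1.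
- exact: Hb.
Qed.

Section Prism.
Variable m : nat.
Local Notation D := (cube R m * I)%type.
Local Notation A := (@prism_boundary R m).

Let cA : closed A := @closed_prism_boundary R m.
Let hepA : HEP R A := @HEP_prism R m.
Let hepC : @HEP R (D * I)%type (cylinder_boundary A) := @HEP_prism_cylinder R m.

(** A map that is constant on the boundary of the prism is a spheroid, so this
    is surjectivity on homotopy groups. *)
Lemma prism_solve_const (x0 : X) (sg : D -> Y) : continuous sg ->
  (forall p, A p -> sg p = f x0) -> solvable A (fun=> x0) (fun=> f x0) sg.
Proof.
move=> csg sgA.
have cc : continuous (fun z => sg (unpack z)).
  exact: (cont_comp (@cont_unpack R m) csg).
have [] := wf.2 m x0 => _ /(_ (mkcts cc)) [|a ax0 [H [H0 H1 Hb]]].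
  by move=> z bz; apply: sgA; apply/pack_boundary; rewrite unpackK.
exists (fun p => a (pack p)), (fun q => H (pack q.1, q.2)); split.
- split; first by apply: (cont_comp (@cont_pack R m)); exact: cts_fun.
  apply: (cont_comp (f := fun q : D * I => (pack q.1, q.2))); last exact: cts_fun.
  apply: cont_pair; last exact: cont_snd.
  exact: (cont_comp (@cont_fst _ _) (@cont_pack R m)).
- by move=> p /pack_boundary; exact: ax0.
- by move=> p t /pack_boundary; exact: Hb.
- by move=> p; rewrite H0 ?val_i0.
- by move=> p; rewrite H1 ?val_i1 //; exact: (congr1 sg (packK p)).
Qed.

(** The restriction of [u] to the bottom is a spheroid whose image is null-
    homotopic through [sg]. Injectivity gives a null-homotopy in [X], which
    deforms the problem to one in which [u] is constant. *)
Lemma prism_solve_bottom (x0 : X) (u : D -> X) (sg : D -> Y) :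
  {within A, continuous u} -> continuous sg ->
  (forall p, A p -> f (u p) = sg p) ->
  (forall p, p.2 = i1 \/ cube_boundary p.1 -> u p = x0) ->
  solvable A u (fun q => f (u q.1)) sg.
Proof.
move=> cu csg usg uJ.
have A0 s : A (s, i0) by exact: Or31.
have A1 s : A (s, i1) by exact: Or32.
have [|s bs|//|s|s|s t bs|H [cH H0 H1 Hb]] :=
    @null_homotopy_lift m x0 (fun s => u (s, i0)) sg.
- apply: (within_comp_cont (f := fun s => (s, i0)) _ A0 cu).
  by apply: cont_pair; [exact: cont_id|exact: cont_const].
- by apply: uJ; right.
- by rewrite usg.
- by rewrite -usg // uJ //; left.
- by rewrite -usg ?uJ //; [right|exact: Or33].
(* On the bottom the maximum of the height and the time is the time, so
   the null-homotopy is run; elsewhere on the boundary [H] has reached or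
   keeps the base point. *)
pose u' (q : D * I) := H (q.1.1, to_unit (Num.max (val q.1.2) (val q.2))).
have cu' : continuous u'.
  apply: cont_comp cH; apply: cont_pair.
    exact: (cont_comp (@cont_fst _ _) (@cont_fst _ _)).
  apply: cont_to_unit; apply: cont_max.
    exact: (cont_comp (cont_comp (@cont_fst _ _) (@cont_snd _ _)) (@cont_unit_val R)).
  exact: (cont_comp (@cont_snd _ _) (@cont_unit_val R)).
have u'0 p : A p -> u' (p, i0) = u p.
  case: p => s r Ap; rewrite -[LHS]/(H (s, to_unit (Num.max (val r) (val i0)))).
  rewrite val_i0 max_l; last by have /andP[] := unit_bounds r.
  rewrite to_unitK; case: Ap => /= [->|->|bs]; first by rewrite H0.
    by rewrite H1 uJ //; left.
  by rewrite Hb // uJ //; right.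
have u'1 p : u' (p, i1) = x0.
  rewrite -[LHS]/(H (p.1, to_unit (Num.max (val p.2) (val i1)))).
  rewrite val_i1 max_r; last by have /andP[] := unit_bounds p.2.
  by rewrite H1.
have cu'f : continuous (fun q : (D * I) * I => f (u' (q.1.1, q.2))).
  apply: cont_comp (@underlying_continuous); apply: cont_comp cu'.
  apply: cont_pair; last exact: cont_snd.
  exact: (cont_comp (@cont_fst _ _) (@cont_fst _ _)).
have := @solvable_deform _ _ cA hepA hepC u' (fun q => f (u' (q.1.1, q.2))) sg.
case=> //.
- exact: cont_within.
- exact: cont_within.
- by move=> p Ap; rewrite /= u'0 // usg.
- move=> sg' csg' sg'E.
  apply: (@eq_solvable _ _ (fun=> x0) _ (fun=> f x0)) => [p _|p t _|].
  + by rewrite u'1.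
  + by rewrite /= u'1.
  + by apply: prism_solve_const => // p Ap; rewrite -sg'E //= u'1.
- move=> U [H' [c UA HA H'0 H'1]]; exists U, H'; split=> // [p Ap|p t Ap].
    by rewrite UA // u'0.
  by rewrite HA //= u'0.
Qed.

(** The boundary off the bottom face is a retract of the prism, by [rho],
    hence contractible inside itself: shrink the prism linearly, then retract.
    Deforming [u] along this contraction, and extending the deformation over
    the bottom face, makes [u] constant off the bottom. *)
Lemma HELP_prism : HELP A.
Proof.
apply: (HELP_stationary cA hepA hepC) => u sg cu csg usg.
pose rho (p : D) : D := let q := cube_retract (p.1, flip p.2) in (q.1, flip q.2).
have crho : continuous rho.
  have c1 : continuous (fun p : D => cube_retract (p.1, flip p.2)).
    apply: cont_comp (@cont_cube_retract R m).
    apply: cont_pair; first exact: cont_fst.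
    exact: (cont_comp (@cont_snd _ _) (@cont_flip)).
  apply: cont_pair; first exact: (cont_comp c1 (@cont_fst _ _)).
  by apply: (cont_comp (cont_comp c1 (@cont_snd _ _))); exact: cont_flip.
have rhoJ p : p.2 = i1 \/ cube_boundary p.1 -> rho p = p.
  case: p => s t /= st; rewrite /rho cube_retract_fix ?flipK //.
  by case: st => [->|]; [left; rewrite flip1|right].
have Jrho p : A (rho p).
  rewrite /rho; have := cube_retract_in (p.1, flip p.2).
  by case=> [q0|bq]; [apply: Or32; exact: (etrans (congr1 _ q0) flip0)|apply: Or33].
pose scale (q : D * I) : D :=
  (to_cube (fun i => (1 - val q.2) * val q.1.1 ord0 i),
   to_unit ((1 - val q.2) * val q.1.2)).
have cscale : continuous scale.
  have c1 : continuous (fun q : D * I => 1 - val q.2 : R).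
    apply: contB; first exact: cont_const.
    exact: (cont_comp (@cont_snd _ _) (@cont_unit_val R)).
  apply: cont_pair.
    apply: cont_to_cube => i; apply: contM => //.
    exact: (cont_comp (cont_comp (@cont_fst _ _) (@cont_fst _ _)) (@cont_cube_coord R m i)).
  apply: cont_to_unit; apply: contM => //.
  exact: (cont_comp (cont_comp (@cont_fst _ _) (@cont_snd _ _)) (@cont_unit_val R)).
have scale0 p : scale (p, i0) = p.
  case: p => s r; congr (_, _); last first.
    by rewrite -[LHS]/(to_unit ((1 - val i0) * val r)) val_i0 subr0 mul1r to_unitK.
  rewrite -[LHS]/(to_cube (fun i => (1 - val i0) * val s ord0 i)).
  by apply: cube_eq => i; rewrite val_to_cube val_i0 subr0 mul1r // cube_bounds.
have scale1 p p' : scale (p, i1) = scale (p', i1).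
  rewrite /scale ![(_, i1).2]/= val_i1 subrr !mul0r; congr (to_cube _, _).
  by apply/funext => i; rewrite !mul0r.
pose v (q : D * I) := u (rho (scale q)).
have cv : continuous v.
  apply: (within_comp_cont (f := fun q => rho (scale q)) _ _ cu) => //.
  exact: cont_comp crho.
have vJ p : p.2 = i1 \/ cube_boundary p.1 -> v (p, i0) = u p.
  by move=> Jp; rewrite /v scale0 rhoJ.
have A0 s : A (s, i0) by exact: Or31.
have [|||w [cw w0 wb]] := @HEP_cube R m X (fun s => u (s, i0)) (fun q => v ((q.1, i0), q.2)).
- apply: (within_comp_cont (f := fun s => (s, i0)) _ A0 cu).
  by apply: cont_pair; [exact: cont_id|exact: cont_const].
- apply: cont_within; apply: cont_comp cv.
  apply: cont_pair; last exact: cont_snd.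
  by apply: cont_pair; [exact: cont_fst|exact: cont_const].
- by move=> s bs; rewrite vJ //; right.
(* The contraction [v] off the bottom face, and its extension [w] on that
   face. *)
pose u' (q : D * I) := if pselect (q.1.2 = i0) then w (q.1.1, q.2) else v q.
have u'J p t : p.2 = i1 \/ cube_boundary p.1 -> u' (p, t) = v (p, t).
  case: p => s r Jp; rewrite /u' /=; case: pselect => //= r0.
  case: Jp => /= [r1|bs]; first by case: (@i1_neq_i0 R); rewrite -r0 -r1.
  by rewrite wb //= r0.
have cu' : {within [set q | A q.1], continuous u'}.
  pose B (b : bool) : set (D * I) :=
    if b then [set q | q.1.2 = i0] else [set q | q.1.2 = i1 \/ cube_boundary q.1.1].
  have c12 : continuous (fun q : D * I => q.1.2).
    exact: (cont_comp (@cont_fst _ _) (@cont_snd _ _)).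
  have c11 : continuous (fun q : D * I => q.1.1).
    exact: (cont_comp (@cont_fst _ _) (@cont_fst _ _)).
  apply: (@within_glue bool _ _ _ B).
  - by move=> q [q0|q1|qb]; [exists true|exists false; left|exists false; right].
  - case; first exact: (closed_preimage c12 (@closed_i0 R)).
    apply: closedU; first exact: (closed_preimage c12 (@closed_i1 R)).
    exact: (closed_preimage c11 (@closed_cube_boundary R m)).
  - case.
      apply: (within_eq (f := fun q => w (q.1.1, q.2))).
        by move=> q q0; rewrite /u'; case: pselect.
      apply: cont_within; apply: cont_comp cw.
      by apply: cont_pair => //; exact: cont_snd.
    apply: (within_eq (f := v)); last exact: cont_within.
    by move=> [p t] Jp; rewrite u'J.
have u'0 p : A p -> u' (p, i0) = u p.
  case: p => s r Ap; rewrite /u' /=; case: pselect => [/= ->|/= r0]; first by rewrite w0.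
  by rewrite vJ //; case: Ap => //=; [left|right].
have cu'f : {within [set q | A q.1.1], continuous (fun q : (D * I) * I => f (u' (q.1.1, q.2)))}.
  apply: (within_comp (B := setT)) => //; last first.
    by apply: cont_within; exact: underlying_continuous.
  apply: within_comp cu' => //; apply: cont_within.
  apply: cont_pair; last exact: cont_snd.
  exact: (cont_comp (@cont_fst _ _) (@cont_fst _ _)).
have := @solvable_deform _ _ cA hepA hepC u' (fun q => f (u' (q.1.1, q.2))) sg.
case=> //.
- by move=> p Ap; rewrite /= u'0 // usg.
- move=> sg' csg' sg'E.
  apply: (prism_solve_bottom (x0 := v ((to_cube (fun=> 0), i0), i1))) => //.
    by apply: cont_at_fst cu'.
  by move=> p Jp; rewrite u'J // /v; congr (u (rho _)); exact: scale1.
- move=> U [H' [c UA HA H'0 H'1]]; exists U, H'; split=> // [p Ap|p t Ap].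
    by rewrite UA // u'0.
  by rewrite HA //= u'0.
Qed.

End Prism.

End HomotopyLifting.

(** * Quotient maps and relative homeomorphisms *)

Section Quotient.

(** A continuous map from a compact space to a Hausdorff space is closed. *)
Lemma quotient_continuous (P Q Z : topologicalType) (c : P -> Q) (E : Q -> Z) :
  compact [set: P] -> hausdorff_space Q -> continuous c ->
  (forall x, exists x', c x' = x) -> continuous (fun x => E (c x)) -> continuous E.
Proof.
move=> cP hQ cc csurj cE; apply/continuous_closedP => B cB.
have -> : E @^-1` B = c @` ((fun x => E (c x)) @^-1` B).
  apply/seteqP; split=> [x Bx|_ [x' Bx' <-] //].
  by have [x' x'x] := csurj x; exists x' => //=; rewrite x'x.
apply: compact_closed => //; apply: continuous_compact.
  by apply: continuous_subspaceT.
apply: (subclosed_compact _ cP) => //.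
by have /continuous_closedP := cE; apply.
Qed.

Lemma compact_set_type (T : topologicalType) (A : set T) :
  set_type A -> compact A -> compact [set: set_type A].
Proof.
move=> x0 cA.
have cg : {within A, continuous (valL_ x0 (@id (set_type A)))}.
  by apply/subspace_valL_continuousP' => x.
have := continuous_compact cg cA.
congr (compact _); apply/seteqP; split=> // x _.
exists (val x); first exact/set_mem/(valP x).
exact: (congr1 (@^~ x) (valLK x0 (@id (set_type A)))).
Qed.

Lemma compact_prod (P Q : topologicalType) :
  compact [set: P] -> compact [set: Q] -> compact [set: (P * Q)%type].
Proof. by move=> cP cQ; rewrite -setXTT; exact: compact_setX. Qed.

Variable R : realType.
Local Notation I := (unit_interval R).

Lemma compact_unit : compact [set: I].
Proof. by apply: compact_set_type; [exact: i0|exact: segment_compact]. Qed.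

Lemma compact_cube n : compact [set: cube R n].
Proof.
apply: compact_set_type; first exact: (to_cube (fun=> 0)).
have := @rV_compact R n (fun=> `[0, 1]%classic) (fun=> @segment_compact R 0 1).
congr (compact _); apply/seteqP; split=> x xi i; have := xi i; rewrite /= in_itv /= => //.
Qed.

Lemma hausdorff_Delta_unit n : hausdorff_space (Delta R n * I)%type.
Proof.
apply: (@hausdorff_separated R) => -[x t] [y s] xy; congr (_, _).
  apply: val_inj; apply/rowP => i.
  exact: (xy (fun q => val q.1 ord0 i) (cont_comp (@cont_fst _ _) (@simplex_coordP R n i))).
by apply: val_inj; exact: (xy (fun q => val q.2) (cont_comp (@cont_snd _ _) (@cont_unit_val R))).
Qed.

Section RelativeHomeomorphism.
Variables (D' D : topologicalType) (A' : set D') (A : set D) (c : D' -> D).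
Hypotheses (cD' : compact [set: D']) (hD : hausdorff_space D)
  (hDI : hausdorff_space (D * I)%type) (cc : continuous c)
  (csurj : forall x, exists x', c x' = x)
  (cA : forall x', A (c x') <-> A' x')
  (cinj : forall x' y', c x' = c y' -> ~ A' x' -> x' = y').

Lemma cyl_continuous : continuous (fun q : D' * I => (c q.1, q.2)).
Proof. by apply: cont_pair; [exact: (cont_comp (@cont_fst _ _))|exact: cont_snd]. Qed.

Lemma cyl_quotient (Z : topologicalType) (E : D * I -> Z) :
  continuous (fun q => E (c q.1, q.2)) -> continuous E.
Proof.
apply: quotient_continuous => //.
- by apply: compact_prod => //; exact: compact_unit.
- exact: cyl_continuous.
- by move=> [x t]; have [x' <-] := csurj x; exists (x', t).
Qed.

(** A relative homeomorphism exhibits [D] as [A] with [D'] attached along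
    [A']. A homotopy on [D'] that agrees with one coming from [A] therefore
    descends. *)
Lemma descend (Z : topologicalType) (E' : D' * I -> Z) (G : D * I -> Z) :
  continuous E' -> (forall x' t, A' x' -> E' (x', t) = G (c x', t)) ->
  exists E : D * I -> Z, continuous E /\ forall x' t, E (c x', t) = E' (x', t).
Proof.
move=> cE' E'A; have [g gK] := choice csurj.
have EE x' t : E' (g (c x'), t) = E' (x', t).
  have [Ax'|Ax'] := pselect (A' x').
    by rewrite !E'A //; rewrite ?gK //; apply/cA; rewrite gK; apply/cA.
  by rewrite [in RHS](cinj (esym (gK (c x'))) Ax').
exists (fun q => E' (g q.1, q.2)); split=> //.
apply: cyl_quotient => /=.
have -> : (fun q : D' * I => E' (g (c q.1), q.2)) = E'.
  by apply/funext => -[x' t]; exact: EE.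
exact: cE'.
Qed.

Lemma HEP_quotient : HEP R A' -> HEP R A.
Proof.
move=> hep Z F G cF cG FG.
have [|||E' [cE' E'0 E'A]] := hep Z (fun x => F (c x)) (fun q => G (c q.1, q.2)).
- exact: cont_comp cF.
- by apply: within_comp cG => [|q /cA //]; apply: cont_within; exact: cyl_continuous.
- by move=> x /cA; exact: FG.
have [E [cE EE]] := descend cE' E'A.
exists E; split=> // [x|x t]; have [x' <-] := csurj x; first by rewrite EE E'0.
by move=> /cA Ax'; rewrite EE E'A.
Qed.

Lemma HELP_quotient (X Y : topologicalType) (f : continuousType X Y) :
  HELP R f A' -> HELP R f A.
Proof.
move=> help u h sg cu ch csg h0 h1.
have [|||||U' [H' [[cU' cH'] U'A H'A H'0 H'1]]] :=
    help (fun x => u (c x)) (fun q => h (c q.1, q.2)) (fun x => sg (c x)).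
- by apply: within_comp cu => [|q /cA //]; exact: cont_within.
- by apply: within_comp ch => [|q /cA //]; apply: cont_within; exact: cyl_continuous.
- exact: cont_comp csg.
- by move=> x /cA; exact: h0.
- by move=> x /cA; exact: h1.
have [H [cH HE]] := descend cH' H'A.
have [|x t Ax|V [cV VE]] := @descend X (fun q => U' q.1) (fun q => u q.1).
- exact: (cont_comp (@cont_fst _ _)).
- exact: U'A.
exists (fun x => V (x, i0 R)), H; split.
- by split=> //; exact: cont_at_fstT.
- move=> x; have [x' <-] := csurj x => /cA Ax'.
  by rewrite VE /= U'A.
- move=> x t; have [x' <-] := csurj x => /cA Ax'.
  by rewrite HE H'A.
- by move=> x; have [x' <-] := csurj x; rewrite HE VE H'0.
- by move=> x; have [x' <-] := csurj x; rewrite HE H'1.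
Qed.

End RelativeHomeomorphism.

(** * The collapse of the cube onto the simplex *)

Definition simplex_boundary n : set (Delta R n) :=
  [set x : Delta R n | exists i, val x ord0 i = 0].

Section Collapse.
Variable n : nat.

(** The value 0 for the missing coordinate makes the formula for the last
    barycentric coordinate the same as for the others. *)
Definition coord_ext (s : cube R n) (k : nat) : R :=
  if insub k is Some i then val s ord0 (i : 'I_n) else 0.

Definition coord_prod (s : cube R n) (k : nat) : R := \prod_(i < k) coord_ext s i.

Lemma coord_extE s (i : 'I_n) : coord_ext s i = val s ord0 i.
Proof. by rewrite /coord_ext valK. Qed.

Lemma coord_ext_n s : coord_ext s n = 0.
Proof. by rewrite /coord_ext insubF // ltnn. Qed.

Lemma coord_ext_bounds s k : 0 <= coord_ext s k <= 1.
Proof.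
rewrite /coord_ext; case: insub => [i|]; last by rewrite lexx ler01.
exact: cube_bounds.
Qed.

Lemma coord_prodS s k : coord_prod s k.+1 = coord_prod s k * coord_ext s k.
Proof. by rewrite /coord_prod big_ord_recr. Qed.

Lemma coord_prod_ge0 s k : 0 <= coord_prod s k.
Proof. by apply: prodr_ge0 => i _; have /andP[] := coord_ext_bounds s i. Qed.

Lemma coord_prod_le s k : coord_prod s k.+1 <= coord_prod s k.
Proof.
rewrite coord_prodS ler_piMr ?coord_prod_ge0 //.
by have /andP[] := coord_ext_bounds s k.
Qed.

Lemma collapse_in (s : cube R n) :
  (\row_j (coord_prod s j - coord_prod s j.+1)) \in simplex R n.
Proof.
apply/mem_set; split=> [i|]; first by rewrite mxE subr_ge0 coord_prod_le.
under eq_bigr do rewrite mxE.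
rewrite -(big_mkord xpredT (fun j => coord_prod s j - coord_prod s j.+1)).
rewrite -[LHS]opprK -sumrN; under eq_bigr do rewrite opprB.
rewrite telescope_sumr // coord_prodS coord_ext_n mulr0 sub0r opprK.
by rewrite /coord_prod big_ord0.
Qed.

(** The barycentric coordinates are [1 - t_0], [t_0 * (1 - t_1)], and so on up
    to the full product. Off the boundary of the cube the [t_i] are recovered
    as quotients of successive products. *)
Definition collapse (s : cube R n) : Delta R n :=
  exist (fun y => y \in simplex R n) _ (collapse_in s).

Lemma collapseE s j : val (collapse s) ord0 j = coord_prod s j * (1 - coord_ext s j).
Proof. by rewrite /= mxE coord_prodS mulrBr mulr1. Qed.

Lemma cont_coord_ext k : continuous (fun s => coord_ext s k).
Proof.
rewrite /coord_ext; case: insub => [i|]; last exact: cont_const.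
exact: cont_cube_coord.
Qed.

Lemma cont_coord_prod k : continuous (fun s => coord_prod s k).
Proof. by apply: cont_prod => i; exact: cont_coord_ext. Qed.

Lemma cont_collapse : continuous collapse.
Proof.
apply: continuous_to_simplex => j; under eq_fun do rewrite collapseE.
apply: contM; first exact: cont_coord_prod.
by apply: contB; [exact: cont_const|exact: cont_coord_ext].
Qed.

Lemma collapse_boundary s : simplex_boundary (collapse s) <-> cube_boundary s.
Proof.
split=> [[j]|[k]].
  move=> /eqP; rewrite collapseE mulf_eq0 => /orP[|].
    rewrite /coord_prod prodf_seq_eq0 => /hasP[i _ /=].
    rewrite /coord_ext; have ij := ltn_ord i; have jn := ltn_ord j.
    rewrite insubT ?(leq_trans ij) //= => in_ /eqP s0.
    by exists (Sub (val i) in_); left.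
  rewrite subr_eq0 /coord_ext; case: insub => [i /eqP si|]; last by rewrite oner_eq0.
  by exists i; right.
case=> sk.
  exists ord_max; rewrite collapseE /coord_prod (bigD1 k) //=.
  by rewrite coord_extE sk !mul0r.
exists (widen_ord (leqnSn n) k); rewrite collapseE /= coord_extE sk.
by rewrite subrr mulr0.
Qed.

Lemma collapse_prod s s' : collapse s = collapse s' ->
  forall k, (k <= n)%N -> coord_prod s k = coord_prod s' k.
Proof.
move=> ss'; elim=> [|k IHk] kn; first by rewrite /coord_prod !big_ord0.
have := congr1 (fun x : Delta R n => val x ord0 (inord k)) ss'.
rewrite /= !mxE inordK 1?ltnS 1?ltnW // IHk 1?ltnW //.
by move/addrI/oppr_inj.
Qed.

Lemma collapse_inj s s' : collapse s = collapse s' -> ~ cube_boundary s -> s = s'.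
Proof.
move=> /collapse_prod ss' bs; apply: cube_eq => k.
have s0 (i : 'I_n) : val s ord0 i != 0.
  by apply/eqP => si; apply: bs; exists i; left.
have := ss' k.+1 (ltn_ord k); rewrite !coord_prodS !coord_extE -ss' ?(ltnW (ltn_ord k)) //.
apply: mulfI; rewrite prodf_seq_neq0; apply/allP => i _ /=.
have ik : (i < n)%N by exact: ltn_trans (ltn_ord i) (ltn_ord k).
by rewrite -[nat_of_ord i]/(nat_of_ord (Ordinal ik)) coord_extE.
Qed.

Lemma collapse_surj x : exists s, collapse s = x.
Proof.
pose Q k := 1 - \sum_(i < n.+1 | (i < k)%N) val x ord0 i.
have [x0 x1] := set_mem (valP x).
have QS (k : 'I_n.+1) : Q k.+1 = Q k - val x ord0 k.
  rewrite /Q -addrA -opprD; congr (1 - _).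
  rewrite (bigD1 k) //= addrC; congr (_ + _); apply: eq_bigl => i.
  by rewrite ltnS ltn_neqAle andbC.
have Q0 : Q 0%N = 1 by rewrite /Q big_pred0 ?subr0.
have Qn : Q n.+1 = 0.
  by rewrite /Q -[X in X - _]x1; apply/eqP; rewrite subr_eq0; apply/eqP; apply: eq_bigl => i; rewrite ltn_ord.
have Qge k : (k <= n.+1)%N -> 0 <= Q k.
  move=> kn; rewrite /Q subr_ge0 -[X in _ <= X]x1 [X in _ <= X](bigID (fun i : 'I_n.+1 => (i < k)%N)) /=.
  by rewrite lerDl; apply: sumr_ge0 => i _; exact: x0.
pose s := to_cube (n := n) (fun k : 'I_n => if Q k == 0 then 0 else Q k.+1 / Q k).
have Qle (k : 'I_n.+1) : Q k.+1 <= Q k by rewrite QS gerBl; exact: x0.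
have sE (k : 'I_n) : val s ord0 k = if Q k == 0 then 0 else Q k.+1 / Q k.
  rewrite val_to_cube //; case: eqP => [_|/eqP Qk0]; first by rewrite lexx ler01.
  have kn := ltn_ord k.
  have Qk : 0 < Q k by rewrite lt_def Qk0 Qge // leqW // ltnW.
  have Qk1 : 0 <= Q k.+1 by apply: Qge; exact: leqW.
  rewrite divr_ge0 ?(ltW Qk) //=.
  by rewrite ler_pdivrMr // mul1r (Qle (widen_ord (leqnSn n) k)).
have PQ k : (k <= n)%N -> coord_prod s k = Q k.
  elim: k => [|k IHk] kn; first by rewrite /coord_prod big_ord0 Q0.
  rewrite coord_prodS IHk 1?ltnW // (coord_extE s (Ordinal kn)) sE /=.
  case: eqP => [Qk|/eqP Qk]; last by rewrite mulrCA mulfV ?mulr1.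
  rewrite mulr0; apply/esym/eqP; rewrite eq_le Qge ?andbT; last by rewrite ltnW.
  by rewrite -[X in _ <= X]Qk (Qle (Ordinal (ltnW kn : (k < n.+1)%N))).
exists s; apply: val_inj; apply/rowP => j; rewrite /= mxE (PQ j); last by rewrite -ltnS.
have -> : coord_prod s j.+1 = Q j.+1; last by rewrite QS opprB addrC subrK.
have := ltn_ord j; rewrite ltnS leq_eqVlt => /orP[/eqP jn|]; last exact: PQ.
by rewrite coord_prodS jn coord_ext_n mulr0 Qn.
Qed.

End Collapse.

Lemma HEP_simplex m : HEP R (@simplex_boundary m.+1).
Proof.
apply: (HEP_quotient _ _ (@cont_collapse m.+1) (@collapse_surj m.+1)
  (@collapse_boundary m.+1) (@collapse_inj m.+1)).
- exact: compact_cube.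
- exact: hausdorff_Delta_unit.
- exact: HEP_cube.
Qed.

Lemma HELP_simplex (X Y : topologicalType) (f : continuousType X Y) m :
  weak_homotopy_equivalence R f -> HELP R f (@simplex_boundary m.+1).
Proof.
move=> wf.
have hprism : HELP R f (@prism_boundary R m) by exact: HELP_prism.
have cP : compact [set: (cube R m * I)%type].
  by apply: compact_prod; [exact: compact_cube|exact: compact_unit].
apply: (@HELP_quotient _ _ _ _ (fun p => collapse (pack p)) cP
  (@hausdorff_Delta_unit _) _ _ _ _ _ _ _ hprism).
- exact: (cont_comp (@cont_pack R m) (@cont_collapse _)).
- move=> x; have [z <-] := collapse_surj x.
  by exists (unpack z); rewrite unpackK.
- by move=> p; rewrite collapse_boundary pack_boundary.
- move=> p p' pp' np; rewrite -[p]packK -[p']packK; congr unpack.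
  by apply: collapse_inj pp' _ => /pack_boundary.
Qed.

(** * Faces of the simplex *)

Definition dmap n (i : nat) : Delta R n -> Delta R n.+1 :=
  simplex_map R (fun k : 'I_n.+1 => inord (bump i k) : 'I_n.+2).

(** A left inverse of the face map [dmap i]. For [i = n.+1] the vertex [i] is
    sent to an arbitrary vertex, the value of [inord] out of range; this does
    not affect [smap i] on the face, where the coordinate [i] vanishes. *)
Definition smap n (i : nat) : Delta R n.+1 -> Delta R n :=
  simplex_map R (fun k : 'I_n.+2 => inord (unbump i k) : 'I_n.+1).

Lemma cont_dmap n i : continuous (@dmap n i).
Proof. exact: simplex_fun_continuous. Qed.

Lemma cont_smap n i : continuous (@smap n i).
Proof. exact: simplex_fun_continuous. Qed.

Lemma dmap_dmap n i j (x : Delta R n) : (i <= j)%N ->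
  dmap j.+1 (dmap i x) = dmap i (dmap j x).
Proof.
move=> ij; rewrite /dmap !simplex_map_comp; congr (simplex_map R _ x).
apply/funext => k /=; congr inord.
have bk l : (bump l k < n.+2)%N by rewrite ltnS leq_bump_succ // -ltnS.
by rewrite !inordK //; exact: (bump_bump ij k).
Qed.

Lemma inord_bump n (i : 'I_n.+2) (k : 'I_n.+1) : inord (bump i k) = lift i k.
Proof. by apply: val_inj; rewrite /= inordK // ltnS leq_bump_succ // -ltnS. Qed.

Lemma dmap_lift n (i : 'I_n.+2) (x : Delta R n) k :
  val (dmap i x) ord0 (lift i k) = val x ord0 k.
Proof.
rewrite /= mxE (big_pred1 k) // => k'; rewrite inord_bump.
by rewrite (inj_eq lift_inj).
Qed.

Lemma dmap_omitted n (i : 'I_n.+2) (x : Delta R n) : val (dmap i x) ord0 i = 0.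
Proof.
rewrite /= mxE big_pred0 // => k'; rewrite inord_bump.
by apply/negbTE; rewrite eq_sym neq_lift.
Qed.

Lemma smapK n (i : 'I_n.+2) (x : Delta R n) : smap i (dmap i x) = x.
Proof.
rewrite /smap /dmap simplex_map_comp -[RHS]simplex_map_id.
congr (simplex_map R _ x); apply/funext => k /=.
by apply: val_inj; rewrite inord_bump /= bumpK inordK.
Qed.

Lemma dmapK n (i : 'I_n.+2) (x : Delta R n.+1) :
  val x ord0 i = 0 -> dmap i (smap i x) = x.
Proof.
move=> xi; rewrite /smap /dmap simplex_map_comp.
apply: val_inj; apply/rowP => j; rewrite /= mxE.
have cE k : k != i -> (inord (bump i (inord (unbump i k) : 'I_n.+1)) : 'I_n.+2) = k.
  case: (unliftP i k) => [k' ->|->]; last by rewrite eqxx.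
  by move=> _; rewrite /= bumpK inord_val inord_bump.
rewrite (bigID (pred1 i)) /= big1 ?add0r => [|k /andP[_ /eqP ->] //].
have [->|ji] := eqVneq j i.
  rewrite xi big1 // => k /andP[/eqP kj ki].
  by rewrite cE // in kj; rewrite kj eqxx in ki.
rewrite (big_pred1 j) // => k /=; have [->|ki] := eqVneq k i.
  by rewrite andbF eq_sym (negbTE ji).
by rewrite cE // andbT.
Qed.

Definition face_compatible n (P : topologicalType) (Z : Type) :
    (nat -> Delta R n * P -> Z) -> Prop :=
  match n with
  | 0 => fun _ => True
  | m.+1 => fun g => forall i j, (i <= j <= m.+1)%N ->
      forall x t, g j.+1 (dmap i x, t) = g i (dmap j x, t)
  end.

(** A point on several faces receives the same value from each of them,
    because it comes from a common face of these. The parameter space [P]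
    serves to glue homotopies. *)
Lemma glue_faces n (P Z : topologicalType) (g : nat -> Delta R n * P -> Z) :
  (forall i, (i <= n.+1)%N -> continuous (g i)) -> face_compatible g ->
  exists G : Delta R n.+1 * P -> Z,
    {within [set q | simplex_boundary q.1], continuous G} /\
    forall i, (i <= n.+1)%N -> forall x t, G (dmap i x, t) = g i (x, t).
Proof.
move=> cg gg.
have key (y : Delta R n) (i : 'I_n.+1) j t : (i <= j <= n)%N -> val y ord0 i = 0 ->
    g j.+1 (y, t) = g i (smap i (dmap j.+1 y), t).
  case: n g {cg} gg y i => [|m] g gg y i ij yi.
    have [_] := set_mem (valP y); rewrite big_ord1 => /eqP.
    by rewrite (ord1 i) in yi; rewrite [X in X == _]yi eq_sym oner_eq0.
  have /andP[lij _] := ij; have yz := dmapK yi; set z := smap _ y in yz.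
  rewrite -yz dmap_dmap // (smapK (widen_ord (leqnSn _) i)) gg //.
have lt_agree (i j : 'I_n.+2) (x : Delta R n.+1) t : (i < j)%N ->
    val x ord0 i = 0 -> val x ord0 j = 0 -> g i (smap i x, t) = g j (smap j x, t).
  move=> ij xi xj; have xy := dmapK xj; set y := smap j x in xy *.
  have i1n : (i < n.+1)%N by rewrite (leq_trans ij) // -ltnS.
  have ii' : i = lift j (Ordinal i1n).
    by apply: val_inj; rewrite /= /bump leqNgt ij.
  have yi : val y ord0 (Ordinal i1n) = 0 by rewrite -(dmap_lift j) -ii' xy.
  have jE : nat_of_ord j = j.-1.+1 by rewrite prednK // (leq_ltn_trans _ ij).
  clearbody y; rewrite -xy [in RHS]jE (key y (Ordinal i1n)) -?jE //.
  by have := ltn_ord j; rewrite /=; lia.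
have agree (i j : 'I_n.+2) (x : Delta R n.+1) t : val x ord0 i = 0 -> val x ord0 j = 0 ->
    g i (smap i x, t) = g j (smap j x, t).
  move=> xi xj; case: (ltngtP i j) => [ij|ji|/val_inj -> //].
    exact: lt_agree.
  exact/esym/lt_agree.
pose G (q : Delta R n.+1 * P) : Z :=
  let i := odflt ord0 [pick i | val q.1 ord0 i == 0] in g i (smap i q.1, q.2).
have GE (i : 'I_n.+2) (x : Delta R n.+1) t : val x ord0 i = 0 -> G (x, t) = g i (smap i x, t).
  move=> xi; rewrite /G; case: pickP => [j /eqP xj|/(_ i)] /=.
    exact: agree.
  by rewrite xi eqxx.
exists G; split=> [|i im x t]; last first.
  pose i' : 'I_n.+2 := Ordinal (im : (i < n.+2)%N).
  rewrite -[i]/(nat_of_ord i') (GE i') ?smapK //; exact: dmap_omitted.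
apply: (@within_glue 'I_n.+2 _ _ _ (fun i => [set q : Delta R n.+1 * P | val q.1 ord0 i = 0])).
- by [].
- move=> i; apply: (closed_preimage (f := fun q : Delta R n.+1 * P => val q.1 ord0 i) (B := [set 0])).
    exact: (cont_comp (@cont_fst _ _) (@simplex_coordP R n.+1 i)).
  exact: closed_eq.
- move=> i; apply: (within_eq (f := fun q => g i (smap i q.1, q.2))).
    by move=> [x t] xi; rewrite (GE i).
  apply: cont_within; apply: cont_comp; last by apply: cg; rewrite -ltnS.
  apply: cont_pair; last exact: cont_snd.
  exact: (cont_comp (@cont_fst _ _) (@cont_smap n i)).
Qed.

End Quotient.

(** * Path cells *)

Section PathCells.
Variables (R : realType) (X Y : topologicalType) (f : continuousType X Y).
Local Notation I := (unit_interval R).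
Local Notation i0 := (i0 R).
Local Notation i1 := (i1 R).

(** The singular simplices of the mapping path space of [f], with the time
    parameter of the path kept as a second argument. *)
Record pathCell n := PathCell {
  pbase : sing R X n;
  ptrack : continuousType (Delta R n * I)%type Y;
  ptrack0 : forall x, ptrack (x, i0) = f (pbase x) }.

Lemma pathCell_inj n (e e' : pathCell n) :
  pbase e = pbase e' -> ptrack e =1 ptrack e' -> e = e'.
Proof.
case: e e' => [b k k0] [b' k' k'0] bb' /continuousEP kk'.
have {}bb' : b = b' := bb'; have {}kk' : k = k' := kk'.
by subst b' k'; congr PathCell; exact: Prop_irrelevance.
Qed.

Lemma cont_dmap_cyl n i : continuous (fun q : Delta R n * I => (dmap i q.1, q.2)).
Proof.
apply: cont_pair; last exact: cont_snd.
exact: (cont_comp (@cont_fst _ _) (@cont_dmap R n i)).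
Qed.

Lemma pathCell_face_subproof n i (e : pathCell n.+1) x :
  (ptrack e \o mkcts (@cont_dmap_cyl n i)) (x, i0) =
  f (@face (singular R X) n i (pbase e) x).
Proof. exact: ptrack0. Qed.

Definition pathCell_face n i (e : pathCell n.+1) : pathCell n :=
  @PathCell n (@face (singular R X) n i (pbase e))
    (ptrack e \o mkcts (@cont_dmap_cyl n i)) (pathCell_face_subproof i e).

Lemma pathCell_face_face n i j (e : pathCell n.+2) : (i <= j)%N ->
  pathCell_face i (pathCell_face j.+1 e) = pathCell_face j (pathCell_face i e).
Proof.
move=> ij; apply: pathCell_inj => [|[x t]]; first exact: (@face_face (singular R X)).
exact: (congr1 (fun z => ptrack e (z, t)) (dmap_dmap x ij)).
Qed.

Definition pathCells : semiSimplicial :=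
  @SemiSimplicial pathCell pathCell_face pathCell_face_face.

Definition start_map : ssMap pathCells (singular R X) :=
  @SSMap pathCells (singular R X) (fun n e => pbase e) (fun n i e => erefl).

Lemma cont_track1 n (e : pathCell n) : continuous (fun x => ptrack e (x, i1)).
Proof. by apply: cont_at_fstT; exact: cts_fun. Qed.

Definition pathCell_end n (e : pathCell n) : sing R Y n := mkcts (@cont_track1 n e).

Lemma pathCell_end_face n i (e : pathCell n.+1) :
  pathCell_end (pathCell_face i e) = @face (singular R Y) n i (pathCell_end e).
Proof. exact/continuousEP. Qed.

Definition end_map : ssMap pathCells (singular R Y) :=
  @SSMap pathCells (singular R Y) pathCell_end pathCell_end_face.

Lemma cont_const_track n (s : sing R X n) :
  continuous (fun q : Delta R n * I => f (s q.1)).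
Proof.
apply: cont_comp (@underlying_continuous _ _ f).
by apply: (cont_comp (@cont_fst _ _)); exact: cts_fun.
Qed.

Definition const_cell n (s : sing R X n) : pathCell n :=
  @PathCell n s (mkcts (@cont_const_track n s)) (fun x => erefl).

Lemma const_cell_face n i (s : singular R X n.+1) :
  const_cell (face i s) = pathCell_face i (const_cell s).
Proof. exact: pathCell_inj. Qed.

Definition const_map : ssMap (singular R X) pathCells :=
  @SSMap (singular R X) pathCells const_cell const_cell_face.

Lemma sing_comp_face n i (s : singular R X n.+1) :
  (f \o (face i s : sing R X n) : continuousType _ _) =
  @face (singular R Y) n i (f \o (s : sing R X n.+1) : continuousType _ _).
Proof. exact/continuousEP. Qed.

Definition sing_map : ssMap (singular R X) (singular R Y) :=
  @SSMap (singular R X) (singular R Y)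
    (fun n (s : sing R X n) => (f \o s : continuousType _ _)) sing_comp_face.

Lemma end_const n (s : singular R X n) : end_map n (const_map n s) = sing_map n s.
Proof. exact/continuousEP. Qed.

Lemma cont_base n (e : pathCell n) : continuous (fun q : Delta R n * I => pbase e q.1).
Proof. by apply: (cont_comp (@cont_fst _ _)); exact: cts_fun. Qed.

Lemma compatible_track n (u : nat -> pathCells n) : compatible u ->
  face_compatible (fun i => ptrack (u i) : Delta R n * I -> Y).
Proof.
case: n u => [//|n] u cu i j ij x t.
exact: (congr1 (fun e : pathCell n => ptrack e (x, t)) (cu i j ij)).
Qed.

Lemma compatible_base n (u : nat -> pathCells n) : compatible u ->
  face_compatible (fun i (q : Delta R n * I) => pbase (u i) q.1).
Proof.
case: n u => [//|n] u cu i j ij x t.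
exact: (congr1 (fun e : pathCell n => pbase e x) (cu i j ij)).
Qed.

Lemma dmap_boundary n i (z : Delta R n) : (i <= n.+1)%N -> simplex_boundary (dmap i z).
Proof.
move=> im; exists (inord i).
by rewrite -[i in dmap i](inordK (im : i < n.+2)%N) dmap_omitted.
Qed.

Lemma simplex_boundary_face n (x : Delta R n.+1) : simplex_boundary x ->
  exists2 i, (i <= n.+1)%N & exists z, x = dmap i z.
Proof.
move=> [i xi]; exists (nat_of_ord i); first by rewrite -ltnS.
by exists (smap i x); rewrite dmapK.
Qed.

(** Paths given on the boundary extend over the simplex once their starting
    points do. *)
Lemma start_lifts : lifts_boundaries start_map.
Proof.
split=> [y|n y u pu cu]; first by exists (const_cell y).
have [|G [cG GE]] := glue_faces _ (compatible_track cu).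
  by move=> i _; exact: cts_fun.
have cfy : continuous (fun x => f ((y : sing R X n.+1) x)).
  by apply: cont_comp (@underlying_continuous _ _ f); exact: cts_fun.
have [|E [cE E0 EG]] := @HEP_simplex R n _ _ G cfy cG.
  move=> x /simplex_boundary_face[i im [z ->]].
  rewrite GE // ptrack0; congr (f _).
  exact: (congr1 (fun s : sing R X n => s z) (pu i im)).
exists (@PathCell n.+1 y (mkcts cE) E0) => // i im.
apply: pathCell_inj; first exact/esym/pu.
by move=> [x t]; rewrite -GE // -EG //; exact: dmap_boundary.
Qed.

Hypothesis wf : weak_homotopy_equivalence R f.

Lemma Delta0_eq (x y : Delta R 0) : x = y.
Proof.
apply: val_inj; apply/rowP => i; rewrite (ord1 i).
have [_] := set_mem (valP x); have [_] := set_mem (valP y).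
by rewrite !big_ord1 => -> ->.
Qed.

(** In degree 0 this is surjectivity on path components; in higher degrees it
    is the homotopy extension and lifting property for the boundary of the
    simplex. *)
Lemma end_lifts : lifts_boundaries end_map.
Proof.
split=> [y|n y u pu cu].
  pose d : Delta R 0 := collapse (to_cube (fun=> 0)).
  have [x [g [g0 g1]]] := wf.1.2 ((y : sing R Y 0) d).
  have cg : continuous (fun q : Delta R 0 * I => g q.2).
    by apply: (cont_comp (@cont_snd _ _)); exact: cts_fun.
  have g0' z : mkcts cg (z, i0) = f (mkcts (@cont_const (Delta R 0) _ x) z).
    by apply: g0; rewrite val_i0.
  exists (@PathCell 0 (mkcts (@cont_const _ _ x)) (mkcts cg) g0').
  apply/continuousEP => z; rewrite [z](Delta0_eq z d).
  by apply: g1; rewrite val_i1.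
have [|G [cG GE]] := glue_faces _ (compatible_track cu).
  by move=> i _; exact: cts_fun.
have [|B [cB BE]] := glue_faces _ (compatible_base cu).
  by move=> i _; exact: cont_base.
have cy : continuous (fun x => (y : sing R Y n.+1) x) by exact: cts_fun.
have [|x|x|U [H [[cU cH] UB HG H0 H1]]] :=
  @HELP_simplex R X Y f n wf (fun x => B (x, i0)) G (fun x => (y : sing R Y n.+1) x) _ cG cy.
- exact: cont_at_fst cB.
- move=> /simplex_boundary_face[i im [z ->]].
  by rewrite GE // BE // ptrack0.
- move=> /simplex_boundary_face[i im [z ->]].
  by rewrite GE //; exact: (congr1 (fun s : sing R Y n => s z) (pu i im)).
exists (@PathCell n.+1 (mkcts cU) (mkcts cH) H0).
  by apply/continuousEP => x; exact: H1.
move=> i im; apply: pathCell_inj => [|[x t]].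
  apply/continuousEP => x; apply: etrans (UB _ (dmap_boundary x im)) _; exact: BE.
by apply: etrans (HG _ t (dmap_boundary x im)) _; exact: GE.
Qed.

End PathCells.

(** * Cohomology of weakly equivalent spaces *)

Section Cohomology.
Variables (R : realType) (K : fieldType).

Lemma exact_is_coboundary (X : topologicalType) n (z : cocycle R K X n) :
  exact_cochain (T := singular R X) (val z) <-> is_coboundary z.
Proof.
case: n z => [|n] z; split.
- by move=> z0; apply/eqP/funext => s; exact: z0.
- by move=> /eqP z0 s; rewrite z0.
- by move=> [b bE]; apply/asboolP; exists b; apply/funext => s; rewrite bE.
- by move=> /asboolP[b bE]; exists b => s; rewrite -bE.
Qed.

Lemma cocycle_sdelta (X : topologicalType) n (z : cocycle R K X n) s :
  sdelta (T := singular R X) (val z) s = 0.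
Proof. exact: (congr1 (fun c => c s) (cocycleP z)). Qed.

Lemma cohomology_class_eq0 (X : topologicalType) n (z : cocycle R K X n) :
  cohomology_class z = 0 <-> is_coboundary z.
Proof.
rewrite -[X in X <-> _]/(_ = _).
have -> : (0 : cohomology_group R K X n) = cohomology_class 0 by exact/esym/raddf0.
by rewrite cohomology_groupP subr0.
Qed.

Lemma exact_cochainD (T : semiSimplicial) n (c c' d : T n -> K) :
  exact_cochain c -> exact_cochain c' -> (forall e, d e = c e + c' e) ->
  exact_cochain d.
Proof.
move=> ec ec' dE.
have e0 : exact_cochain (fun e => 0 - c' e).
  apply: exact_cochainB ec'.
  have := exact_cochainB ec ec; apply: eq_exact_cochain => e; exact: subrr.
apply: eq_exact_cochain (exact_cochainB ec e0) => e.
by rewrite dE sub0r opprK.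
Qed.

Section OneMap.
Variables (X Y : topologicalType) (f : continuousType X Y).

(** The start induces an isomorphism in cohomology, and constant cells are a
    section of it; restriction to constant cells is therefore injective in
    cohomology. *)
Lemma pathCells_from_base n (c : pathCells R f n -> K) :
  (forall e, sdelta c e = 0) ->
  exact_cochain (T := singular R X) (fun s => c (const_map R f n s)) ->
  exact_cochain c.
Proof.
move=> c0 cs; have [a _ ca] := lifting_descend (@start_lifts R X Y f) c0.
have sa : exact_cochain (T := singular R X) a.
  have := exact_cochainB cs (exact_cochain_pull (const_map R f) ca).
  by apply: eq_exact_cochain => s; rewrite opprB addrC subrK.
apply: exact_cochainD ca (exact_cochain_pull (start_map R f) sa) _ => e.
by rewrite subrK.
Qed.

Hypothesis wf : weak_homotopy_equivalence R f.

(** The pullback of a cocycle along the end restricts to its pullback along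
    [f] on constant cells. If the latter is exact, so is the former, and the
    end detects this. *)
Theorem weak_equivalence_cohomology_inj n (x : cohomology R K Y n) :
  cohomology_map R K f n x = 0 -> x = 0.
Proof.
have [z ->] := cohomology_surj x; rewrite /= cohomology_funE.
move=> /cohomology_class_eq0/exact_is_coboundary fz.
apply/cohomology_class_eq0/exact_is_coboundary.
apply: (lifting_exact (end_lifts wf)).
apply: pathCells_from_base => [e|].
  rewrite (sdelta_pull (end_map R f) (val z)); exact: cocycle_sdelta.
by apply: eq_exact_cochain fz => s; rewrite end_const.
Qed.

(** A cocycle on [X], pulled back along the start, descends along the end;
    restriction to constant cells then reads off a preimage. *)
Theorem weak_equivalence_cohomology_surj n (x : cohomology R K X n) :
  exists y : cohomology R K Y n, cohomology_map R K f n y = x.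
Proof.
have [z ->] := cohomology_surj x.
have [|a a0 ca] := lifting_descend (end_lifts wf) (c := fun e => val z (start_map R f n e)).
  by move=> e; rewrite (sdelta_pull (start_map R f) (val z)); exact: cocycle_sdelta.
have az : a \in @is_cocycle R K Y n by apply/eqP/funext => s; exact: a0.
exists (cohomology_class (exist _ a az : cocycle R K Y n)).
rewrite /= cohomology_funE; apply/cohomology_groupP/exact_is_coboundary.
have := exact_cochain_pull (const_map R f) ca.
have e0 : exact_cochain (T := singular R X) (fun _ : singular R X n => 0 : K).
  have := exact_cochainB ca ca; move=> /(exact_cochain_pull (const_map R f)).
  by apply: eq_exact_cochain => s; rewrite subrr.
move=> /(exact_cochainB e0); apply: eq_exact_cochain => s.
by rewrite sub0r opprB end_const.
Qed.

End OneMap.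

(** For path cells of the identity, start and end agree on constant cells, so
    they agree in cohomology. The homotopy sends a simplex [s] to the path
    cell [k s], which starts at [f s] and ends at [g s]. *)
Theorem homotopic_cohomology_map (X Y : topologicalType) (f g : continuousType X Y)
    (H : X * unit_interval R -> Y) :
  continuous H -> (forall x, H (x, i0 R) = f x) -> (forall x, H (x, i1 R) = g x) ->
  forall n (x : cohomology R K Y n),
    cohomology_map R K f n x = cohomology_map R K g n x.
Proof.
move=> cH H0 H1 n x; have [z ->] := cohomology_surj x; rewrite /= !cohomology_funE.
apply/cohomology_groupP/exact_is_coboundary.
pose idY : continuousType Y Y := mkcts (@cont_id Y).
pose T := pathCells R idY.
have cHs m (s : sing R X m) : continuous (fun q : Delta R m * unit_interval R => H (s q.1, q.2)).
  apply: (cont_comp (f := fun q : Delta R m * unit_interval R => (s q.1, q.2))) => //.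
  apply: cont_pair; last exact: cont_snd.
  by apply: (cont_comp (@cont_fst _ _)); exact: cts_fun.
have k0 m (s : sing R X m) y :
    mkcts (cHs m s) (y, i0 R) = idY ((f \o s : continuousType _ _) y) by exact: H0.
pose k m (s : singular R X m) : T m := PathCell (k0 m s).
have kface m i (s : singular R X m.+1) : k m (face i s) = face i (k m.+1 s).
  by apply: pathCell_inj => //; exact/continuousEP.
have dz : exact_cochain (T := T)
    (fun e => val z (start_map R idY n e) - val z (end_map R idY n e)).
  apply: pathCells_from_base => [e|].
    rewrite -[LHS]/(sdelta (T := T) _ e) /sdelta.
    under eq_bigr do rewrite mulrBr.
    rewrite sumrB; have c1 := etrans (sdelta_pull (start_map R idY) (val z) e) (cocycle_sdelta z _).
    have c2 := etrans (sdelta_pull (end_map R idY) (val z) e) (cocycle_sdelta z _).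
    exact: etrans (congr2 (fun a b => a - b) c1 c2) (subrr 0).
  apply: (eq_exact_cochain (T := singular R Y) (c := fun s : sing R Y n => val z s - val z s)) => [s|].
    rewrite end_const; congr (_ - val z _); exact/continuousEP.
  case: n {x} z => [|m] z /=; first by move=> e; rewrite subrr.
  exists (fun=> 0) => e; rewrite subrr /sdelta big1 // => i _; exact: mulr0.
have := exact_cochain_pull (SSMap kface) dz.
apply: eq_exact_cochain => s; congr (val z _ - val z _).
by apply/continuousEP => y; exact: H1.
Qed.

End Cohomology.

(** * Stability of the persistent cup-length *)

Section ImageLengths.

(** A product in the image ring is the image of a product, so the length can
    be tested on sequences in the source. *)
Lemma cup_lengthsP (A B : gradedRing) (f : gradedHom A B) l :
  cup_lengths (image_gradedRing f) l <-> l = 0%N \/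
  exists r : seq (homogeneous A), [/\ size r = l, all (fun x => 0 < tag x)%N r
    & f _ (tagged (hprod r)) != 0].
Proof.
split=> [[->|[s [sl s0 sN0]]]|[->|[r [rl r0 rN0]]]]; try by left.
  right; have [r sr] := gim_corestr_surj s; subst s.
  exists r; split; first by rewrite -sl size_map.
    by move: s0; rewrite all_map.
  by move: sN0; rewrite hmap_hprod; apply: contra => /eqP f0; apply/eqP/val_inj.
right; exists (map (hmap (gim_corestr f)) r); split; first by rewrite size_map.
  by rewrite all_map.
by rewrite hmap_hprod; apply: contra rN0 => /eqP /(congr1 val) /= /eqP.
Qed.

Variables (A B A' B' : gradedRing) (f : gradedHom A B) (f' : gradedHom A' B').

Lemma cup_lengths_inj (u : gradedHom A A') (v : gradedHom B B') :
  (forall p (x : A p), f' p (u p x) = v p (f p x)) ->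
  (forall p (y : B p), v p y = 0 -> y = 0) ->
  cup_lengths (image_gradedRing f) `<=` cup_lengths (image_gradedRing f').
Proof.
move=> fu v0 l /cup_lengthsP[->|[r [rl r0 rN0]]]; first by left.
apply/cup_lengthsP; right; exists (map (hmap u) r); split.
- by rewrite size_map.
- by rewrite all_map.
- by rewrite hmap_hprod fu; apply: contra rN0 => /eqP/v0 ->.
Qed.

Lemma cup_lengths_surj (u : gradedHom A A') (v : gradedHom B B') :
  (forall p (x : A p), f' p (u p x) = v p (f p x)) ->
  (forall p (x' : A' p), exists x, u p x = x') ->
  cup_lengths (image_gradedRing f') `<=` cup_lengths (image_gradedRing f).
Proof.
move=> fu us l /cup_lengthsP[->|[r [rl r0 rN0]]]; first by left.
have [s rs] : exists s, r = map (hmap u) s.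
  elim: r {rl r0 rN0} => [|[p x] r [s ->]]; first by exists [::].
  have [y yx] := us p x; exists (Tagged (gcomp A) y :: s) => /=.
  by congr (_ :: _); rewrite /hmap /= yx.
subst r; apply/cup_lengthsP; right; exists s; split.
- by rewrite -rl size_map.
- by move: r0; rewrite all_map.
- by move: rN0; rewrite hmap_hprod fu; apply: contra => /eqP ->; rewrite ghom0.
Qed.

End ImageLengths.

Section Persistence.
Variables (R : realType) (K : fieldType).

Lemma weak_equivalence_cup (Z X : persistentSpace R)
    (f : forall t, continuousType (Z t) (X t)) :
  natural f -> (forall t, weak_homotopy_equivalence R (f t)) ->
  forall I, cup_fun K X I = cup_fun K Z I.
Proof.
move=> nf wf I; rewrite /cup_fun /len.
have sq p (x : cohomology R K (X (hi I)) p) :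
    cohomology_map R K (Defs.pmap Z (lo_le_hi I)) p (cohomology_map R K (f (hi I)) p x) =
    cohomology_map R K (f (lo I)) p (cohomology_map R K (Defs.pmap X (lo_le_hi I)) p x).
  have h := @cohomology_map_comp R K _ _ _ _ _
    (f (hi I) \o Defs.pmap Z (lo_le_hi I) : continuousType _ _).
  by rewrite -h // -h // => z; exact: nf.
congr (ereal_sup [set _ | _ in _]); apply/seteqP; split.
  by apply: (cup_lengths_inj sq) => p y; exact: weak_equivalence_cohomology_inj.
by apply: (cup_lengths_surj sq) => p y; exact: weak_equivalence_cohomology_surj.
Qed.

Lemma weakly_equivalent_cup (X X' : persistentSpace R) :
  weakly_equivalent X X' -> forall I, cup_fun K X I = cup_fun K X' I.
Proof.
move=> [Z [f [g [nf ng wf wg]]]] I.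
by rewrite (weak_equivalence_cup nf wf) (weak_equivalence_cup ng wg).
Qed.

(** Over the thickened interval the map of [Y] passes through [X] over the
    original interval: go to [X] by [psi], move along [X], and return by
    [phi]. *)
Lemma interleaved_cup_le (e : {nonneg R}) (X Y : persistentSpace R) :
  interleaved e X Y -> forall I, (cup_fun K Y (thicken e I) <= cup_fun K X I)%E.
Proof.
move=> [phi [psi [nphi npsi _ phipsi]]] I.
have lo_le : lo I - e%:num + e%:num <= lo I by rewrite subrK.
have lo_hi : lo I - e%:num + e%:num <= hi I by rewrite subrK; exact: lo_le_hi.
pose v : continuousType (Y (lo I - e%:num)) (X (lo I)) :=
  Defs.pmap X lo_le \o psi (lo I - e%:num).
pose w : continuousType (Y (lo I - e%:num)) (X (hi I)) := Defs.pmap X (lo_le_hi I) \o v.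
apply: ereal_sup_le => _ [l ll <-]; exists l => //.
apply: (cup_lengths_image (u := cohomology_map R K (phi (hi I)))
  (v := cohomology_map R K v)) ll => p x.
transitivity (cohomology_map R K w p (cohomology_map R K (phi (hi I)) p x)).
  apply: cohomology_map_comp => y /=.
  have := phipsi (lo I - e%:num).
  have le2 : lo I - e%:num <= lo I - e%:num + e%:num + e%:num.
    by rewrite -addrA lerDl addr_ge0.
  have le3 : lo I - e%:num + e%:num + e%:num <= hi I + e%:num by rewrite lerD2r.
  move=> /(_ le2 y) phipsiE.
  rewrite (pmap_comp _ _ lo_hi) (nphi _ _ _ le3) phipsiE.
  exact/esym/pmap_comp.
exact: cohomology_map_comp.
Qed.

Lemma interleaved_sym (e : {nonneg R}) (X Y : persistentSpace R) :
  interleaved e X Y -> interleaved e Y X.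
Proof. by move=> [phi [psi [? ? ? ?]]]; exists psi, phi; split. Qed.

Lemma erosion_le_interleaving (X Y X' Y' : persistentSpace R) :
  weakly_equivalent X' X -> weakly_equivalent Y' Y ->
  (erosion_distance (cup K X) (cup K Y) <= interleaving_distance X' Y')%E.
Proof.
move=> XX' YY'; apply: le_ereal_inf_tmp => _ [e il <-].
apply: ereal_inf_lbound; exists e => // I /=.
rewrite -!(weakly_equivalent_cup XX') -!(weakly_equivalent_cup YY').
by split; apply: interleaved_cup_le => //; exact: interleaved_sym.
Qed.

Lemma erosion_le_homotopy_interleaving (X Y : persistentSpace R) :
  (erosion_distance (cup K X) (cup K Y) <= homotopy_interleaving_distance X Y)%E.
Proof.
apply: le_ereal_inf_tmp => _ [X' [Y' [XX' YY' ->]]].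
exact: erosion_le_interleaving.
Qed.

End Persistence.

(** * Maps into and out of realizations *)

Section Realizations.
Variable R : realType.
Local Notation I := (unit_interval R).
Local Notation i0 := (i0 R).
Local Notation i1 := (i1 R).

Section FiniteSums.
Variable V : choiceType.

Lemma fsum_seq (g : V -> R) (r : seq V) : uniq r -> (forall v, g v != 0 -> v \in r) ->
  \sum_(v \in [set: V]) g v = \sum_(v <- r) g v.
Proof.
move=> ur gr; rewrite (fsbigE r) //=.
  by apply: eq_bigl => v; rewrite in_setT.
by move=> v _; apply: contraNeq; exact: gr.
Qed.

Lemma finite_enum (s : set V) : finite_set s -> s !=set0 ->
  exists n (vs : 'I_n.+1 -> V), injective vs /\ range vs = s.
Proof.
move=> /finite_seqP[r rs] [v sv].
have vr : v \in undup r by rewrite mem_undup; have : [set` r] v by rewrite -rs.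
have [n nE] : exists n, size (undup r) = n.+1.
  by case: (undup r) vr => // a r' _; exists (size r').
exists n, (fun i => nth v (undup r) i); split=> [i j /eqP|].
  by rewrite nth_uniq ?undup_uniq ?nE ?ltn_ord // => /eqP/val_inj.
rewrite rs; apply/seteqP; split=> [_ [i _ <-] /=|w /=].
  by rewrite -mem_undup mem_nth // nE.
rewrite -mem_undup => wr.
have iw : (index w (undup r) < n.+1)%N by rewrite -nE index_mem.
by exists (Ordinal iw) => //=; rewrite nth_index.
Qed.

End FiniteSums.

Section OneComplex.
Variables (V : choiceType) (C : simplicialComplex V).

Definition supp (a : realization R C) : set V := [set v | a v != 0].

Lemma finite_supp a : finite_set (supp a).
Proof. exact: simplex_finite (bary_support a). Qed.

Lemma support_simplex (s : set V) (g : V -> R) : simplices C s ->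
  [set v | g v != 0] `<=` s -> \sum_(v \in [set: V]) g v = 1 ->
  simplices C [set v | g v != 0].
Proof.
move=> Cs gs g1; apply: simplex_face Cs gs _.
apply: contrapT => /set0P/negP; rewrite negbK => /eqP g0.
have := g1; rewrite fsbig1 => [/esym/eqP|v _]; first by rewrite oner_eq0.
apply: contrapT => /eqP gv.
by have : [set v | g v != 0] v by []; rewrite g0.
Qed.

Lemma bary_sum_seq (a : realization R C) (r : seq V) : uniq r ->
  (forall v, a v != 0 -> v \in r) -> \sum_(v <- r) a v = 1.
Proof. by move=> ur ar; rewrite -(fsum_seq ur ar) bary_sum. Qed.

Lemma finite_supp_seq (a : realization R C) :
  exists2 r : seq V, uniq r & forall v, (a v != 0) = (v \in r).
Proof.
have /finite_seqP[r rs] := finite_supp a.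
exists (undup r) => [|v]; first exact: undup_uniq.
by rewrite mem_undup; apply/idP/idP => [av|vr]; [have : supp a v by []|
  have : [set` r] v by []]; rewrite ?rs // -rs.
Qed.

Lemma face_coord_vs n (vs : 'I_n.+1 -> V) (x : Delta R n) i :
  injective vs -> face_coord vs x (vs i) = val x ord0 i.
Proof. by move=> vsi; rewrite /face_coord (big_pred1 i) // => j; rewrite /= inj_eq. Qed.

Lemma face_coord_out n (vs : 'I_n.+1 -> V) (x : Delta R n) v :
  ~ range vs v -> face_coord vs x v = 0.
Proof. by move=> nv; apply: big1 => i /eqP iv; case: nv; exists i. Qed.

Section VertexCoordinates.
Variables (n : nat) (vs : 'I_n.+1 -> V).
Hypotheses (vsi : injective vs) (vsC : simplices C (range vs)).

Lemma vertex_coords_in (a : realization R C) : supp a `<=` range vs ->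
  (\row_i a (vs i)) \in simplex R n.
Proof.
move=> avs; apply/mem_set; split=> [i|]; first by rewrite mxE bary_ge0.
under eq_bigr do rewrite mxE.
have ur : uniq [seq vs i | i <- enum 'I_n.+1] by rewrite map_inj_uniq // enum_uniq.
rewrite -(bary_sum_seq (a := a) ur) => [|v /avs[i _ <-]].
  by rewrite big_map big_enum.
by rewrite map_f // mem_enum.
Qed.

Lemma face_map_coords (a : realization R C) (avs : supp a `<=` range vs) :
  face_map vsi vsC (exist (fun y => y \in simplex R n) _ (vertex_coords_in avs)) = a.
Proof.
apply: bary_inj => v /=; have [[i _ <-]|nv] := pselect (range vs v).
  by rewrite face_coord_vs //= mxE.
by rewrite face_coord_out //; apply/esym; apply: contrapT => /eqP/avs.
Qed.

End VertexCoordinates.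

(** Into a single closed simplex, continuity is that of the finitely many
    barycentric coordinates. *)
Lemma to_realization_continuous (P : topologicalType) (F : P -> realization R C)
    (s : set V) : simplices C s -> (forall x, supp (F x) `<=` s) ->
  (forall v, continuous (fun x => F x v)) -> continuous F.
Proof.
move=> Cs Fs cF.
have [n [vs [vsi vss]]] := finite_enum (simplex_finite Cs) (simplex_nonempty Cs).
have vsC : simplices C (range vs) by rewrite vss.
have Fvs x : supp (F x) `<=` range vs by rewrite vss; exact: Fs.
pose G x : Delta R n := exist (fun y => y \in simplex R n) _ (vertex_coords_in vsi (Fvs x)).
have cG : continuous G.
  apply: continuous_to_simplex => j; under eq_fun do rewrite /= mxE.
  exact: cF.
have -> : F = fun x => face_map vsi vsC (G x).
  by apply/funext => x; rewrite face_map_coords.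
exact: (cont_comp cG (@face_map_continuous R V C n vs vsi vsC)).
Qed.

Lemma from_realization_continuous (Z : topologicalType) (F : realization R C -> Z) :
  (forall n (vs : 'I_n.+1 -> V) (vsi : injective vs) (vsC : simplices C (range vs)),
     continuous (fun x => F (face_map vsi vsC x))) -> continuous F.
Proof.
move=> cF; apply/continuousP => A oA; rewrite realization_openE => n vs vsi vsC.
by have /continuousP := cF n vs vsi vsC; apply.
Qed.

(** Every point lies on the closed simplex spanned by its support. *)
Lemma on_face (a : realization R C) :
  exists n (vs : 'I_n.+1 -> V) (vsi : injective vs) (vsC : simplices C (range vs)) x,
    a = face_map vsi vsC x.
Proof.
have [n [vs [vsi vss]]] := finite_enum (finite_supp a) (simplex_nonempty (bary_support a)).
have vsC : simplices C (range vs) by rewrite vss; exact: bary_support.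
have avs : supp a `<=` range vs by rewrite vss.
by exists n, vs, vsi, vsC; eexists; exact/esym/(face_map_coords vsi vsC avs).
Qed.

Lemma unit_compact_nbhs (t : I) (N : set I) : nbhs t N ->
  exists2 M, nbhs t M & closure M `<=` N /\ compact (closure M).
Proof.
move=> tN.
have hI : hausdorff_space I.
  apply: (@hausdorff_separated R) => x y xy; apply: val_inj.
  exact: (xy (fun t => val t) (@cont_unit_val R)).
have [M tM MN] := @compact_regular I t setT hI (@compact_unit R) filterT N tN.
exists M => //; split=> //; apply: (subclosed_compact _ (@compact_unit R)) => //.
exact: closed_closure.
Qed.

(** The cylinder over a realization again carries the coherent topology,
    because the interval is locally compact. Around a point, a compact
    neighbourhood [closure M] of the time is fixed; the points [b] for which
    all of [b] times [closure M] is sent into the given open set form an open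
    set, by the tube lemma on each closed simplex. *)
Lemma from_cylinder_continuous (Z : topologicalType) (W : realization R C * I -> Z) :
  (forall n (vs : 'I_n.+1 -> V) (vsi : injective vs) (vsC : simplices C (range vs)),
     continuous (fun q : Delta R n * I => W (face_map vsi vsC q.1, q.2))) ->
  continuous W.
Proof.
move=> cW [a t0] U WU.
have [U' [oU' WU' U'U]] : exists U', [/\ open U', U' (W (a, t0)) & U' `<=` U].
  by move: WU; rewrite nbhsE => -[U' [oU' WU'] U'U]; exists U'.
have slice : nbhs t0 [set t | U' (W (a, t))].
  have [n [vs [vsi [vsC [x ax]]]]] := on_face a.
  have c1 : continuous (fun t => W (a, t)).
    rewrite ax; apply: (cont_comp (f := fun t => (x, t)) _ (cW n vs vsi vsC)).
    by apply: cont_pair; [exact: cont_const|exact: cont_id].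
  by apply: (c1 t0); apply: open_nbhs_nbhs.
have [M tM [MU cM]] := unit_compact_nbhs slice.
pose T := [set b : realization R C | closure M `<=` [set t | U' (W (b, t))]].
have oT : open T.
  rewrite realization_openE => n vs vsi vsC; rewrite openE => x0 Tx0.
  have /compact_near_coveringP/(_ _ (nbhs x0)
    (fun x t => U' (W (face_map vsi vsC x, t))) _) := cM.
  apply=> t Mt; have := cW n vs vsi vsC (x0, t) U'.
  case; first by apply: open_nbhs_nbhs; split=> //; exact: Tx0.
  move=> [A B] /= [xA tB] ABU; exists (B, A) => //= -[t' x'] /= [Bt' Ax'].
  exact: (ABU (x', t')).
exists (T, M); first by split=> //; apply: open_nbhs_nbhs; split.
by move=> [b t] /= [Tb Mt]; apply: U'U; apply: Tb; exact: subset_closure.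
Qed.

End OneComplex.

Section Contiguity.
Variables (V V' : choiceType) (C : simplicialComplex V) (D : simplicialComplex V').
Variables F G : continuousType (realization R C) (realization R D).
Hypothesis FG : forall s, simplices C s -> exists2 s', simplices D s' &
  forall a, supp a `<=` s -> supp (F a) `<=` s' /\ supp (G a) `<=` s'.

Let mix (q : realization R C * I) (v : V') : R :=
  (1 - val q.2) * F q.1 v + val q.2 * G q.1 v.

Lemma mix_ge0 q v : 0 <= mix q v.
Proof.
have /andP[t0 t1] := unit_bounds q.2.
by rewrite addr_ge0 // mulr_ge0 ?bary_ge0 ?subr_ge0.
Qed.

Lemma mix_supp q s' : supp (F q.1) `<=` s' -> supp (G q.1) `<=` s' ->
  [set v | mix q v != 0] `<=` s'.
Proof.
move=> Fs Gs v; apply: contraPP => nv /=.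
have /negP : ~ (F q.1 v != 0) by move=> /Fs.
have /negP : ~ (G q.1 v != 0) by move=> /Gs.
by rewrite !negbK /mix => /eqP -> /eqP ->; rewrite !mulr0 addr0 eqxx.
Qed.

Lemma mix_sum q : \sum_(v \in [set: V']) mix q v = 1.
Proof.
have [rF uF rFE] := finite_supp_seq (F q.1).
have [rG uG rGE] := finite_supp_seq (G q.1).
pose r := undup (rF ++ rG).
have Fr v : F q.1 v != 0 -> v \in r by rewrite rFE mem_undup mem_cat => ->.
have Gr v : G q.1 v != 0 -> v \in r by rewrite rGE mem_undup mem_cat orbC => ->.
rewrite (fsum_seq (undup_uniq (rF ++ rG))) => [|v mv].
  rewrite big_split /= -!mulr_sumr !bary_sum_seq ?undup_uniq //; ring.
have /(_ [set` r]) sub := @mix_supp q; exact: sub mv.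
Qed.

Lemma mix_simplex q : simplices D [set v | mix q v != 0].
Proof.
have [s' Ds' sub] := FG (bary_support q.1).
have [Fs Gs] := sub q.1 (fun _ x => x).
by apply: (support_simplex Ds') (mix_sum q); exact: mix_supp.
Qed.

(** For contiguous maps the segment between the two images of a point stays
    inside one simplex. *)
Definition straight_line (q : realization R C * I) : realization R D :=
  Realization (mix_ge0 q) (mix_simplex q) (mix_sum q).

Lemma straight_line_continuous : continuous straight_line.
Proof.
apply: from_cylinder_continuous => n vs vsi vsC.
have [s' Ds' sub] := FG vsC.
have sv x : supp (face_map (R := R) vsi vsC x) `<=` range vs.
  move=> v; apply: contraPP => nv; rewrite /supp /= face_coord_out //.
  by rewrite eqxx.
apply: (to_realization_continuous Ds') => [q|v].
  by have [Fs Gs] := sub _ (sv q.1); exact: mix_supp.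
have cf : continuous (fun q : Delta R n * I => face_map (R := R) vsi vsC q.1).
  exact: (cont_comp (@cont_fst _ _) (@face_map_continuous R V C n vs vsi vsC)).
have ct : continuous (fun q : Delta R n * I => val q.2 : R).
  exact: (cont_comp (@cont_snd _ _) (@cont_unit_val R)).
have cv (H : continuousType (realization R C) (realization R D)) :
    continuous (fun q : Delta R n * I => H (face_map (R := R) vsi vsC q.1) v).
  apply: (cont_comp (cont_comp cf _) (@bary_continuous R V' D v)).
  exact: cts_fun.
apply: contD; apply: contM; [|exact: cv|exact: ct|exact: cv].
by apply: contB => //; exact: cont_const.
Qed.

Lemma contiguous_cohomology (K : fieldType) n (x : cohomology R K (realization R D) n) :
  cohomology_map R K F n x = cohomology_map R K G n x.
Proof.
apply: (homotopic_cohomology_map straight_line_continuous) => a;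
  apply: bary_inj => v.
  by rewrite -[LHS]/((1 - val i0) * F a v + val i0 * G a v) val_i0 subr0 mul1r mul0r addr0.
by rewrite -[LHS]/((1 - val i1) * F a v + val i1 * G a v) val_i1 subrr mul1r mul0r add0r.
Qed.

End Contiguity.

Section SimplicialMap.
Variables (V V' : choiceType) (C : simplicialComplex V) (D : simplicialComplex V').
Variable phi : V -> V'.
Hypothesis phiP : forall s, simplices C s -> simplices D (phi @` s).

Let push (a : realization R C) (w : V') : R :=
  \sum_(v \in [set: V]) (if phi v == w then a v else 0).

Lemma push_seq (a : realization R C) (r : seq V) w : uniq r -> (forall v, a v != 0 -> v \in r) ->
  push a w = \sum_(v <- r | phi v == w) a v.
Proof.
move=> ur ar; rewrite /push (fsum_seq ur) -?big_mkcond // => v.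
by case: ifP => // _; [exact: ar|rewrite eqxx].
Qed.

Lemma push_ge0 a w : 0 <= push a w.
Proof.
have [r ur rE] := finite_supp_seq a; rewrite (push_seq w ur) => [|v]; last by rewrite rE.
by apply: sumr_ge0 => v _; exact: bary_ge0.
Qed.

Lemma push_supp a : [set w | push a w != 0] `<=` phi @` supp a.
Proof.
move=> w; apply: contraPP => nw /=; rewrite /push fsbig1 ?eqxx // => v _.
case: eqP => // vw; apply: contrapT => /eqP av; apply: nw.
by exists v.
Qed.

Lemma push_sum a : \sum_(w \in [set: V']) push a w = 1.
Proof.
have [r ur rE] := finite_supp_seq a.
have ar v : a v != 0 -> v \in r by rewrite rE.
rewrite (fsum_seq (undup_uniq (map phi r))) => [|w /push_supp[v av <-]]; last first.
  by rewrite mem_undup map_f // ar.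
under eq_bigr do rewrite (push_seq _ ur ar).
rewrite (exchange_big_dep xpredT) //= -[RHS](bary_sum_seq ur ar).
rewrite big_seq [RHS]big_seq; apply: eq_bigr => v vr.
rewrite big_mkcond (bigD1_seq (phi v)) ?undup_uniq ?mem_undup ?map_f //=.
by rewrite eqxx big1 ?addr0 // => w /negPf; rewrite eq_sym => ->.
Qed.

Definition simplicial_fun (a : realization R C) : realization R D :=
  Realization (push_ge0 a)
    (support_simplex (phiP (bary_support a)) (@push_supp a) (push_sum a)) (push_sum a).

Lemma simplicial_fun_supp a : supp (simplicial_fun a) `<=` phi @` supp a.
Proof. exact: push_supp. Qed.

Lemma simplicial_fun_continuous : continuous simplicial_fun.
Proof.
apply: from_realization_continuous => n vs vsi vsC.
apply: (to_realization_continuous (phiP vsC)) => [x w /simplicial_fun_supp|w].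
  move=> [v av <-]; exists v => //; apply: contrapT => nv.
  by move: av; rewrite /supp /= face_coord_out ?eqxx.
have ur : uniq [seq vs i | i <- enum 'I_n.+1] by rewrite map_inj_uniq // enum_uniq.
have pE x : simplicial_fun (face_map vsi vsC x) w =
    \sum_(i | phi (vs i) == w) val x ord0 i.
  rewrite /= (push_seq w ur) => [|v]; last first.
    move=> /= av; have [[i _ <-]|nv] := pselect (range vs v).
      by rewrite map_f // mem_enum.
    by rewrite face_coord_out ?eqxx in av.
  rewrite big_map big_enum_cond /=; apply: eq_bigr => i _.
  by rewrite face_coord_vs.
under eq_fun do rewrite pE.
exact: simplex_sum_continuous.
Qed.

End SimplicialMap.
End Realizations.

(** * Spaces without non-constant simplices *)

Section ConstantSimplices.
Variables (R : realType) (K : fieldType).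

Lemma sum_signs n : \sum_(i < n) (-1) ^+ i = (odd n)%:R :> K.
Proof.
elim: n => [|n IHn]; first by rewrite big_ord0.
rewrite big_ord_recr /= IHn -signr_odd; case: odd => /=.
  by rewrite expr1 subrr.
by rewrite expr0 add0r.
Qed.

Variable W : topologicalType.
Hypothesis constW : forall n (s : sing R W n) x y, s x = s y.

Lemma sing_op_back n m (f g : nat -> nat) (s : sing R W n) :
  sing_op n f (sing_op m g s) = s.
Proof. by apply/continuousEP => x; exact: (constW s). Qed.

(** A space in which all singular simplices are constant has the cochain
    complex of a set of points: the coboundary is the identity out of odd
    degrees and zero out of even ones. *)
Lemma const_cohomology0 p (x : cohomology R K W p.+1) : x = 0.
Proof.
have [z ->] := cohomology_surj x; apply/cohomology_class_eq0/exact_is_coboundary.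
have faceE n (c : cochain R K W n.+1) (s : sing R W n.+1) (f : nat -> nat) m (g : nat -> nat) :
    c (sing_op n.+1 f (sing_op m g s)) = c s by rewrite sing_op_back.
(* A coboundary is the value on a simplex times an alternating sum of
   signs, which is 1 or 0 by parity: in even degree [p.+1] the cocycle is
   a coboundary, in odd degree it is zero. *)
have [op|ep] := boolP (odd p).
  exists (fun t => val z (sing_op p.+1 (fun=> 0%N) t)) => s.
  rewrite /sdelta; under eq_bigr do rewrite faceE.
  by rewrite -mulr_suml sum_signs /= negbK op mul1r.
have z0 s : val z s = 0.
  have := cocycle_sdelta z (sing_op p.+2 (fun=> 0%N) s).
  rewrite /sdelta; under eq_bigr do rewrite faceE.
  by rewrite -mulr_suml sum_signs /= negbK ep mul1r.
exists (fun=> 0) => s; rewrite z0 /sdelta big1 // => i _; exact: mulr0.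
Qed.

End ConstantSimplices.

Lemma len_eq0 (R : realType) (A : gradedRing) :
  (forall p (x : A p.+1), x = 0) -> len R A = 0%E.
Proof.
move=> A0; rewrite /len.
have -> : cup_lengths A = [set 0%N].
  apply/seteqP; split=> [l [//|[s [sl s0 sN0]]]|_ ->]; last by left.
  case: s sl s0 sN0 => [<- //|[[|p] x] s _ //= _ /eqP[]].
  exact: (A0 (p + tag (hprod s))%N).
by rewrite image_set1 ereal_sup1.
Qed.

Lemma len_ge0 (R : realType) (A : gradedRing) : (0 <= len R A)%E.
Proof. by apply: ereal_sup_ubound; exists 0%N => //; left. Qed.

(** * Vietoris-Rips filtrations *)

Section VietorisRips.
Variables (R : realType) (K : fieldType).

(** Points of the simplex are joined by segments, so the intermediate value
    theorem applies. *)
Lemma two_valued_const n (g : Delta R n -> R) : continuous g ->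
  (forall x, g x = 0 \/ g x = 1) -> forall x y, g x = g y.
Proof.
move=> cg g01 x y.
have mem (t : unit_interval R) :
    ((1 - val t) *: val x + val t *: val y : 'rV[R]_n.+1) \in simplex R n.
  have /andP[t0 t1] := unit_bounds t.
  have [x0 x1] := set_mem (valP x); have [y0 y1] := set_mem (valP y).
  apply/mem_set; split=> [i|].
    by rewrite !mxE addr_ge0 // mulr_ge0 ?subr_ge0.
  under eq_bigr do rewrite !mxE.
  by rewrite big_split /= -!mulr_sumr x1 y1 !mulr1 subrK.
pose seg (t : R) : Delta R n := exist (fun z => z \in simplex R n) _ (mem (to_unit t)).
have cseg : continuous seg.
  apply: continuous_to_simplex => j; under eq_fun do rewrite /= !mxE.
  have cu : continuous (fun t : R => val (to_unit t)).
    exact: (cont_comp (cont_to_unit (@cont_id R)) (@cont_unit_val R)).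
  apply: contD; apply: contM; [|exact: cont_const|exact: cu|exact: cont_const].
  by apply: contB => //; exact: cont_const.
have seg0 : seg 0 = x.
  apply: val_inj; rewrite -[LHS]/((1 - val (i0 R)) *: val x + val (i0 R) *: val y).
  by rewrite val_i0 subr0 scale1r scale0r addr0.
have seg1 : seg 1 = y.
  apply: val_inj; rewrite -[LHS]/((1 - val (i1 R)) *: val x + val (i1 R) *: val y).
  by rewrite val_i1 subrr scale1r scale0r add0r.
have half : forall t, g (seg t) <> 1 / 2.
  by move=> t gt; have := g01 (seg t); rewrite gt; case; lra.
have cgs : {within `[0, 1], continuous (fun t => g (seg t))}.
  by apply: cont_within; exact: cont_comp cg.
have ivt := @IVT R (fun t => g (seg t)) 0 1 (1 / 2) ler01 cgs.
rewrite /= seg0 seg1 in ivt.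
case: (g01 x) (g01 y) => [gx|gx] [gy|gy]; rewrite gx gy in ivt *; rewrite ?gx ?gy //.
  by have [|t _ /half //] := ivt; rewrite ge_min le_max; lra.
by have [|t _ /half //] := ivt; rewrite ge_min le_max; lra.
Qed.

Section Diameter.
Variable X : metricType R.

Lemma diameter_le (s : set X) (t : R) : (diameter s <= t%:E)%E <->
  forall x y, s x -> s y -> mdist x y <= t.
Proof.
split=> [st x y sx sy|st]; last first.
  by apply: ge_ereal_sup => _ [[x y] [sx sy] <-]; rewrite lee_fin; exact: st.
rewrite -lee_fin; apply: le_trans st; apply: ereal_sup_ubound.
by exists (x, y).
Qed.

Lemma vr_simplexP (t : R) (s : set X) : simplices (vr_complex X t) s <->
  [/\ finite_set s, s !=set0 & forall x y, s x -> s y -> mdist x y <= t].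
Proof. by split=> -[? ? /diameter_le ?]. Qed.

(** At scale zero the simplices are the points, so barycentric coordinates
    take the values 0 and 1 only. *)
Lemma vr0_const n (s : sing R (realization R (vr_complex X 0)) n) x y : s x = s y.
Proof.
apply: bary_inj => v.
have cv : continuous (fun x => s x v).
  by apply: (cont_comp _ (@bary_continuous R X (vr_complex X 0) v)); exact: cts_fun.
apply: (two_valued_const cv) => {y} {}x.
have [av|/eqP av] := pselect (s x v = 0); first by left.
right; have /vr_simplexP[_ _ d0] := bary_support (s x).
rewrite -(bary_sum_seq (a := s x) (r := [:: v])) //; first by rewrite big_seq1.
move=> w aw; rewrite mem_seq1; apply/eqP; apply: (@mdist_positivity R X).
by apply/eqP; rewrite eq_le mdist_ge0 andbT; exact: d0.
Qed.

End Diameter.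

Section OneSide.
Variables (X Y : metricType R) (phi : X -> Y) (psi : Y -> X) (e : {nonneg R}).
Hypotheses
  (phi_le : forall x x', mdist (phi x) (phi x') <= mdist x x' + e%:num)
  (psi_le : forall y y', mdist (psi y) (psi y') <= mdist y y' + e%:num)
  (phipsi_le : forall y y', mdist y (phi (psi y')) <= mdist y y' + e%:num).

Lemma vr_image (X' Y' : metricType R) (g : X' -> Y') (s t : R) :
  (forall x x', mdist x x' <= s -> mdist (g x) (g x') <= t) ->
  forall A, simplices (vr_complex X' s) A -> simplices (vr_complex Y' t) (g @` A).
Proof.
move=> gst A /vr_simplexP[fA [x Ax] dA]; apply/vr_simplexP; split.
- exact: finite_image.
- by exists (g x), x.
- by move=> _ _ [a Aa <-] [b Ab <-]; apply: gst; exact: dA.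
Qed.

(** If the thickened interval starts at a scale at most 0, the cohomology of
    [Y] at its start vanishes in positive degrees and the left-hand side is
    zero. Otherwise all scales are positive, and the map of [Y] over the
    thickened interval agrees in cohomology with the composite through [X]. *)
Lemma vr_cup_le (J : Int R) :
  (cup_fun K (vietoris_rips Y) (thicken e J) <= cup_fun K (vietoris_rips X) J)%E.
Proof.
have e0 : 0 <= e%:num by [].
have [lo0|lo0] := leP (lo J - e%:num) 0.
  rewrite {1}/cup_fun len_eq0; first exact: len_ge0.
  move=> p [x xP]; apply: val_inj => /=.
  have cW n (s : sing R (vietoris_rips Y (lo J - e%:num)) n) a b : s a = s b.
    have max0 : Num.max 0 (lo J - e%:num) = 0 by rewrite max_l.
    move: s a b; rewrite /= max0; exact: vr0_const.
  exact: (const_cohomology0 cW).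
have lohi := lo_le_hi J.
have psiS : forall A, simplices (vr_complex Y (Num.max 0 (lo J - e%:num))) A ->
    simplices (vr_complex X (Num.max 0 (lo J))) (psi @` A).
  apply: vr_image => y y' yy'; rewrite max_r ?(ltW lo0) // in yy'.
  apply: le_trans (psi_le y y') _; rewrite le_max; apply/orP; right; lra.
have phiS : forall A, simplices (vr_complex X (Num.max 0 (hi J))) A ->
    simplices (vr_complex Y (Num.max 0 (hi J + e%:num))) (phi @` A).
  apply: vr_image => x x' xx'; rewrite max_r in xx'; last by lra.
  apply: le_trans (phi_le x x') _; rewrite le_max; apply/orP; right; lra.
pose P : continuousType (vietoris_rips X (hi J)) (vietoris_rips Y (hi J + e%:num)) :=
  mkcts (@simplicial_fun_continuous R _ _ _ _ phi phiS).
pose Q : continuousType (vietoris_rips Y (lo J - e%:num)) (vietoris_rips X (lo J)) :=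
  mkcts (@simplicial_fun_continuous R _ _ _ _ psi psiS).
pose M := Defs.pmap (vietoris_rips X) (lo_le_hi J).
pose MQ : continuousType _ _ := M \o Q.
pose F : continuousType _ _ := P \o MQ.
apply: ereal_sup_le => _ [l ll <-]; exists l => //.
apply: (cup_lengths_image (u := cohomology_map R K P) (v := cohomology_map R K Q)) ll => p x.
transitivity (cohomology_map R K F p x); last first.
  apply: etrans (@cohomology_map_comp R K _ _ _ MQ P F (fun=> erefl) p x) _.
  exact: (@cohomology_map_comp R K _ _ _ Q M MQ (fun=> erefl) p).
apply: contiguous_cohomology => s /vr_simplexP[fs s0 ds].
rewrite max_r ?(ltW lo0) // in ds.
have hE : Num.max 0 (hi J + e%:num) = hi J + e%:num by rewrite max_r //; lra.
exists (s `|` (phi \o psi) @` s).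
  apply/vr_simplexP; split.
  - by rewrite finite_setU; split=> //; exact: finite_image.
  - by have [y sy] := s0; exists y; left.
  rewrite hE => y y' [sy|[a sa <-]] [sy'|[b sb <-]] /=.
  - have := ds _ _ sy sy'; lra.
  - have := phipsi_le y b; have := ds _ _ sy sb; lra.
  - rewrite metric_sym; have := phipsi_le y' a; have := ds _ _ sy' sa; lra.
  - have := phi_le (psi a) (psi b); have := psi_le a b; have := ds _ _ sa sb; lra.
move=> a as_; split=> [v /as_|]; first by left.
move=> v Fv; have [w Qw <-] := @simplicial_fun_supp R _ _ _ _ phi phiS (M (Q a)) v Fv.
have [u ua <-] := @simplicial_fun_supp R _ _ _ _ psi psiS a w Qw.
by right; exists u => //; exact: as_.
Qed.

End OneSide.

(** Send a point to one at distance less than [r] in the common space. *)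
Lemma vr_eroded (X Y Z : metricType R) (f : X -> Z) (g : Y -> Z) (r : R) :
  isometric_embedding f -> isometric_embedding g -> 0 < r ->
  range f `<=` \bigcup_(b in range g) ball b r ->
  range g `<=` \bigcup_(a in range f) ball a r ->
  forall e : {nonneg R}, e%:num = 2 * r ->
  eroded e (cup K (vietoris_rips X)) (cup K (vietoris_rips Y)).
Proof.
move=> isof isog r0 fg gf e eE.
have [x|phi phiP] := choice (P := fun (x : X) (y : Y) => mdist (f x) (g y) < r).
  have [_ [y _ <-]] := fg (f x) (imageT f x).
  by rewrite ballEmdist /= metric_sym; exists y.
have [y|psi psiP] := choice (P := fun (y : Y) (x : X) => mdist (g y) (f x) < r).
  have [_ [x _ <-]] := gf (g y) (imageT g y).
  by rewrite ballEmdist /= metric_sym; exists x.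
have side (A B : metricType R) (a : A -> Z) (b : B -> Z) (u : A -> B) :
    isometric_embedding a -> isometric_embedding b ->
    (forall x, mdist (a x) (b (u x)) < r) ->
    forall x x', mdist (u x) (u x') <= mdist x x' + e%:num.
  move=> isoa isob au x x'; rewrite -isoa -isob eE.
  have := metric_triangle (b (u x)) (a x) (b (u x')).
  have := metric_triangle (a x) (a x') (b (u x')).
  have := au x; have := au x'; rewrite (metric_sym (b (u x)) (a x)); lra.
have loop (A B : metricType R) (a : A -> Z) (b : B -> Z) (u : A -> B) (v : B -> A) :
    isometric_embedding a -> isometric_embedding b ->
    (forall x, mdist (a x) (b (u x)) < r) -> (forall y, mdist (b y) (a (v y)) < r) ->
    forall y y', mdist y (u (v y')) <= mdist y y' + e%:num.
  move=> isoa isob au bv y y'; rewrite -!isob eE.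
  have := metric_triangle (b y) (b y') (b (u (v y'))).
  have := metric_triangle (b y') (a (v y')) (b (u (v y'))).
  have := au (v y'); have := bv y'; lra.
move=> J; split; rewrite /=.
- apply: (vr_cup_le (phi := phi) (psi := psi)).
  + exact: side isof isog phiP.
  + exact: side isog isof psiP.
  + exact: loop isof isog phiP psiP.
- apply: (vr_cup_le (phi := psi) (psi := phi)).
  + exact: side isog isof psiP.
  + exact: side isof isog phiP.
  + exact: loop isog isof psiP phiP.
Qed.

Lemma erosion_le_gromov_hausdorff (X Y : metricType R) :
  (erosion_distance (cup K (vietoris_rips X)) (cup K (vietoris_rips Y))
     <= 2%:E * gromov_hausdorff_distance X Y)%E.
Proof.
rewrite -lee_pdivrMl //; apply: le_ereal_inf_tmp => _ [Z [f [g [isof isog ->]]]].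
apply: le_ereal_inf_tmp => _ [r [r0 fg gf] <-]; rewrite lee_pdivrMl //.
have e0 : 0 <= 2 * r by rewrite mulr_ge0 // ltW.
apply: ereal_inf_lbound; exists (NngNum e0) => //.
exact: (vr_eroded isof isog r0 fg gf).
Qed.

End VietorisRips.

Theorem theorem2 (R : realType) (K : fieldType) :
  (forall X Y : persistentSpace R,
     discrete_critical_values K X -> discrete_critical_values K Y ->
     (erosion_distance (cup K X) (cup K Y)
        <= homotopy_interleaving_distance X Y)%E) /\
  (forall X Y : metricType R, compact [set: X] -> compact [set: Y] ->
     (erosion_distance (cup K (vietoris_rips X)) (cup K (vietoris_rips Y))
        <= 2%:E * gromov_hausdorff_distance X Y)%E).
Proof.
split=> X Y _ _; first exact: erosion_le_homotopy_interleaving.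
exact: erosion_le_gromov_hausdorff.
Qed.
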